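(* Let $s>1/2$ and $r_1,r_2\ge 2$. Let $\beta_1,\beta_2$ be integrable kernels on $\mathbb{R}$ with $0\le\widehat{\beta_i}(\xi)\le C_i(1+\xi^2)^{-r_i/2}$ for all $\xi\in\mathbb{R}$ and some constants $C_i>0$, such that $\widehat{\beta_i}$ has only isolated zeros ($i=1,2$). Let $g_1,g_2\in C^\infty(\mathbb{R}^2)$ be real valued with $g_1(0)=g_2(0)=0$ and $g_i=\partial G/\partial u_i$ ($i=1,2$) for a function $G:\mathbb{R}^2\to\mathbb{R}$. Put $f_i(u_1,u_2)=u_i+g_i(u_1,u_2)$ and $F(u_1,u_2)=\frac12(u_1^2+u_2^2)+G(u_1,u_2)$. Let $\varphi_1,\varphi_2,\psi_1,\psi_2\in H^s$. Suppose that $P_1\varphi_1,P_2\varphi_2,P_1\psi_1,P_2\psi_2\in L^2$ and $G(\varphi_1,\varphi_2)\in L^1$. If there is some $\nu>0$ such that $$u_1f_1(u_1,u_2)+u_2f_2(u_1,u_2)\le 2(1+2\nu)F(u_1,u_2)\qquad\text{for all }(u_1,u_2)\in\mathbb{R}^2,$$ and $$E(0)=\|P_1\psi_1\|^2+\|P_2\psi_2\|^2+2\int_{\mathbb{R}}F(\varphi_1,\varphi_2)\,dx<0,$$ then the solution $(u_1,u_2)$ of the Cauchy problem $$u_{1tt}=(\beta_1*(u_1+g_1(u_1,u_2)))_{xx},\qquad u_{2tt}=(\beta_2*(u_2+g_2(u_1,u_2)))_{xx},\qquad x\in\mathbb{R},\ t>0,$$ $$u_i(x,0)=\varphi_i(x),\qquad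 u_{it}(x,0)=\psi_i(x)\qquad(i=1,2)$$ blows up in finite time.
   Context: $H^s=H^s(\mathbb{R})$ is the $L^2$-based Sobolev space of real-valued functions with norm $\|u\|_s^2=\int_{\mathbb{R}}(1+\xi^2)^s|\hat u(\xi)|^2\,d\xi$, where $\hat v(\xi)=\int_{\mathbb{R}}e^{-i\xi x}v(x)\,dx$; $\|\cdot\|$ is the $L^2(\mathbb{R})$ norm; $*$ is convolution in $x$; subscripts $x,t$ denote partial derivatives. For $i=1,2$, $P_i$ is the (possibly unbounded) operator $P_iw=\mathcal{F}^{-1}\big(|\xi|^{-1}(\widehat{\beta_i}(\xi))^{-1/2}\hat w(\xi)\big)$, where $\mathcal{F}^{-1}$ is the inverse Fourier transform; $P_iw\in L^2$ means that $|\xi|^{-1}(\widehat{\beta_i}(\xi))^{-1/2}\hat w(\xi)$ is in $L^2$. The solution is the one with $u_1,u_2\in C^2([0,T_{\max}),H^s)$ on its maximal interval of existence $[0,T_{\max})$. Blow-up in finite time means $T_{\max}<\infty$, which is characterized by $\limsup_{t\to T_{\max}^-}\big(\|U(t)\|_s+\|U_t(t)\|_s\big)=\infty$ with $U=(u_1,u_2)$, $U_t=(u_{1t},u_{2t})$ and $\|U\|_s=\|u_1\|_s+\|u_2\|_s$. *)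

(* Defs.v *)
From mathcomp Require Import all_boot all_order all_algebra.
From mathcomp Require Import all_classical all_reals all_analysis.
From mathcomp Require Import complex.

Set Implicit Arguments.
Unset Strict Implicit.
Unset Printing Implicit Defensive.

Import Order.TTheory GRing.Theory Num.Theory.
Import numFieldNormedType.Exports.
Import ComplexField.Normc.

Local Open Scope classical_set_scope.
Local Open Scope ring_scope.
Local Open Scope complex_scope.

Section Fourier.
Context {R : realType}.
Local Notation mu := (@lebesgue_measure R).

Definition cintegral (D : set R) (h : R -> R[i]) : R[i] :=
  (\int[mu]_(x in D) complex.Re (h x)) +i* (\int[mu]_(x in D) complex.Im (h x)).

Definition expi (theta : R) : R[i] := cos theta +i* sin theta.

(* `normc : R[i] -> R` is the modulus, as a real number *)
Definition L2norm (h : R -> R[i]) : \bar R :=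
  (Lnorm mu 2%:E (fun x => (normc (h x))%:E)).

Definition inL2 (h : R -> R[i]) : Prop :=
  [/\ measurable_fun setT (fun x => complex.Re (h x)),
      measurable_fun setT (fun x => complex.Im (h x)) &
      (L2norm h < +oo)%E].

Definition L2_lim (H : nat -> R -> R[i]) (h : R -> R[i]) : Prop :=
  inL2 h /\ L2norm (fun x => H n x - h x) @[n --> \oo] --> 0%E.

Definition fourierL1 (w : R -> R) (xi : R) : R[i] :=
  cintegral setT (fun x => expi (- (xi * x)) * (w x)%:C).

(* The Fourier transform on L^2 and its inverse are only defined up to null
   sets: a representative of the L^2-limit of the truncated integrals is
   chosen. The value is meaningless if the argument is not in L^2. *)
Definition fourierL2 (w : R -> R[i]) : R -> R[i] :=
  xget (fun=> 0) [set W | L2_lim (fun n xi =>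
    cintegral `[- n%:R, n%:R] (fun x => expi (- (xi * x)) * w x)) W].

Definition ifourierL2 (W : R -> R[i]) : R -> R[i] :=
  xget (fun=> 0) [set w | L2_lim (fun n x =>
    ((2 * pi)^-1)%:C *
    cintegral `[- n%:R, n%:R] (fun xi => expi (xi * x) * W xi)) w].

Definition cfun (w : R -> R) : R -> R[i] := fun x => (w x)%:C.

Definition Hs_norm (s : R) (u : R -> R) : \bar R :=
  ((\int[mu]_xi ((1 + xi ^+ 2) `^ s
     * normc (fourierL2 (cfun u) xi) ^+ 2)%:E) `^ 2^-1)%E.

(* Elements of H^s are represented by real functions, without passing to the
   quotient by equality almost everywhere. This is H^s for s >= 0 only, where
   it is a subspace of L^2. *)
Definition inHs (s : R) (u : R -> R) : Prop :=
  inL2 (cfun u) /\ (Hs_norm s u < +oo)%E.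

(* At the zeros of the denominator the symbol takes the value 0 by the library
   conventions on inverses and powers; this concerns a null set when the
   transform of beta is nonnegative with isolated zeros. *)
Definition P_transform (beta w : R -> R) (xi : R) : R[i] :=
  (`|xi|^-1 * complex.Re (fourierL1 beta xi) `^ (- 2^-1))%:C
  * fourierL2 (cfun w) xi.

Definition P_op (beta w : R -> R) : R -> R[i] :=
  ifourierL2 (P_transform beta w).

Definition P_inL2 (beta w : R -> R) : Prop := inL2 (P_transform beta w).

(* In R[i], `0 <= z <= a%:C` says that z is a real number in [0, a]. *)
Definition kernel_hyp (r : R) (beta : R -> R) : Prop :=
  [/\ mu.-integrable setT (EFin \o beta),
      exists C : R, 0 < C /\ forall xi : R,
        0 <= fourierL1 beta xi <= (C * (1 + xi ^+ 2) `^ (- (r / 2)))%:C &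
      forall xi0 : R, fourierL1 beta xi0 = 0 ->
        \forall xi \near xi0^', fourierL1 beta xi != 0].

Definition convolution (beta f : R -> R) (x : R) : R :=
  \int[mu]_y (beta (x - y) * f y).

Definition test_function (phi : R -> R) : Prop :=
  (forall n x, derivable (derive1n n phi) x 1) /\
  (exists M : R, forall x, M < `|x| -> phi x = 0).

(* w_xx = h in the sense of distributions *)
Definition weak_dxx (w h : R -> R) : Prop :=
  [/\ locally_integrable setT w, locally_integrable setT h &
      forall phi, test_function phi ->
        \int[mu]_x (w x * derive1n 2 phi x) = \int[mu]_x (h x * phi x)].

End Fourier.

Section SmoothPlane.
Context {R : realType}.

Definition dir1 : (R * R)%type := (1, 0).
Definition dir2 : (R * R)%type := (0, 1).

Fixpoint iter_partial (l : seq bool) (f : R * R -> R) : R * R -> R :=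
  if l is b :: l' then
    fun p => 'D_(if b then dir1 else dir2) (iter_partial l' f) p
  else f.

Definition smooth2 (f : R * R -> R) : Prop :=
  forall l, continuous (iter_partial l f) /\
    forall p, derivable (iter_partial l f) p dir1 /\
              derivable (iter_partial l f) p dir2.

End SmoothPlane.

Section Cauchy.
Context {R : realType}.
Local Notation mu := (@lebesgue_measure R).

Definition time_interval (T : \bar R) : set R :=
  [set t | 0 <= t /\ (t%:E < T)%E].

Definition Hs_continuous (s : R) (I : set R) (u : R -> R -> R) : Prop :=
  forall t, I t ->
    Hs_norm s (fun x => u r x - u t x) @[r --> within I (nbhs t)] --> 0%E.

(* u' is the strong derivative of u in H^s, one-sided at an endpoint in I *)
Definition Hs_derivative (s : R) (I : set R) (u u' : R -> R -> R) : Prop :=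
  forall t, I t ->
    Hs_norm s (fun x => (u r x - u t x) / (r - t) - u' t x)
      @[r --> within I t^'] --> 0%E.

Definition C2_Hs (s : R) (I : set R) (u ut utt : R -> R -> R) : Prop :=
  [/\ forall t, I t -> [/\ inHs s (u t), inHs s (ut t) & inHs s (utt t)],
      Hs_derivative s I u ut, Hs_derivative s I ut utt &
      Hs_continuous s I utt].

Definition ae_eq_fun (v w : R -> R) : Prop := {ae mu, forall x, v x = w x}.

(* Arguments of u_i are time first, then space. *)
Definition Cauchy_solution (s : R) (beta1 beta2 : R -> R)
    (g1 g2 : R * R -> R) (phi1 phi2 psi1 psi2 : R -> R)
    (T : \bar R) (u1 u2 : R -> R -> R) : Prop :=
  (0 < T)%E /\
  exists u1t u1tt u2t u2tt : R -> R -> R,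
  [/\ C2_Hs s (time_interval T) u1 u1t u1tt,
      C2_Hs s (time_interval T) u2 u2t u2tt,
      (forall t, 0 < t -> (t%:E < T)%E ->
        weak_dxx (convolution beta1 (fun x => u1 t x + g1 (u1 t x, u2 t x)))
          (u1tt t) /\
        weak_dxx (convolution beta2 (fun x => u2 t x + g2 (u1 t x, u2 t x)))
          (u2tt t)),
      ae_eq_fun (u1 0) phi1 /\ ae_eq_fun (u2 0) phi2 &
      ae_eq_fun (u1t 0) psi1 /\ ae_eq_fun (u2t 0) psi2].

(* [0, T) is the maximal interval of existence: no extension to a longer
   interval is a solution. *)
Definition maximal_solution (s : R) (beta1 beta2 : R -> R)
    (g1 g2 : R * R -> R) (phi1 phi2 psi1 psi2 : R -> R)
    (T : \bar R) (u1 u2 : R -> R -> R) : Prop :=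
  Cauchy_solution s beta1 beta2 g1 g2 phi1 phi2 psi1 psi2 T u1 u2 /\
  forall (T' : \bar R) (v1 v2 : R -> R -> R), (T < T')%E ->
    Cauchy_solution s beta1 beta2 g1 g2 phi1 phi2 psi1 psi2 T' v1 v2 ->
    ~ (forall t, time_interval T t ->
         ae_eq_fun (v1 t) (u1 t) /\ ae_eq_fun (v2 t) (u2 t)).

Definition energy_density (G : R * R -> R) (p : R * R) : R :=
  2^-1 * (p.1 ^+ 2 + p.2 ^+ 2) + G p.

Definition initial_energy (beta1 beta2 : R -> R) (G : R * R -> R)
    (phi1 phi2 psi1 psi2 : R -> R) : \bar R :=
  (L2norm (P_op beta1 psi1) ^+ 2 + L2norm (P_op beta2 psi2) ^+ 2
   + 2%:E * \int[mu]_x (energy_density G (phi1 x, phi2 x))%:E)%E.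

End Cauchy.

(* Main.v *)
From HB Require Import structures.
Require Import Defs.
From mathcomp Require Import all_boot all_order all_algebra.
From mathcomp Require Import all_classical all_reals all_analysis.
From mathcomp Require Import measurable_realfun complex ring lra.
Set Implicit Arguments.
Unset Strict Implicit.
Unset Printing Implicit Defensive.
Import Order.TTheory GRing.Theory Num.Theory.
Import numFieldNormedType.Exports.
Local Open Scope classical_set_scope.
Local Open Scope ring_scope.

(** The proof is Levine's concavity argument. If the solution existed for all times, the function

      K(t) = ||P_1 u_1||^2 + ||P_2 u_2||^2 + b (t + t0)^2,   b = - E(0) > 0,

    would satisfy K K'' >= (1 + nu) K'^2. Then (K / K')' <= - nu, whereas K and K' stay positive for
    a large t0: a contradiction after finite time. The inequality comes from conservation of
    the energy E(t) = ||P_1 u_1t||^2 + ||P_2 u_2t||^2 + 2 int F(u_1, u_2), from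
    <P_i u_i, P_i u_itt> = - int u_i f_i, from the structural inequality between the sum of u_i f_i and
    F, and from Cauchy-Schwarz ([levine], [energy_blowup]).

    The work lies in justifying these derivatives, as P_i is unbounded and the equation holds in the
    sense of distributions. Everything is done in Fourier variables. Testing the equation against
    smooth bumps and their translates gives u_itt^ = - xi^2 beta_i^ f_i^ almost everywhere
    ([eq_fourier]); at time 0 this follows by continuity. Let
    m = |xi|^-1 (beta_i^)^(-1/2) be the symbol of P_i; it is finite and nonzero almost everywhere because
    the zeros of beta_i^ are isolated ([isolated_null]). The decay of order r_i >= 2
    makes m xi^2 beta_i^ = |xi| (beta_i^)^(1/2) bounded, so m u_itt^ is a continuous curve in L^2. A mean value
    inequality for truncations of m, followed by Fatou's lemma, then shows that first m u_it^
    and next m u_i^ stay in L^2 and are differentiable there, since they start in L^2 by hypothesis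
    ([weight_curve], [component_curves]). In <P_i u_i, P_i u_itt> the two weights cancel and
    Parseval's identity leaves the integral of - u_i f_i.

    The potential energy is differentiable because H^s with s > 1/2 is contained in the bounded
    functions ([sobolev_sup]): along the solution, g_i and G are only evaluated on a bounded set, locally
    uniformly in time, where Taylor's formula applies ([potential_rdiff]). For this G has to vanish at
    the origin, which follows from G(phi_1, phi_2) being integrable ([potential_at0]).

    The Fourier transform on L^2 is developed in the first half. Plancherel's identity is obtained by
    Abel summation: the Abel means of |f^|^2 are Poisson integrals of f tested against f
    ([plancherel_cont]); density of bounded continuous functions extends it to all of L^1 and L^2
    together ([plancherel_L1L2]), and truncation to L^2 ([isFT_exists], [parseval]). *)

(** * Integrable and square integrable real functions *)

Section Integrable.
Context {R : realType}.
Local Notation mu := (@lebesgue_measure R).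
Implicit Types (f g h k : R -> R).

Definition intg f := mu.-integrable setT (EFin \o f).

Lemma intg_meas f : intg f -> measurable_fun setT f.
Proof. by move=> /measurable_int /measurable_EFinP. Qed.

Lemma intg_le f g : measurable_fun setT f -> (forall x, `|f x| <= g x) ->
  intg g -> intg f.
Proof.
move=> mf fg ig; apply: (le_integrable measurableT _ _ ig).
- exact/measurable_EFinP.
- by move=> x _ /=; rewrite lee_fin (le_trans (fg x))// ler_norm.
Qed.

Lemma intgD f g : intg f -> intg g -> intg (fun x => f x + g x).
Proof. by move=> /(integrableD measurableT) /[apply]. Qed.

Lemma intgB f g : intg f -> intg g -> intg (fun x => f x - g x).
Proof. by move=> /(integrableB measurableT) /[apply]. Qed.

Lemma intgZ (c : R) f : intg f -> intg (fun x => c * f x).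
Proof. by move=> /(integrableZl measurableT c). Qed.

Lemma intg_norm f : intg f -> intg (fun x => `|f x|).
Proof. by move=> /integrable_norm. Qed.

Lemma intgM k f (M : R) : measurable_fun setT k -> (forall x, `|k x| <= M) ->
  intg f -> intg (fun x => k x * f x).
Proof.
move=> mk kM If; apply: (@intg_le _ (fun x => M * `|f x|)).
- by apply: measurable_funM => //; exact: intg_meas.
- by move=> x; rewrite normrM ler_wpM2r.
- exact/intgZ/intg_norm.
Qed.

Lemma aeS (P Q : R -> Prop) : (forall x, P x -> Q x) ->
  {ae mu, forall x, P x} -> {ae mu, forall x, Q x}.
Proof. exact: (@filterS _ _ (ae_filter_ringOfSetsType mu)). Qed.

Lemma aeS2 (P Q S : R -> Prop) : (forall x, P x -> Q x -> S x) ->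
  {ae mu, forall x, P x} -> {ae mu, forall x, Q x} -> {ae mu, forall x, S x}.
Proof. exact: (@filterS2 _ _ (ae_filter_ringOfSetsType mu)). Qed.

Lemma eq_ae_Rint f g : measurable_fun setT f -> measurable_fun setT g ->
  {ae mu, forall x, f x = g x} -> \int[mu]_x f x = \int[mu]_x g x.
Proof.
move=> mf mg fg; congr fine; apply: ae_eq_integral => //.
- exact/measurable_EFinP.
- exact/measurable_EFinP.
- by apply: aeS fg => x fgx _; rewrite fgx.
Qed.

Lemma intg_ae f g : measurable_fun setT g ->
  {ae mu, forall x, f x = g x} -> intg f -> intg g.
Proof.
move=> mg fg If; apply/integrableP; split; first exact/measurable_EFinP.
have [mf foo] := (integrableP _ _ _ If).
apply: le_lt_trans foo; rewrite le_eqVlt; apply/orP; left; apply/eqP.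
apply: ae_eq_integral => //.
- by apply: measurableT_comp => //; exact/measurable_EFinP.
- exact: measurableT_comp.
- by apply: aeS fg => x /= fgx _; rewrite fgx.
Qed.

Lemma ge0_intg f : measurable_fun setT f -> (forall x, 0 <= f x) ->
  (\int[mu]_x (f x)%:E < +oo)%E -> intg f.
Proof.
move=> mf f0 foo; apply/integrableP; split; first exact/measurable_EFinP.
apply: le_lt_trans foo; rewrite le_eqVlt; apply/orP; left; apply/eqP.
by apply: eq_integral => x _ /=; rewrite ger0_norm.
Qed.

Lemma intg_fin f : intg f -> (\int[mu]_x (f x)%:E = (\int[mu]_x f x)%:E)%E.
Proof. by move=> If; rewrite /Rintegral fineK//; exact: integrable_fin_num. Qed.

Lemma RintD f g : intg f -> intg g ->
  \int[mu]_x (f x + g x) = \int[mu]_x f x + \int[mu]_x g x.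
Proof. by move=> If Ig; rewrite RintegralD. Qed.

Lemma RintB f g : intg f -> intg g ->
  \int[mu]_x (f x - g x) = \int[mu]_x f x - \int[mu]_x g x.
Proof. by move=> If Ig; rewrite RintegralB. Qed.

Lemma RintZ (c : R) f : intg f -> \int[mu]_x (c * f x) = c * \int[mu]_x f x.
Proof. by move=> If; rewrite RintegralZl. Qed.

Lemma Rint_le f g : intg f -> intg g -> (forall x, f x <= g x) ->
  \int[mu]_x f x <= \int[mu]_x g x.
Proof. by move=> If Ig fg; apply: le_Rintegral. Qed.

Lemma Rint_ge0 f : (forall x, 0 <= f x) -> 0 <= \int[mu]_x f x.
Proof. by move=> f0; apply: Rintegral_ge0. Qed.

Lemma Rint_norm_le f g : intg f -> intg g -> (forall x, `|f x| <= g x) ->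
  `|\int[mu]_x f x| <= \int[mu]_x g x.
Proof.
move=> If Ig fg; apply: le_trans (le_normr_Rintegral measurableT If) _.
by apply: Rint_le => //; exact: intg_norm.
Qed.

Lemma Rint_eq0 f : intg f -> (forall x, 0 <= f x) -> \int[mu]_x f x = 0 ->
  {ae mu, forall x, f x = 0}.
Proof.
move=> If f0 I0.
have : ae_eq mu setT (EFin \o f) (cst 0%E).
  apply/(ae_eq_integral_abs mu measurableT (measurable_int mu If)).
  under eq_integral do rewrite /= ger0_norm//.
  by rewrite intg_fin// I0.
by apply: aeS => x /= /(_ Logic.I) [].
Qed.

Definition l2 f := measurable_fun setT f /\ intg (fun x => f x ^+ 2).

Lemma l2_le f g : measurable_fun setT f -> (forall x, `|f x| <= `|g x|) ->
  l2 g -> l2 f.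
Proof.
move=> mf fg [mg Ig]; split=> //; apply: intg_le Ig.
- exact: measurable_funX.
- by move=> x; rewrite normrX -[g x ^+ 2]ger0_norm ?sqr_ge0// normrX lerXn2r// nnegrE.
Qed.

Lemma l2M f g : l2 f -> l2 g -> intg (fun x => f x * g x).
Proof.
move=> [mf If] [mg Ig]; apply: (@intg_le _ (fun x => f x ^+ 2 + g x ^+ 2)).
- exact: measurable_funM.
- move=> x; rewrite ler_norml; apply/andP; split; nra.
- exact: intgD.
Qed.

Lemma l2D f g : l2 f -> l2 g -> l2 (fun x => f x + g x).
Proof.
move=> lf lg; have Ifg := l2M lf lg; case: lf => mf If; case: lg => mg Ig.
split; first exact: measurable_funD.
apply: (@eq_integrable _ _ _ mu setT measurableT
  (EFin \o (fun x => f x ^+ 2 + (2 * (f x * g x) + g x ^+ 2)))).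
  by move=> x _ /=; congr EFin; ring.
by apply: intgD => //; apply: intgD => //; apply: intgZ.
Qed.

Lemma l2Z (c : R) f : l2 f -> l2 (fun x => c * f x).
Proof.
move=> [mf If]; split; first exact: measurable_funM.
apply: (@eq_integrable _ _ _ mu setT measurableT
  (EFin \o (fun x => c ^+ 2 * f x ^+ 2))).
  by move=> x _ /=; rewrite exprMn.
exact: intgZ.
Qed.

Lemma l2N f : l2 f -> l2 (fun x => - f x).
Proof.
move=> lf; rewrite (_ : (fun x => - f x) = (fun x => -1 * f x)); first exact: l2Z.
by apply/funext => x; rewrite mulN1r.
Qed.

Lemma l2B f g : l2 f -> l2 g -> l2 (fun x => f x - g x).
Proof. by move=> lf lg; apply: l2D => //; exact: l2N. Qed.

Lemma l20 : l2 (fun=> 0).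
Proof.
split; first exact: measurable_cst.
apply: (@eq_integrable _ _ _ mu setT measurableT (cst 0%E)).
  by move=> x _ /=; rewrite expr0n.
exact: integrable0.
Qed.

Lemma l2_bounded f k (M : R) : measurable_fun setT k -> (forall x, `|k x| <= M) ->
  l2 f -> l2 (fun x => k x * f x).
Proof.
move=> mk kM lf; apply: (@l2_le _ (fun x => M * f x)); last exact: l2Z.
- by apply: measurable_funM => //; case: lf.
- move=> x; rewrite !normrM ler_wpM2r// (le_trans (kM x))//; exact: ler_norm.
Qed.

Lemma l2_ae f g : measurable_fun setT g -> {ae mu, forall x, f x = g x} ->
  l2 f -> l2 g.
Proof.
move=> mg fg [mf If]; split=> //; apply: intg_ae If; first exact: measurable_funX.
by apply: aeS fg => x ->.
Qed.

Lemma intg_bounded_l2 f (M : R) : intg f -> (forall x, `|f x| <= M) -> l2 f.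
Proof.
move=> If fM; split; first exact: intg_meas.
apply: (@eq_integrable _ _ _ mu setT measurableT (EFin \o (fun x => f x * f x))).
  by move=> x _ /=; rewrite expr2.
by apply: (@intgM _ _ M) => //; exact: intg_meas.
Qed.

Lemma l2_sqr_eq0 f : l2 f -> \int[mu]_x (f x ^+ 2) = 0 -> {ae mu, forall x, f x = 0}.
Proof.
move=> [mf If] /(Rint_eq0 If) h; have {}h := h (fun x => sqr_ge0 _).
by apply: aeS h => x /eqP; rewrite sqrf_eq0 => /eqP.
Qed.

End Integrable.

(** * Affine substitutions and exchange of integrals *)

Section Affine.
Context {R : realType}.
Local Notation mu := (@lebesgue_measure R).
Implicit Types (f g h k : R -> R).

Definition affine (a b x : R) : R := a * x + b.

Lemma measurable_affine (a b : R) : measurable_fun setT (affine a b).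
Proof. by apply: measurable_funD => //; exact: measurable_funM. Qed.

Lemma preimage_affine_itv_pos (a b c d : R) : 0 < a ->
  affine a b @^-1` `]c, d]%classic = `](c - b) / a, (d - b) / a]%classic.
Proof.
move=> a0; apply/seteqP; split=> x /=; rewrite !in_itv/= /affine.
- by rewrite ltr_pdivrMr// ler_pdivlMr// ltrBlDr lerBrDr mulrC.
- by rewrite ltr_pdivrMr// ler_pdivlMr// ltrBlDr lerBrDr mulrC.
Qed.

Lemma preimage_affine_itv_neg (a b c d : R) : a < 0 ->
  affine a b @^-1` `]c, d]%classic = `[(d - b) / a, (c - b) / a[%classic.
Proof.
move=> a0; apply/seteqP; split=> x /=; rewrite !in_itv/= /affine.
- by rewrite ltr_ndivlMr// ler_ndivrMr// ltrBlDr lerBrDr mulrC andbC.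
- by rewrite ltr_ndivlMr// ler_ndivrMr// ltrBlDr lerBrDr mulrC andbC.
Qed.

(** Uniqueness of the Lebesgue measure: both sides are measures in A with the same
value on half-open intervals. *)
Lemma lebesgue_measure_affine (a b : R) (ane : a != 0) (A : set (measurableTypeR R)) :
  measurable A ->
  mu A = (`|a|%:E * pushforward mu (affine a b : measurableTypeR R -> measurableTypeR R) A)%E.
Proof.
move=> mA.
pose nu : {measure set (measurableTypeR R) -> \bar R} :=
  @measure_function_pushforward__canonical__measure_function_Measure _ _
    (measurableTypeR R) (measurableTypeR R) R mu _ (measurable_affine a b).
rewrite -[RHS]/(mscale (NngNum (normr_ge0 a)) nu A).
apply: lebesgue_measure_unique => // X [[c d]] /= _ <-; rewrite /mscale/= /pushforward/=.
have [a0|a0] := ltP 0 a.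
- rewrite preimage_affine_itv_pos// !lebesgue_measure_itv/= !lte_fin.
  rewrite ltr_pM2r ?invr_gt0// ltrD2r; case: ifPn => cd; last by rewrite mule0.
  by rewrite -!EFinD -EFinM gtr0_norm//; congr EFin; field.
- have {}a0 : a < 0 by rewrite lt_neqAle a0 andbT.
  rewrite preimage_affine_itv_neg// !lebesgue_measure_itv/= !lte_fin.
  rewrite ltr_nM2r ?invr_lt0// ltrD2r; case: ifPn => cd; last by rewrite mule0.
  by rewrite -!EFinD -EFinM ltr0_norm//; congr EFin; field.
Qed.

Lemma ge0_integral_affine (a b : R) (f : R -> \bar R) : a != 0 ->
  measurable_fun setT f -> (forall x, 0 <= f x)%E ->
  (\int[mu]_x f x = `|a|%:E * \int[mu]_x f (a * x + b)%R)%E.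
Proof.
move=> a0 mf f0; have ane : 0 < `|a| by rewrite normr_gt0.
have := @ge0_integral_pushforward _ _ (measurableTypeR R) (measurableTypeR R) R
  (affine a b) (measurable_affine a b) mu setT f measurableT mf (fun x _ => f0 x).
rewrite preimage_setT => <-.
have na0 : 0 <= `|a|^-1 by rewrite invr_ge0.
transitivity (`|a|%:E * \int[mscale (NngNum na0) mu]_x f x)%E.
  rewrite ge0_integral_mscale// muleA -EFinM divff ?mul1e//; exact: lt0r_neq0.
congr (_ * _)%E; apply: eq_measure_integral => /=; first exact: measurable_affine.
move=> m A mA _; rewrite /mscale/= (lebesgue_measure_affine b a0)//.
by rewrite muleA -EFinM mulVf ?mul1e// ?lt0r_neq0.
Qed.

Lemma measurable_comp_affine (a b : R) f :
  measurable_fun setT f -> measurable_fun setT (fun x => f (a * x + b)).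
Proof. by move=> mf; apply: (measurableT_comp mf); exact: measurable_affine. Qed.

Lemma intg_affine (a b : R) f : a != 0 -> intg f -> intg (fun x => f (a * x + b)).
Proof.
move=> a0 If; have [mf foo] := integrableP _ _ _ If.
apply/integrableP; split.
  by apply/measurable_EFinP; apply: measurable_comp_affine; exact: intg_meas.
rewrite (@ge0_integral_affine a b) in foo; [|by []|exact: measurableT_comp|by []].
rewrite /= ltey; apply/eqP => H; move: foo; rewrite [X in (_ * X)%E]H.
by rewrite gt0_muley ?lte_fin ?normr_gt0// ltxx.
Qed.

Lemma ge0_Rint_affine (a b : R) f : a != 0 -> intg f -> (forall x, 0 <= f x) ->
  \int[mu]_x f x = `|a| * \int[mu]_x f (a * x + b).
Proof.
move=> a0 If f0; apply: EFin_inj; rewrite EFinM -!intg_fin//; last exact: intg_affine.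
apply: (@ge0_integral_affine a b (fun x => (f x)%:E)) => //.
by apply/measurable_EFinP; exact: intg_meas.
Qed.

Lemma Rint_affine (a b : R) f : a != 0 -> intg f ->
  \int[mu]_x f x = `|a| * \int[mu]_x f (a * x + b).
Proof.
move=> a0 If; have In := intg_norm If; have Is := intgD In If.
have Ia := intg_affine b a0 If; have Ina := intg_affine b a0 In.
have := ge0_Rint_affine b a0 In (fun x => normr_ge0 _).
have : \int[mu]_x (`|f x| + f x) = `|a| * \int[mu]_x (`|f (a * x + b)| + f (a * x + b)).
  apply: (@ge0_Rint_affine a b (fun x => `|f x| + f x)) => // x.
  by have := ler_norm (- f x); rewrite normrN; lra.
by rewrite !RintD// mulrDr => + e; rewrite e => /addrI.
Qed.

End Affine.

Section Fubini.
Context {R : realType}.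
Local Notation mu := (@lebesgue_measure R).
Implicit Types (f g h k : R -> R).

Definition intg2 (F : R * R -> R) :=
  (mu \x mu)%E.-integrable setT (EFin \o F).

(** The inner integral in Fubini's theorem is an extended real, finite almost everywhere only;
this passes to a real-valued version of it. *)
Lemma fin_intg (F : R -> \bar R) f : measurable_fun setT f ->
  {ae mu, forall x, F x = (f x)%:E} -> mu.-integrable setT F -> intg f.
Proof.
move=> mf fg IF; apply/integrableP; split; first exact/measurable_EFinP.
have [mF foo] := integrableP _ _ _ IF.
apply: le_lt_trans foo; rewrite le_eqVlt; apply/orP; left; apply/eqP.
apply: ae_eq_integral => //.
- by apply: measurableT_comp => //; exact/measurable_EFinP.
- exact: measurableT_comp.
- by apply: aeS fg => x /= fgx _; rewrite fgx.
Qed.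

Lemma integrable_fubini_G (F : R * R -> R) : intg2 F ->
  mu.-integrable setT (fubini_G mu (EFin \o F)).
Proof.
move=> IF; have mF := measurable_int _ IF.
apply/integrableP; split; first exact: (measurable_fubini_G IF).
apply: le_lt_trans ((integrable21ltyP mu mu mF).1 IF).
apply: ge0_le_integral => //.
- by apply: measurableT_comp => //; exact: (measurable_fubini_G IF).
- apply: (@measurable_fun_fubini_tonelli_G _ _ _ _ _ mu (fun z => `|(EFin \o F) z|%E)) => //.
  exact: measurableT_comp.
- move=> y _; apply: le_abse_integral => //.
  exact: (measurableT_comp mF (pair2_measurable y)).
Qed.

Lemma Rfubini (F : R * R -> R) : intg2 F ->
  [/\ intg (fun x => \int[mu]_y F (x, y)), intg (fun y => \int[mu]_x F (x, y)) &
  \int[mu]_x (\int[mu]_y F (x, y)) = \int[mu]_y (\int[mu]_x F (x, y))].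
Proof.
move=> IF.
have I1 := integrable_fubini_F IF; have I2 := integrable_fubini_G IF.
have e1 : {ae mu, forall x, fubini_F mu (EFin \o F) x = (\int[mu]_y F (x, y))%:E}.
  by apply: aeS (ae_integrable1 IF) => x Ix; rewrite -intg_fin.
have e2 : {ae mu, forall y, fubini_G mu (EFin \o F) y = (\int[mu]_x F (x, y))%:E}.
  by apply: aeS (ae_integrable2 IF) => x Ix; rewrite -intg_fin.
have m1 := measurable_fubini_F IF; have m2 := measurable_fubini_G IF.
have mm1 : measurable_fun setT (fun x => \int[mu]_y F (x, y)).
  exact: (measurableT_comp _ m1).
have mm2 : measurable_fun setT (fun y => \int[mu]_x F (x, y)).
  exact: (measurableT_comp _ m2).
have E1 : (\int[mu]_x (fubini_F mu (EFin \o F) x) = \int[mu]_x (\int[mu]_y F (x, y))%:E)%E.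
  apply: ae_eq_integral => //; first exact/measurable_EFinP.
  by apply: aeS e1 => x -> _.
have E2 : (\int[mu]_x (fubini_G mu (EFin \o F) x) = \int[mu]_y (\int[mu]_x F (x, y))%:E)%E.
  apply: ae_eq_integral => //; first exact/measurable_EFinP.
  by apply: aeS e2 => x -> _.
split.
- exact: (fin_intg mm1 e1 I1).
- exact: (fin_intg mm2 e2 I2).
- by congr fine; rewrite -E1 -E2; exact: Fubini.
Qed.

Lemma intg2_prod f g : intg f -> intg g -> intg2 (fun z => f z.1 * g z.2).
Proof.
move=> If Ig; have [mf fo] := integrableP _ _ _ If; have [mg go] := integrableP _ _ _ Ig.
have mF : measurable_fun setT (fun z : R * R => f z.1 * g z.2).
  apply: measurable_funM.
  - by apply: (measurableT_comp (intg_meas If)).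
  - by apply: (measurableT_comp (intg_meas Ig)).
apply/integrable12ltyP; first exact/measurable_EFinP.
rewrite (_ : (fun x => _) = (fun x => `|f x|%:E * \int[mu]_y `|g y|%:E)%E); last first.
  apply/funext => x; rewrite -ge0_integralZl_EFin//; last first.
    by apply/measurable_EFinP; apply: measurableT_comp => //; exact: intg_meas.
  by apply: eq_integral => y _ /=; rewrite normrM.
rewrite ge0_integralZr//.
- by apply: lte_mul_pinfty => //; [exact: integral_ge0|rewrite ge0_fin_numE//; exact: integral_ge0].
- by apply/measurable_EFinP; apply: measurableT_comp => //; exact: intg_meas.
- exact: integral_ge0.
Qed.

Lemma intg2M (k F : R * R -> R) (M : R) : measurable_fun setT k -> (forall z, `|k z| <= M) ->
  intg2 F -> intg2 (fun z => k z * F z).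
Proof.
move=> mk kM IF.
have mF : measurable_fun setT F by apply/measurable_EFinP; exact: (measurable_int _ IF).
have IMF := integrableZl measurableT M IF.
apply: (le_integrable measurableT _ _ IMF).
- by apply/measurable_EFinP; exact: measurable_funM.
- move=> z _ /=; rewrite lee_fin !normrM ler_wpM2r//.
  by rewrite (le_trans (kM z))// ler_norm.
Qed.

(** The exchange needed for Abel means, where k is a cosine or a sine; it is stated with the
weights f and g outside the kernel so that it can be applied twice in a row. *)
Lemma swap_kernel f g (k : R -> R -> R) (M : R) :
  measurable_fun setT (fun z : R * R => k z.1 z.2) -> (forall x y, `|k x y| <= M) ->
  intg f -> intg g ->
  \int[mu]_x (f x * \int[mu]_y (g y * k x y)) =
  \int[mu]_y (g y * \int[mu]_x (f x * k x y)).
Proof.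
move=> mk kM If Ig.
have IF := @intg2M (fun z => k z.1 z.2) _ M mk (fun z => kM _ _) (intg2_prod If Ig).
have [_ _] := Rfubini IF => /=.
have kx x : measurable_fun setT (fun y => k x y).
  exact: (measurableT_comp mk (pair1_measurable x)).
have ky y : measurable_fun setT (fun x => k x y).
  exact: (measurableT_comp mk (pair2_measurable y)).
have -> : (fun x => \int[mu]_y (k x y * (f x * g y))) =
          (fun x => f x * \int[mu]_y (g y * k x y)).
  apply/funext => x; rewrite -RintZ.
    by apply: eq_Rintegral => y _; ring.
  have := intgM (kx x) (kM x) Ig.
  by congr intg; apply/funext => y; rewrite mulrC.
have -> : (fun y => \int[mu]_x (k x y * (f x * g y))) =
          (fun y => g y * \int[mu]_x (f x * k x y)).
  apply/funext => y; rewrite -RintZ.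
    by apply: eq_Rintegral => x _; ring.
  have := intgM (ky y) (fun x => kM x y) If.
  by congr intg; apply/funext => x; rewrite mulrC.
by [].
Qed.

(** The sections of the positive and of the negative part have measurable integrals by Tonelli's
theorem. *)
Lemma measurable_kernel_int g (k : R -> R -> R) (M : R) :
  measurable_fun setT (fun z : R * R => k z.1 z.2) -> (forall x y, `|k x y| <= M) ->
  intg g -> measurable_fun setT (fun x => \int[mu]_y (g y * k x y)).
Proof.
move=> mk kM Ig.
pose F (z : R * R) := g z.2 * k z.1 z.2.
have mF : measurable_fun setT (EFin \o F).
  apply/measurable_EFinP; apply: measurable_funM => //.
  exact: (measurableT_comp (intg_meas Ig)).
have Ix x : intg (fun y => g y * k x y).
  have kx : measurable_fun setT (fun y => k x y).
    exact: (measurableT_comp mk (pair1_measurable x)).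
  have := intgM kx (kM x) Ig.
  by congr intg; apply/funext => y; rewrite mulrC.
have -> : (fun x => \int[mu]_y (g y * k x y)) =
  (fun x => fine (\int[mu]_y ((EFin \o F)^\+%E (x, y)))%E -
            fine (\int[mu]_y ((EFin \o F)^\-%E (x, y)))%E).
  apply/funext => x.
  have -> : (\int[mu]_y ((EFin \o F)^\+ (x, y)) = \int[mu]_y ((fun y => (g y * k x y)%:E)^\+ y))%E.
    by apply: eq_integral => y _; rewrite !funeposE.
  have -> : (\int[mu]_y ((EFin \o F)^\- (x, y)) = \int[mu]_y ((fun y => (g y * k x y)%:E)^\- y))%E.
    by apply: eq_integral => y _; rewrite !funenegE.
  rewrite -fineB.
  - by rewrite /Rintegral integralE.
  - exact: (integrable_pos_fin_num measurableT (Ix x)).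
  - exact: (integrable_neg_fin_num measurableT (Ix x)).
apply: measurable_funB.
- apply: measurableT_comp => //.
  apply: (@measurable_fun_fubini_tonelli_F _ _ _ _ _ mu ((EFin \o F)^\+%E)) => //.
  exact: measurable_funepos.
- apply: measurableT_comp => //.
  apply: (@measurable_fun_fubini_tonelli_F _ _ _ _ _ mu ((EFin \o F)^\-%E)) => //.
  exact: measurable_funeneg.
Qed.

End Fubini.

(** * Curves in a semi-inner product space *)

Section SemiInner.
Context {R : realType} {V : lmodType R}.
Variables (L : V -> Prop) (dot : V -> V -> R).

(** Square integrable functions are kept as functions, not as classes modulo null sets. So the form
is only semidefinite, and it has its properties only on a carrier L inside a vector space of
arbitrary functions. *)
Record semi_inner : Prop := SemiInner {
  carD : forall x y, L x -> L y -> L (x + y) ;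
  carZ : forall a x, L x -> L (a *: x) ;
  dotC : forall x y, dot x y = dot y x ;
  dotDl : forall x y z, L x -> L y -> L z -> dot (x + y) z = dot x z + dot y z ;
  dotZl : forall a x y, L x -> L y -> dot (a *: x) y = a * dot x y ;
  dot_ge0 : forall x, L x -> 0 <= dot x x }.

Hypothesis H : semi_inner.

Definition nm x := Num.sqrt (dot x x).

Lemma nm_ge0 x : 0 <= nm x. Proof. exact: sqrtr_ge0. Qed.

Lemma sqr_nm x : L x -> nm x ^+ 2 = dot x x.
Proof. by move=> Lx; rewrite sqr_sqrtr// (dot_ge0 H). Qed.

Lemma carN x : L x -> L (- x).
Proof. by rewrite -scaleN1r; exact: carZ. Qed.

Lemma carB x y : L x -> L y -> L (x - y).
Proof. by move=> Lx Ly; apply: (carD H) => //; exact: carN. Qed.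

Lemma dotDr x y z : L x -> L y -> L z -> dot z (x + y) = dot z x + dot z y.
Proof. by move=> *; rewrite dotC// dotDl// !(dotC H z). Qed.

Lemma dotZr a x y : L x -> L y -> dot y (a *: x) = a * dot y x.
Proof. by move=> *; rewrite dotC// dotZl// (dotC H y). Qed.

Lemma dotNl x y : L x -> L y -> dot (- x) y = - dot x y.
Proof. by move=> *; rewrite -scaleN1r dotZl// mulN1r. Qed.

Lemma dotBl x y z : L x -> L y -> L z -> dot (x - y) z = dot x z - dot y z.
Proof. by move=> *; rewrite dotDl ?dotNl//; exact: carN. Qed.

Lemma dotBr x y z : L x -> L y -> L z -> dot z (x - y) = dot z x - dot z y.
Proof. by move=> *; rewrite dotC// dotBl// !(dotC H z). Qed.

Lemma dot_sqrD x y : L x -> L y ->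
  dot (x + y) (x + y) = dot x x + 2 * dot x y + dot y y.
Proof.
move=> Lx Ly; have Lxy := carD H Lx Ly.
by rewrite dotDl// !dotDr// (dotC H y x); ring.
Qed.

Lemma dotZZ a x : L x -> dot (a *: x) (a *: x) = a ^+ 2 * dot x x.
Proof. by move=> Lx; rewrite dotZl ?dotZr// ?expr2 ?mulrA//; exact: carZ. Qed.

Lemma nmZ a x : L x -> nm (a *: x) = `|a| * nm x.
Proof. by move=> Lx; rewrite /nm dotZZ// sqrtrM ?sqr_ge0// sqrtr_sqr. Qed.

Lemma nmN x : L x -> nm (- x) = nm x.
Proof. by move=> Lx; rewrite -scaleN1r nmZ// normrN1 mul1r. Qed.

Lemma dot_sqr_le x y : L x -> L y -> dot x y ^+ 2 <= dot x x * dot y y.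
Proof.
move=> Lx Ly; have q (t : R) : 0 <= dot x x + 2 * t * dot x y + t ^+ 2 * dot y y.
  have := dot_ge0 H (carD H Lx (carZ H t Ly)).
  rewrite dot_sqrD//; last exact: carZ.
  by rewrite dotZZ// dotZr// mulrA.
have x0 := dot_ge0 H Lx; have y0 := dot_ge0 H Ly.
(* If dot y y = 0 the quadratic q is affine in t and nonnegative, so its slope vanishes. *)
have [y0'|yn] := eqVneq (dot y y) 0.
  rewrite y0' mulr0; have [->|xy] := eqVneq (dot x y) 0; first by rewrite expr0n.
  have := q (- (dot x x + 1) / (2 * dot x y)); rewrite y0' mulr0 addr0.
  rewrite (_ : 2 * _ * _ = - (dot x x + 1)); last by field.
  by rewrite opprD addrA subrr add0r lerNr oppr0 ler10.
have {}yn : 0 < dot y y by rewrite lt_neqAle eq_sym yn.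
have := q (- dot x y / dot y y).
rewrite (_ : _ + _ = (dot x x * dot y y - dot x y ^+ 2) / dot y y); last by field; exact: lt0r_neq0.
by rewrite pmulr_lge0 ?invr_gt0// subr_ge0.
Qed.

Lemma cauchy_schwarz x y : L x -> L y -> `|dot x y| <= nm x * nm y.
Proof.
move=> Lx Ly; rewrite -(@ler_pXn2r _ 2)// ?nnegrE ?mulr_ge0 ?nm_ge0//.
by rewrite -normrX ger0_norm ?sqr_ge0// exprMn !sqr_nm// dot_sqr_le.
Qed.

Lemma nmD x y : L x -> L y -> nm (x + y) <= nm x + nm y.
Proof.
move=> Lx Ly; rewrite -(@ler_pXn2r _ 2)// ?nnegrE ?addr_ge0 ?nm_ge0//.
rewrite sqr_nm ?dot_sqrD//; last exact: (carD H).
have h : dot x y <= nm x * nm y by exact: le_trans (ler_norm _) (cauchy_schwarz Lx Ly).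
by rewrite sqrrD !sqr_nm// -[nm x * nm y *+ 2]mulr_natl; lra.
Qed.

Lemma nmB_le x y : L x -> L y -> `|nm x - nm y| <= nm (x - y).
Proof.
move=> Lx Ly; rewrite ler_norml; apply/andP; split.
- have := nmD (carB Ly Lx) Lx; rewrite subrK -(opprB x y) nmN; last exact: carB.
  by move=> h; lra.
- rewrite lerBlDr; have := nmD (carB Lx Ly) Ly; by rewrite subrK.
Qed.

(** Only the values of a curve at nonnegative times count, so that the derivative is one-sided at
time 0 and two-sided at positive times. The inequality is multiplied by |r - t|, which avoids
excluding r = t. *)
Definition cdiff (c : R -> V) (c' : V) (t : R) := forall e : R, 0 < e -> exists2 d : R, 0 < d &
  forall r : R, 0 <= r -> `|r - t| < d -> nm (c r - c t - (r - t) *: c') <= e * `|r - t|.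

Definition ccont (c : R -> V) (t : R) := forall e : R, 0 < e -> exists2 d : R, 0 < d &
  forall r : R, 0 <= r -> `|r - t| < d -> nm (c r - c t) <= e.

Lemma cdiff_cont c c' t : 0 <= t -> (forall r, 0 <= r -> L (c r)) -> L c' ->
  cdiff c c' t -> ccont c t.
Proof.
move=> t0 Lc Lc' /(_ 1 ltr01)[d d0 hd] e e0.
have n0 := nm_ge0 c'.
have n1 : 0 < 1 + nm c' by rewrite ltr_pwDl.
exists (Num.min d (e / (1 + nm c'))) => [|r r0].
  by rewrite lt_min d0 divr_gt0.
rewrite lt_min => /andP[rd re].
have -> : c r - c t = (c r - c t - (r - t) *: c') + (r - t) *: c' by rewrite subrK.
apply: le_trans (nmD _ _) _.
- by apply: carB; [apply: carB; exact: Lc|exact: carZ].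
- exact: carZ.
rewrite nmZ//; apply: le_trans (lerD (hd _ r0 rd) (lexx _)) _.
rewrite mul1r -[X in X + _]mulr1 -mulrDr.
by rewrite -ler_pdivlMr//; exact: ltW.
Qed.

End SemiInner.

Section ScalarCurves.
Context {R : realType}.

Definition rdiff (f : R -> R) (l t : R) := forall e : R, 0 < e -> exists2 d : R, 0 < d &
  forall r : R, 0 <= r -> `|r - t| < d -> `|f r - f t - (r - t) * l| <= e * `|r - t|.

Definition rcont (f : R -> R) (t : R) := forall e : R, 0 < e -> exists2 d : R, 0 < d &
  forall r : R, 0 <= r -> `|r - t| < d -> `|f r - f t| <= e.

Lemma rdiff_cont f l t : rdiff f l t -> rcont f t.
Proof.
move=> /(_ 1 ltr01)[d d0 hd] e e0.
have n1 : 0 < 1 + `|l| by rewrite ltr_pwDl.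
exists (Num.min d (e / (1 + `|l|))) => [|r r0]; first by rewrite lt_min d0 divr_gt0.
rewrite lt_min => /andP[rd re].
have -> : f r - f t = (f r - f t - (r - t) * l) + (r - t) * l by rewrite subrK.
apply: le_trans (ler_normD _ _) _.
rewrite normrM; apply: le_trans (lerD (hd _ r0 rd) (lexx _)) _.
rewrite mul1r -[X in X + _]mulr1 -mulrDr.
by rewrite -ler_pdivlMr//; exact: ltW.
Qed.

Lemma rdiff_is_derive f l t : 0 < t -> rdiff f l t -> is_derive t 1 f l.
Proof.
move=> t0 hf.
have H : h^-1 *: (f (h *: 1 + t) - f t) @[h --> 0^'] --> l.
  apply/cvgrPdist_le => /= e e0.
  have [d d0 hd] := hf e e0.
  near=> h.
  have h0 : h != 0 by near: h; exact: nbhs_dnbhs_neq.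
  have hd' : `|h| < Num.min d t.
    near: h; apply: dnbhs0_lt; by rewrite lt_min d0 t0.
  move: hd'; rewrite lt_min => /andP[hd1 ht].
  have := hd (h + t).
  rewrite addrK => /(_ _ hd1); rewrite [h *: 1]mulr1 => {}hd.
  have : 0 <= h + t by move: ht; rewrite ltr_norml => /andP[]; lra.
  move=> /hd.
  rewrite (_ : l - h^-1 *: (f (h + t) - f t) = - ((f (h + t) - f t - h * l) / h)); last first.
    rewrite /GRing.scale/=; by field.
  by rewrite normrN normrM normfV ler_pdivrMr ?normr_gt0.
apply: DeriveDef; first by apply/cvg_ex; exists l.
exact/cvg_lim.
Unshelve. all: by end_near. Qed.

Lemma rcont_within f (a b : R) : 0 <= a -> (forall t, a <= t <= b -> rcont f t) ->
  {within `[a, b], continuous f}.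
Proof.
move=> a0 cf; apply/subspace_continuousP => x /=; rewrite in_itv/= => xab.
apply/cvgrPdist_le => /= e e0.
have [d d0 hd] := cf x xab e e0.
rewrite near_withinE; near=> r => /= /andP[ar _].
rewrite distrC; apply: hd.
- by move: ar; rewrite bnd_simp; exact: le_trans.
- near: r; apply/nbhs_ballP; exists d => // y; rewrite /ball/= distrC.
Unshelve. all: by end_near. Qed.

(** At time 0 the one-sided derivative provides the continuity from the right that Lagrange's
theorem requires at an endpoint. *)
Lemma rdiff_MVT f f' (a b : R) : 0 <= a -> a < b ->
  (forall t, a <= t <= b -> rdiff f (f' t) t) ->
  exists2 c, a < c < b & f b - f a = f' c * (b - a).
Proof.
move=> a0 ab df.
have [||c cab ->] := @MVT R f f' a b ab.
- move=> x; rewrite in_itv/= => /andP[ax xb]; apply: rdiff_is_derive.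
    exact: le_lt_trans a0 ax.
  by apply: df; rewrite !ltW.
- by apply: rcont_within => // t /df; exact: rdiff_cont.
- by exists c => //; move: cab; rewrite in_itv.
Qed.

Lemma rcont_bounded f (a b : R) : 0 <= a -> a <= b -> (forall t, a <= t <= b -> rcont f t) ->
  exists M, forall t, a <= t <= b -> f t <= M.
Proof.
move=> a0 ab cf.
have [c _ hc] := EVT_max ab (rcont_within a0 cf).
by exists (f c) => t tab; apply: hc; rewrite in_itv.
Qed.

Lemma rdiffD f g l m t : rdiff f l t -> rdiff g m t -> rdiff (fun r => f r + g r) (l + m) t.
Proof.
move=> hf hg e e0; have e2 : 0 < e / 2 by rewrite divr_gt0.
have [d1 d10 h1] := hf _ e2; have [d2 d20 h2] := hg _ e2.
exists (Num.min d1 d2) => [|r r0]; first by rewrite lt_min d10 d20.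
rewrite lt_min => /andP[rd1 rd2].
rewrite (_ : _ - _ - _ = (f r - f t - (r - t) * l) + (g r - g t - (r - t) * m)); last by ring.
apply: le_trans (ler_normD _ _) _.
by apply: le_trans (lerD (h1 r r0 rd1) (h2 r r0 rd2)) _; rewrite -mulrDl -splitr.
Qed.

Lemma rdiffZ f l (a t : R) : rdiff f l t -> rdiff (fun r => a * f r) (a * l) t.
Proof.
move=> hf e e0; have n1 : 0 < 1 + `|a| by rewrite ltr_pwDl.
have [d d0 hd] := hf _ (divr_gt0 e0 n1).
exists d => // r r0 rd.
rewrite (_ : _ - _ - _ = a * (f r - f t - (r - t) * l)); last by ring.
rewrite normrM; apply: le_trans (ler_wpM2l (normr_ge0 a) (hd r r0 rd)) _.
rewrite mulrA ler_wpM2r// mulrCA -[leRHS]mulr1 ler_wpM2l ?(ltW e0)//.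
by rewrite ler_pdivrMr// mul1r lerDr.
Qed.

Lemma rdiff_quad (b t0 t : R) : rdiff (fun r => b * (r + t0) ^+ 2) (2 * b * (t + t0)) t.
Proof.
move=> e e0; have n1 : 0 < 1 + `|b| by rewrite ltr_pwDl.
exists (e / (1 + `|b|)) => [|r r0 rd]; first by rewrite divr_gt0.
rewrite (_ : _ - _ - _ = (b * (r - t)) * (r - t)); last by ring.
rewrite normrM ler_wpM2r// normrM.
apply: le_trans (ler_wpM2l (normr_ge0 b) (ltW rd)) _.
by rewrite mulrCA -[leRHS]mulr1 ler_wpM2l ?(ltW e0)// ler_pdivrMr// mul1r lerDr.
Qed.

Lemma rdiff_lin (b t0 t : R) : rdiff (fun r => b * (r + t0)) b t.
Proof.
move=> e e0; exists 1 => // r r0 rd.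
rewrite (_ : _ - _ - _ = 0); last by ring.
by rewrite normr0 mulr_ge0// ltW.
Qed.

End ScalarCurves.

Section DotCurves.
Context {R : realType} {V : lmodType R}.
Variables (L : V -> Prop) (dot : V -> V -> R).
Hypothesis H : semi_inner L dot.

Local Notation nm := (nm dot).

(** The remainder is split into three terms, each with one factor that is small: the remainder
of c, the increment of d and the remainder of d. *)
Lemma dot_rdiff c d c' d' t : 0 <= t ->
  (forall r, 0 <= r -> L (c r)) -> (forall r, 0 <= r -> L (d r)) -> L c' -> L d' ->
  cdiff dot c c' t -> cdiff dot d d' t ->
  rdiff (fun r => dot (c r) (d r)) (dot c' (d t) + dot (c t) d') t.
Proof.
move=> t0 Lc Ld Lc' Ld' hc hd e e0.
have Lct := Lc t t0; have Ldt := Ld t t0.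
(* K dominates the norms of the other factors of the three terms; nm (d r) <= nm (d t) + 1 for r
   close to t. *)
set K := 1 + nm (d t) + nm (c t) + nm c'.
have n1 := nm_ge0 dot (d t); have n2 := nm_ge0 dot (c t); have n3 := nm_ge0 dot c'.
have K0 : 0 < K by rewrite /K; lra.
have e30 : 0 < e / (3 * K) by rewrite divr_gt0// mulr_gt0.
have [d1 d10 h1] := hc _ e30; have [d2 d20 h2] := hd _ e30.
have [d3 d30 h3] := cdiff_cont H t0 Ld Ld' hd e30.
have [d4 d40 h4] := cdiff_cont H t0 Ld Ld' hd ltr01.
exists (Num.min (Num.min d1 d2) (Num.min d3 d4)) => [|r r0].
  by rewrite !lt_min d10 d20 d30 d40.
rewrite !lt_min => /andP[/andP[r1 r2] /andP[r3 r4]].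
have {}h1 := h1 r r0 r1; have {}h2 := h2 r r0 r2; have {}h3 := h3 r r0 r3; have {}h4 := h4 r r0 r4.
have Lcr := Lc r r0; have Ldr := Ld r r0.
set x := c r - c t - (r - t) *: c' in h1.
set y := d r - d t - (r - t) *: d' in h2.
have Lrc : L ((r - t) *: c') by exact: (carZ H).
have Lrd : L ((r - t) *: d') by exact: (carZ H).
have Lcrt : L (c r - c t) by exact: (carB H).
have Ldrt : L (d r - d t) by exact: (carB H).
have Lx : L x by exact: (carB H).
have Ly : L y by exact: (carB H).
have E : dot (c r) (d r) - dot (c t) (d t) - (r - t) * (dot c' (d t) + dot (c t) d') =
   dot x (d r) + (r - t) * dot c' (d r - d t) + dot (c t) y.
  rewrite /x /y !(dotBl H)// !(dotBr H)// (dotZl H)// (dotZr H)//; ring.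
rewrite E.
have ndr : nm (d r) <= nm (d t) + 1.
  rewrite -lerBlDl (le_trans _ h4)// (le_trans _ (nmB_le H Ldr Ldt))//; exact: ler_norm.
have b1 : `|dot x (d r)| <= e / (3 * K) * `|r - t| * K.
  apply: le_trans (cauchy_schwarz H Lx Ldr) _.
  apply: ler_pM => //; [exact: nm_ge0|exact: nm_ge0|].
  by rewrite (le_trans ndr)// /K; lra.
have b2 : `|(r - t) * dot c' (d r - d t)| <= e / (3 * K) * `|r - t| * K.
  rewrite normrM [leRHS](_ : _ = `|r - t| * (K * (e / (3 * K)))); last by ring.
  rewrite ler_wpM2l//; apply: le_trans (cauchy_schwarz H Lc' Ldrt) _.
  by apply: ler_pM => //; [exact: nm_ge0|rewrite /K; lra].
have b3 : `|dot (c t) y| <= e / (3 * K) * `|r - t| * K.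
  apply: le_trans (cauchy_schwarz H Lct Ly) _; rewrite mulrC.
  by apply: ler_pM => //; [exact: nm_ge0|rewrite /K; lra].
apply: le_trans (ler_normD _ _) _.
apply: le_trans (lerD (ler_normD _ _) (lexx _)) _.
apply: le_trans (lerD (lerD b1 b2) b3) _.
rewrite le_eqVlt; apply/orP; left; apply/eqP; field; exact: lt0r_neq0.
Qed.

(** As usual for vector-valued curves, the scalar mean value theorem is applied to the curve paired
with the fixed vector that is to be bounded. The vector w turns the estimate into one for a
Taylor remainder. *)
Lemma cdiff_mean_le c c' (a b B : R) (w : V) : 0 <= a -> a < b ->
  (forall r, 0 <= r -> L (c r)) -> (forall r, 0 <= r -> L (c' r)) -> L w ->
  (forall t, 0 <= t -> cdiff dot c (c' t) t) ->
  (forall t, a <= t <= b -> nm (c' t - w) <= B) ->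
  nm (c b - c a - (b - a) *: w) <= B * (b - a).
Proof.
move=> a0 ab Lc Lc' Lw hc hB; have b0 : 0 <= b by rewrite (le_trans a0)// ltW.
set z := c b - c a - (b - a) *: w.
have Lbw : L ((b - a) *: w) by exact: (carZ H).
have Lca := Lc a a0; have Lcb := Lc b b0.
have Lcba : L (c b - c a) by exact: (carB H).
have Lz : L z by exact: (carB H).
have zn := nm_ge0 dot z.
pose f r := dot z (c r) - r * dot z w.
have df t : a <= t <= b -> rdiff f (dot z (c' t - w)) t.
  move=> /andP[at_ tb] e e0; have t0 : 0 <= t by exact: le_trans at_.
  have Lct := Lc t t0; have Lc't := Lc' t t0.
  have n1 : 0 < 1 + nm z by rewrite ltr_pwDl.
  have [d d0 hd] := hc t t0 _ (divr_gt0 e0 n1).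
  exists d => // r r0 rd; have Lcr := Lc r r0.
  have L1 : L (c r - c t) by exact: (carB H).
  have L2 : L ((r - t) *: c' t) by exact: (carZ H).
  rewrite (_ : _ - _ - _ = dot z (c r - c t - (r - t) *: c' t)); last first.
    by rewrite /f !(dotBr H)// (dotZr H)//; ring.
  apply: le_trans (cauchy_schwarz H Lz _) _; first exact: (carB H).
  apply: le_trans (ler_wpM2l zn (hd r r0 rd)) _.
  rewrite mulrA ler_wpM2r// mulrCA -[leRHS]mulr1 ler_wpM2l ?(ltW e0)//.
  by rewrite ler_pdivrMr// mul1r lerDr.
have [t tab e] := rdiff_MVT a0 ab df.
have {}tab : a <= t <= b by move: tab => /andP[/ltW -> /ltW ->].
have t0 : 0 <= t by move: tab => /andP[+ _]; exact: le_trans.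
have Lct := Lc' t t0.
have zz : nm z ^+ 2 = f b - f a.
  by rewrite (sqr_nm H)// /f {2}/z !(dotBr H)// (dotZr H)//; ring.
have ba : 0 < b - a by rewrite subr_gt0.
have : nm z ^+ 2 <= nm z * B * (b - a).
  rewrite zz e ler_pM2r//.
  apply: le_trans (le_trans (ler_norm _) (cauchy_schwarz H Lz _)) _; first exact: (carB H).
  by rewrite ler_wpM2l// hB.
have [->|zn0] := eqVneq (nm z) 0.
  move=> _; rewrite mulr_ge0// ?(ltW ba)//.
  exact: le_trans (nm_ge0 _ _) (hB t tab).
have {}zn0 : 0 < nm z by rewrite lt_neqAle eq_sym zn0.
by rewrite expr2 -mulrA ler_pM2l.
Qed.

Lemma cdiff_mean_value c c' (a b B : R) (w : V) : 0 <= a -> 0 <= b ->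
  (forall r, 0 <= r -> L (c r)) -> (forall r, 0 <= r -> L (c' r)) -> L w ->
  (forall t, 0 <= t -> cdiff dot c (c' t) t) ->
  (forall t, Num.min a b <= t <= Num.max a b -> nm (c' t - w) <= B) ->
  nm (c b - c a - (b - a) *: w) <= B * `|b - a|.
Proof.
move=> a0 b0 Lc Lc' Lw hc hB.
have [ab|ba|ab] := ltgtP a b.
- rewrite gtr0_norm ?subr_gt0//; apply: (@cdiff_mean_le c c') => // t /andP[t1 t2].
  by apply: hB; rewrite min_l ?max_r ?t1 ?t2// ltW.
- rewrite ltr0_norm ?subr_lt0// opprB.
  have -> : c b - c a - (b - a) *: w = - (c a - c b - (a - b) *: w).
    by rewrite -(opprB a b) scaleNr !opprD !opprK [c b - _]addrC.
  rewrite (nmN H).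
    apply: (@cdiff_mean_le c c') => // t /andP[t1 t2].
    by apply: hB; rewrite min_r ?max_l ?t1 ?t2// ltW.
  by apply: (carB H); [apply: (carB H); exact: Lc|exact: (carZ H)].
- by rewrite -ab !subrr scale0r subrr normr0 mulr0 -(scale0r w) (nmZ H)// normr0 mul0r.
Qed.

End DotCurves.

(** * Limit theorems and completeness of L^2 *)

Section Limits.
Context {R : realType}.
Local Notation mu := (@lebesgue_measure R).
Implicit Types (f g h : R -> R).

Lemma measurable_limn_einf (f : nat -> R -> \bar R) :
  (forall n, measurable_fun setT (f n)) ->
  measurable_fun setT (fun x => limn_einf (f^~ x)).
Proof.
move=> mf.
have -> : (fun x => limn_einf (f^~ x)) = (fun x => - limn_esup (fun n => - f n x))%E.
  by apply/funext => x; rewrite -[in RHS]/(limn_esup (-%E \o f^~ x)) limn_esupN oppeK.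
apply: measurableT_comp => //.
apply: (@measurable_fun_limn_esup _ _ _ _ (fun n x => (- f n x)%E)) => n.
exact: measurableT_comp.
Qed.

Lemma Rfatou (u : nat -> R -> R) g (B : R) :
  (forall n, intg (u n)) -> (forall n x, 0 <= u n x) ->
  measurable_fun setT g -> (forall x, 0 <= g x) ->
  {ae mu, forall x, u n x @[n --> \oo] --> g x} ->
  (forall n, \int[mu]_x u n x <= B) -> intg g /\ \int[mu]_x g x <= B.
Proof.
move=> Iu u0 mg g0 ug uB.
have mu_ n : measurable_fun setT (EFin \o u n).
  by apply/measurable_EFinP; exact: intg_meas.
have F := @fatou _ _ R mu setT measurableT (fun n => EFin \o u n) mu_ (fun n x _ => u0 n x).
have E : (\int[mu]_x (g x)%:E = \int[mu]_x limn_einf (fun n => (u n x)%:E))%E.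
  apply: ae_eq_integral => //.
  - exact/measurable_EFinP.
  - exact: (measurable_limn_einf mu_).
  - apply: aeS ug => x ux _.
    have : (u n x)%:E @[n --> \oo] --> (g x)%:E by apply: cvg_EFin => //; exact: nearW.
    by move=> /cvg_limn_einf_sup[->].
have le : (\int[mu]_x (g x)%:E <= B%:E)%E.
  rewrite E; apply: le_trans F _.
  have -> : (fun n => \int[mu]_x (EFin \o u n) x)%E = (fun n => (\int[mu]_x u n x)%:E).
    by apply/funext => n; rewrite -intg_fin.
  rewrite limn_einf_lim; apply: lime_le; first exact: is_cvg_einfs.
  apply: nearW => n; apply: (@le_trans _ _ (\int[mu]_x u n x)%:E).
    by apply: ereal_inf_lbound; exists n => /=.
  by rewrite lee_fin.
have Ig : intg g by apply: ge0_intg => //; exact: le_lt_trans le (ltry _).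
by split=> //; rewrite -lee_fin -intg_fin.
Qed.

Lemma Rdct (u : nat -> R -> R) f g :
  (forall n, measurable_fun setT (u n)) -> measurable_fun setT f ->
  {ae mu, forall x, u n x @[n --> \oo] --> f x} ->
  intg g -> (forall n x, `|u n x| <= g x) ->
  intg f /\ \int[mu]_x u n x @[n --> \oo] --> \int[mu]_x f x.
Proof.
move=> mu_ mf uf Ig ug.
have [] := @dominated_convergence _ _ R mu setT measurableT (fun n => EFin \o u n) (EFin \o f) (EFin \o g).
- by move=> n; apply/measurable_EFinP; exact: mu_.
- exact/measurable_EFinP.
- by apply: aeS uf => x ux _; apply: cvg_EFin => //; exact: nearW.
- exact: Ig.
- by apply: aeW => x n _ /=; rewrite lee_fin.
move=> If _ H; split; first exact: If.
have Iu n : intg (u n) by exact: (intg_le (mu_ n) (ug n)).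
by have /fine_cvgP[] : (\int[mu]_x (u n x)%:E)%E @[n --> \oo] --> (\int[mu]_x f x)%:E
  by rewrite -intg_fin.
Qed.

Definition null_seq (e : nat -> R) := e n @[n --> \oo] --> (0 : R).

Lemma null_seq_le (a b : nat -> R) : (forall n, 0 <= a n) -> (forall n, a n <= b n) ->
  null_seq b -> null_seq a.
Proof.
move=> a0 ab b0; apply: (@squeeze_cvgr _ _ _ _ (fun=> 0) b) => //; last exact: cvg_cst.
by apply: nearW => n; rewrite a0 ab.
Qed.

Lemma null_seqP (a : nat -> R) : (forall n, 0 <= a n) ->
  null_seq a <-> forall e, 0 < e -> exists N, forall n, (N <= n)%N -> a n <= e.
Proof.
move=> a0; split.
- move=> /cvgrPdist_le ha e e0; have [N _ hN] := ha e e0.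
  by exists N => n Nn; have := hN n Nn; rewrite sub0r normrN ger0_norm.
- move=> h; apply/cvgrPdist_le => e e0; have [N hN] := h e e0.
  by exists N => // n /= /hN; rewrite sub0r normrN ger0_norm.
Qed.

Definition nsq f : R := \int[mu]_x (f x ^+ 2).

Lemma nsq_ge0 f : 0 <= nsq f.
Proof. by apply: Rint_ge0 => x; exact: sqr_ge0. Qed.

(** Along a fast subsequence with increments d_k, the sum of 2^k |d_k|^2 is integrable, hence finite
almost everywhere, and |d_k| <= 2^-k + 2^k |d_k|^2 makes the increments summable. Fatou's lemma
then gives convergence in norm of the full sequence. *)
Lemma riesz_fischer (f : nat -> R -> R) : (forall n, l2 (f n)) ->
  (forall e, 0 < e -> exists N, forall m n, (N <= m)%N -> (N <= n)%N ->
     nsq (fun x => f m x - f n x) <= e) ->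
  exists2 g, l2 g & null_seq (fun n => nsq (fun x => f n x - g x)).
Proof.
move=> lf cf.
(* With 8^-k, the integral of 2^k |d_k|^2 is at most 4^-k. *)
pose eps (k : nat) : R := (2 ^- k) ^+ 3.
have eps0 k : 0 < eps k by rewrite /eps exprn_gt0// invr_gt0 exprn_gt0.
pose N k := sval (cid (cf _ (eps0 k))).
have hN k : forall m n, (N k <= m)%N -> (N k <= n)%N ->
     nsq (fun x => f m x - f n x) <= eps k by exact: svalP (cid (cf _ (eps0 k))).
(* M is a nondecreasing choice of indices above N. *)
pose M k := (\sum_(i < k.+1) N i)%N.
have NM k : (N k <= M k)%N by rewrite /M big_ord_recr/= leq_addl.
have MS k : (M k <= M k.+1)%N by rewrite /M [in leqRHS]big_ord_recr/= leq_addr.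
pose d k x := f (M k.+1) x - f (M k) x.
have ld k : l2 (d k) by exact: l2B.
have dk k : nsq (d k) <= eps k by apply: hN => //; exact: leq_trans (NM k) (MS k).
pose w k x := 2 ^+ k * d k x ^+ 2.
have w0 k x : 0 <= w k x by rewrite /w mulr_ge0// sqr_ge0.
have Iw k : intg (w k) by apply: intgZ; case: (ld k).
have Bw k : \int[mu]_x w k x <= (2 ^- 2) ^+ k.
  rewrite /w RintZ; last by case: (ld k).
  apply: le_trans (ler_wpM2l _ (dk k)) _; first exact: exprn_ge0.
  rewrite exprVn -exprM mulnC exprM /eps le_eqVlt; apply/orP; left; apply/eqP.
  by field; rewrite expf_neq0.
have mw k : measurable_fun setT (EFin \o w k) by apply/measurable_EFinP; exact: intg_meas.
have tot : (\int[mu]_x (\sum_(0 <= k <oo) (w k x)%:E) < +oo)%E.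
  rewrite (@integral_nneseries _ _ R mu setT measurableT (fun k x => (w k x)%:E))//; last first.
    by move=> k x _; rewrite lee_fin.
  apply: (@le_lt_trans _ _ (\sum_(0 <= k <oo) ((2 ^- 2) ^+ k)%:E)%E).
    apply: lee_nneseries => [k _ _|k *].
      by apply: integral_ge0 => x _; rewrite lee_fin.
    by rewrite intg_fin// lee_fin.
  suff : (\sum_(0 <= k < n) ((2 ^- 2 : R) ^+ k)%:E)%E @[n --> \oo] --> ((1 - 2 ^- 2)^-1 : R)%:E.
    by move=> /cvg_lim ->//; rewrite ltry.
  under eq_cvg do rewrite sumEFin.
  apply: cvg_EFin; first exact: nearW.
  have h : `|2 ^- 2 : R| < 1 by rewrite ger0_norm ?invr_ge0// invf_lt1//; lra.
  have := @cvg_geometric_series R 1 _ h; rewrite div1r; apply: cvg_trans.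
  apply: near_eq_cvg; apply: nearW => n /=; rewrite seriesEnat/=.
  by apply: eq_bigr => i _; rewrite mul1r.
have fin : {ae mu, forall x, (\sum_(0 <= k <oo) (w k x)%:E < +oo)%E}.
  have Is : mu.-integrable setT (fun x => \sum_(0 <= k <oo) (w k x)%:E)%E.
    apply/integrableP; split.
      apply: (@ge0_emeasurable_sum _ _ _ setT (fun k x => (w k x)%:E) xpredT).
        by move=> k x _ _; rewrite lee_fin.
      by move=> k _; exact: mw.
    apply: le_lt_trans tot; rewrite le_eqVlt; apply/orP; left; apply/eqP.
    by apply: eq_integral => x _; rewrite gee0_abs// nneseries_ge0// => k _ _; rewrite lee_fin.
  have := integrable_ae measurableT Is.
  by apply: aeS => x /(_ Logic.I); rewrite ge0_fin_numE// nneseries_ge0// => k _ _; rewrite lee_fin.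
have cd : {ae mu, forall x, cvgn (fun k => f (M k) x)}.
  apply: aeS fin => x fx.
  have sw : cvgn (series (fun k => w k x)).
    apply: nondecreasing_is_cvgn.
      by apply/nondecreasing_seqP => n; rewrite !seriesEnat/= big_nat_recr//= lerDl.
    exists (fine (\sum_(0 <= k <oo) (w k x)%:E)%E) => _ [n _ <-].
    rewrite -lee_fin fineK; last by rewrite ge0_fin_numE// nneseries_ge0// => k _ _; rewrite lee_fin.
    by rewrite seriesEnat/= -sumEFin; apply: nneseries_lim_ge => k _ _; rewrite lee_fin.
  have sd : cvgn (series (fun k => d k x)).
    apply: normed_cvg.
    apply: (@series_le_cvg _ _ (fun k => (2^-1) ^+ k + w k x)) => [k|k|k|]//=.
    - by rewrite addr_ge0// exprn_ge0 ?invr_ge0.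
    - rewrite /w -[d k x ^+ 2]real_normK ?num_real//.
      have p0 : 0 < (2 : R) ^+ k by exact: exprn_gt0.
      rewrite exprVn -(ler_pM2l p0) mulrDr divff ?lt0r_neq0//.
      set a := _ ^+ k in p0 *; set b := `|_|.
      have b0 : 0 <= b by exact: normr_ge0.
      nra.
    - rewrite (_ : series _ = series (fun k => (2^-1) ^+ k) + series (fun k => w k x)).
        apply: is_cvgD => //.
        have := @is_cvg_geometric_series R 1 2^-1; rewrite /geometric/=.
        under eq_fun do rewrite mul1r; apply.
        by rewrite ger0_norm ?invr_ge0// invf_lt1//; lra.
      by apply/funext => n; rewrite /series/=; exact: big_split.
  have -> : (fun k => f (M k) x) = (fun k => f (M 0) x + series (fun k => d k x) k).
    apply/funext => k; rewrite /series/= /d telescope_sumr//.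
    by rewrite addrC subrK.
  by apply: is_cvgD => //; exact: is_cvg_cst.
(* An upper limit is measurable and defined also where the subsequence diverges. *)
pose g x := fine (limn_esup (fun k => (f (M k) x)%:E)).
have mg : measurable_fun setT g.
  apply: measurableT_comp => //; apply: (@measurable_fun_limn_esup _ _ _ _ (fun k x => (f (M k) x)%:E)).
  by move=> n; apply/measurable_EFinP; case: (lf (M n)).
have fg : {ae mu, forall x, f (M k) x @[k --> \oo] --> g x}.
  apply: aeS cd => x cx.
  have : (f (M k) x)%:E @[k --> \oo] --> (limn (fun k => f (M k) x))%:E.
    by apply: cvg_EFin => //; exact: nearW.
  by rewrite /g => /cvg_limn_einf_sup[_ ->].
have lM k : (M 0 <= M k)%N by elim: k => // k /leq_trans; apply; exact: MS.
have Mmono j k : (M j <= M (k + j))%N by elim: k => // k /leq_trans; apply; exact: MS.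
have key (j n : nat) : (N j <= n)%N ->
    intg (fun x => (f n x - g x) ^+ 2) /\ nsq (fun x => f n x - g x) <= eps j.
  move=> jn.
  apply: (@Rfatou (fun k x => (f n x - f (M (k + j)%N) x) ^+ 2)) => //.
  - by move=> k; case: (l2B (lf n) (lf (M (k + j)%N))).
  - by move=> k x; exact: sqr_ge0.
  - by apply: measurable_funX; apply: measurable_funB => //; case: (lf n).
  - by move=> x; exact: sqr_ge0.
  - apply: aeS fg => x fx.
    have fx' : f n x - f (M (k + j)%N) x @[k --> \oo] --> f n x - g x.
      apply: cvgB; first exact: cvg_cst.
      by rewrite (cvg_shiftn j (fun k => f (M k) x)).
    by under eq_cvg do rewrite expr2; rewrite expr2; exact: cvgM.
  - move=> k; apply: hN => //.
    by apply: leq_trans (NM j) (Mmono j k).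
have lg : l2 g.
  have [I0 _] := key 0%N _ (leqnn _).
  have lfg : l2 (fun x => f (N 0%N) x - g x).
    by split=> //; apply: measurable_funB => //; case: (lf (N 0%N)).
  rewrite (_ : g = (fun x => f (N 0%N) x - (f (N 0%N) x - g x))).
    exact: l2B.
  by apply/funext => x; rewrite opprB addrC subrK.
exists g => //.
apply/null_seqP; first by move=> n; exact: nsq_ge0.
move=> e e0.
have e1 : null_seq (fun k => (2^-1) ^+ k : R).
  by apply: cvg_expr; rewrite ger0_norm ?invr_ge0// invf_lt1//; lra.
have [j hj] : exists j, eps j <= e.
  have [|J hJ] := (null_seqP (fun k => exprn_ge0 k (_ : 0 <= 2^-1 :> R))).1 e1 _ e0.
    by rewrite invr_ge0.
  exists J; apply: le_trans (hJ J (leqnn _)).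
  rewrite /eps -exprVn -exprM; apply: ler_wiXn2l.
  - by rewrite invr_ge0.
  - by rewrite invf_le1//; lra.
  - by rewrite leq_pmulr.
by exists (N j) => n jn; apply: le_trans hj; case: (key j n jn).
Qed.

End Limits.

(** * Abel weights and the Poisson kernel *)

Section Derivatives.
Context {R : realType}.
Implicit Types (f g : R -> R) (x a b : R).

Lemma is_deriveMf f g x a b : is_derive x 1 f a -> is_derive x 1 g b ->
  is_derive x 1 (fun y => f y * g y) (a * g x + f x * b).
Proof.
move=> df dg; have := @is_deriveM _ _ _ _ _ _ _ _ df dg.
by move=> h; apply: (is_derive_eq h); rewrite /GRing.scale/=; ring.
Qed.

Lemma is_deriveDf f g x a b : is_derive x 1 f a -> is_derive x 1 g b ->
  is_derive x 1 (fun y => f y + g y) (a + b).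
Proof. by move=> df dg; have := @is_deriveD _ _ _ _ _ _ _ _ _ df dg. Qed.

Lemma is_deriveZf f x a c : is_derive x 1 f a -> is_derive x 1 (fun y => c * f y) (c * a).
Proof. by move=> df; have := @is_deriveZ _ _ _ _ c _ _ _ df. Qed.

Lemma is_derivecf c x : is_derive x 1 (fun=> c : R) 0.
Proof. exact: is_derive_cst. Qed.

Lemma is_derive_lin c x : is_derive x 1 (fun y => c * y) c.
Proof.
have := @is_deriveZf (fun y => y) x 1 c (is_derive_id _ _).
by rewrite mulr1.
Qed.

Lemma is_derive_compf f g x a b : is_derive (g x) 1 f a -> is_derive x 1 g b ->
  is_derive x 1 (fun y => f (g y)) (a * b).
Proof. exact: is_derive1_comp. Qed.

Lemma is_derive_cont f x a : is_derive x 1 f a -> {for x, continuous f}.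
Proof. by move=> [df _]; apply/differentiable_continuous/derivable1_diffP. Qed.

End Derivatives.

Section Poisson.
Context {R : realType}.
Local Notation mu := (@lebesgue_measure R).
Implicit Types (f g h : R -> R).

Lemma odd_Rint f : intg f -> (forall x, f (- x) = - f x) -> \int[mu]_x f x = 0.
Proof.
move=> If of_; have m1 : (-1 : R) != 0 by rewrite oppr_eq0 oner_eq0.
have := @Rint_affine R (-1) 0 f m1 If.
rewrite normrN1 mul1r; under [RHS]eq_Rintegral do rewrite mulN1r addr0 of_ -mulN1r.
by rewrite RintZ// => h; lra.
Qed.

(** A factor that makes the integrals over the frequency variable converge; its integral
against a cosine is elementary. *)
Definition abel (e x : R) : R := expR (- (e * `|x|)).

Lemma abel_gt0 e x : 0 < abel e x. Proof. exact: expR_gt0. Qed.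

Lemma abel_le1 e x : 0 < e -> abel e x <= 1.
Proof. by move=> e0; rewrite -expR0 ler_expR oppr_le0 mulr_ge0// ltW. Qed.

(** An antiderivative of the integrand below on the right half line. *)
Let prim (e z x : R) : R :=
  expR (- e * x) * (- e^-1 + (e ^+ 2 + z ^+ 2)^-1 * (z * sin (z * x) + (- e) * cos (z * x))).

Let is_derive_prim (e z x : R) : 0 < e ->
  is_derive x 1 (prim e z) (expR (- e * x) * (1 + cos (z * x))).
Proof.
move=> e0.
have d1 : is_derive x 1 (fun y => expR (- e * y)) (expR (- e * x) * (- e)).
  by apply: is_derive_compf; exact: is_derive_lin.
have d2 : is_derive x 1 (fun y => sin (z * y)) (cos (z * x) * z).
  by apply: is_derive_compf; exact: is_derive_lin.
have d3 : is_derive x 1 (fun y => cos (z * y)) (- sin (z * x) * z).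
  by apply: is_derive_compf; exact: is_derive_lin.
apply: is_derive_eq; rewrite /GRing.scale/=; field.
by rewrite !lt0r_neq0// ltr_pwDl ?sqr_ge0 ?exprn_gt0.
Qed.

Lemma continuous_cosM (z : R) : continuous (fun x : R => cos (z * x)).
Proof.
move=> x; apply: (@is_derive_cont _ _ _ (- sin (z * x) * z)).
by apply: is_derive_compf; exact: is_derive_lin.
Qed.

Lemma continuous_abel (e : R) : continuous (abel e).
Proof.
move=> x; apply: (@continuous_comp _ _ _ (fun y : R => - (e * `|y|)) expR); last exact: continuous_expR.
apply: cvgN; apply: cvgM; first exact: cvg_cst.
exact: norm_continuous.
Qed.

(** Adding 1 to the cosine keeps the integrand nonnegative, so that the fundamental theorem of
calculus applies up to infinity; the contribution of the 1 is subtracted again in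
Rint_abel_cos. *)
Let half (e z : R) : 0 < e ->
  (\int[mu]_(x in [set x | (0 <= x)%R]) (abel e x * (1 + cos (z * x)))%:E =
  (e^-1 + e / (e ^+ 2 + z ^+ 2))%:E)%E.
Proof.
move=> e0.
have n0 : e ^+ 2 + z ^+ 2 != 0 by rewrite lt0r_neq0// ltr_pwDl ?sqr_ge0 ?exprn_gt0.
have -> : [set x : R | 0 <= x] = `[0, +oo[%classic.
  by apply/seteqP; split=> x /=; rewrite in_itv/= andbT.
transitivity (\int[mu]_(x in `[0%R, +oo[) (expR (- e * x) * (1 + cos (z * x)))%:E)%E.
  apply: eq_integral => x; rewrite inE/= in_itv/= andbT => x0.
  by rewrite /abel ger0_norm// mulNr.
have ct x : {for x, continuous (fun x : R => expR (- e * x) * (1 + cos (z * x)))}.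
  apply: cvgM.
    apply: (@is_derive_cont _ (fun y => expR (- e * y)) _ (expR (- e * x) * (- e))).
    by apply: is_derive_compf; exact: is_derive_lin.
  by apply: cvgD; [exact: cvg_cst|exact: continuous_cosM].
rewrite (@ge0_continuous_FTC2y R _ (prim e z) 0 0).
- rewrite -EFinB; congr EFin; rewrite /prim !mulr0 expR0 mul1r sin0 cos0 mulr0 add0r mulr1.
  by field; rewrite n0 lt0r_neq0.
- move=> x x0; apply: mulr_ge0; first exact: expR_ge0.
  by have := cos_geN1 (z * x); lra.
- exact: continuous_subspaceT.
- pose C := e^-1 + (e ^+ 2 + z ^+ 2)^-1 * (`|z| + e).
  have C0 : 0 <= C by rewrite addr_ge0 ?invr_ge0 ?(ltW e0)// mulr_ge0// ?invr_ge0 ?addr_ge0 ?sqr_ge0// ltW.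
  have lim0 : C * expR (- e * x) @[x --> +oo] --> (0 : R).
    rewrite -[X in _ --> X](mulr0 C); apply: cvgM; first exact: cvg_cst.
    have : expR (- (e * x)) @[x --> +oo] --> (0 : R).
      apply: (cvg_comp (fun x => e * x) (fun x => expR (- x))); last exact: cvgr_expR.
      by apply: gt0_cvgMry.
    by under eq_cvg do rewrite -mulNr.
  apply: (@squeeze_cvgr _ _ _ _ (fun x => - (C * expR (- e * x))) (fun x => C * expR (- e * x))).
  + apply: nearW => x; rewrite -ler_norml /prim normrM ger0_norm ?expR_ge0// mulrC.
    rewrite ler_wpM2r ?expR_ge0//; apply: le_trans (ler_normD _ _) _.
    rewrite normrN ger0_norm ?invr_ge0 ?(ltW e0)// lerD2l normrM ger0_norm; last first.
      by rewrite invr_ge0 addr_ge0 ?sqr_ge0.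
    rewrite ler_wpM2l ?invr_ge0 ?addr_ge0 ?sqr_ge0//.
    apply: le_trans (ler_normD _ _) _; rewrite !normrM normrN (gtr0_norm e0).
    apply: lerD.
      by rewrite -[leRHS]mulr1 ler_wpM2l// ler_norml sin_geN1 sin_le1.
    by rewrite -[leRHS]mulr1 ler_wpM2l ?(ltW e0)// ler_norml cos_geN1 cos_le1.
  + by rewrite -oppr0; apply: cvgN.
  + exact: lim0.
- by move=> x _; case: (is_derive_prim z x e0).
- apply: cvg_at_right_filter; exact: (is_derive_cont (is_derive_prim z 0 e0)).
- move=> x _; rewrite derive1E.
  by have [_ ->] := is_derive_prim z x e0.
Qed.

Let whole (e z : R) : 0 < e ->
  (\int[mu]_x (abel e x * (1 + cos (z * x)))%:E =
  (2 * (e^-1 + e / (e ^+ 2 + z ^+ 2)))%:E)%E.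
Proof.
move=> e0; rewrite ge0_symfun_integralT ?half//.
- move=> x; apply: mulr_ge0; first exact: expR_ge0.
  by have := cos_geN1 (z * x); lra.
- move=> x; apply: cvgM; first exact: continuous_abel.
  by apply: cvgD; [exact: cvg_cst|exact: continuous_cosM].
- by move=> x /=; rewrite /abel normrN mulrN cosN.
Qed.

Lemma measurable_abel e : measurable_fun setT (abel e).
Proof. by apply: continuous_measurable_fun; exact: continuous_abel. Qed.

Lemma measurable_cosM z : measurable_fun setT (fun x : R => cos (z * x)).
Proof. by apply: continuous_measurable_fun; exact: continuous_cosM. Qed.

Lemma intg_abel e : 0 < e -> intg (abel e).
Proof.
move=> e0; have := @whole e 0 e0.
under eq_integral do rewrite mul0r cos0.
move=> h; have : intg (fun x => abel e x * (1 + 1)).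
  apply: ge0_intg; first by apply: measurable_funM => //; exact: measurable_abel.
  - by move=> x; apply: mulr_ge0; [exact: expR_ge0|exact: addr_ge0].
  - by rewrite h ltry.
move=> /(intgZ 2^-1); congr intg; apply/funext => x; by field.
Qed.

Lemma Rint_abel e : 0 < e -> \int[mu]_x abel e x = 2 / e.
Proof.
move=> e0; have := @whole e 0 e0.
have I := intg_abel e0.
under eq_integral do rewrite mul0r cos0 mulrC.
rewrite intg_fin; last exact: intgZ.
move=> [] /=; rewrite RintZ// expr0n/= addr0 => h.
have -> : \int[mu]_x abel e x = 2^-1 * ((1 + 1) * \int[mu]_x abel e x) by field.
by rewrite h; field; rewrite lt0r_neq0.
Qed.

Lemma intg_abel_cos e z : 0 < e -> intg (fun x => abel e x * cos (z * x)).
Proof.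
move=> e0; have := @intgM _ (fun x => cos (z * x)) (abel e) 1 (measurable_cosM z) _ (intg_abel e0).
rewrite (_ : (fun x => abel e x * cos (z * x)) = (fun x => cos (z * x) * abel e x)).
  by apply => x; rewrite ler_norml cos_geN1 cos_le1.
by apply/funext => x; rewrite mulrC.
Qed.

Lemma Rint_abel_cos e z : 0 < e ->
  \int[mu]_x (abel e x * cos (z * x)) = 2 * e / (e ^+ 2 + z ^+ 2).
Proof.
move=> e0; have := @whole e z e0.
have I := intg_abel e0; have Ic := intg_abel_cos z e0.
under eq_integral do rewrite mulrDr mulr1.
rewrite intg_fin; last exact: intgD.
move=> []; rewrite RintD// Rint_abel//.
have n0 : e ^+ 2 + z ^+ 2 != 0 by rewrite lt0r_neq0// ltr_pwDl ?sqr_ge0 ?exprn_gt0.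
move=> h; have -> : \int[mu]_x (abel e x * cos (z * x)) =
  2 * (e^-1 + e / (e ^+ 2 + z ^+ 2)) - 2 / e by rewrite -h; ring.
by field; rewrite n0 lt0r_neq0.
Qed.

(** The Poisson kernel at e = 1. *)
Definition cauchy_dens (x : R) : R := 2 / (1 + x ^+ 2).

Lemma cauchy_dens_ge0 x : 0 <= cauchy_dens x.
Proof. by rewrite divr_ge0// addr_ge0// sqr_ge0. Qed.

Lemma continuous_cauchy_dens : continuous cauchy_dens.
Proof. by move=> x; apply: cvgM; [exact: cvg_cst|exact: continuous_oneDsqrV]. Qed.

Let whole_cauchy : (\int[mu]_x (cauchy_dens x)%:E = (2 * pi)%:E)%E.
Proof.
have h0 : (\int[mu]_x ((oneDsqr x)^-1)%:E = pi%:E)%E.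
  rewrite ge0_symfun_integralT.
  - have -> : [set x : R | 0 <= x] = `[0, +oo[%classic.
      by apply/seteqP; split=> x /=; rewrite in_itv/= andbT.
    rewrite integral0y_oneDsqr -EFinM; congr EFin; by field.
  - by move=> x; rewrite invr_ge0; apply: le_trans (oneDsqr_ge1 x).
  - exact: continuous_oneDsqrV.
  - by move=> x /=; rewrite /oneDsqr sqrrN.
rewrite /cauchy_dens; under eq_integral do rewrite EFinM.
rewrite ge0_integralZl_EFin//.
- by rewrite [X in (_ * X)%E]h0.
- by move=> x _; rewrite lee_fin invr_ge0; apply: le_trans (oneDsqr_ge1 x).
- apply/measurable_EFinP; apply: continuous_measurable_fun; exact: continuous_oneDsqrV.
Qed.

Lemma intg_cauchy_dens : intg cauchy_dens.
Proof.
apply: ge0_intg; [|exact: cauchy_dens_ge0|by rewrite whole_cauchy ltry].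
by apply: continuous_measurable_fun; exact: continuous_cauchy_dens.
Qed.

Lemma Rint_cauchy_dens : \int[mu]_x cauchy_dens x = 2 * pi.
Proof. by rewrite /Rintegral whole_cauchy. Qed.

End Poisson.

(** * The Plancherel identity for bounded continuous functions *)

Section Plancherel.
Context {R : realType}.
Local Notation mu := (@lebesgue_measure R).
Implicit Types (f g h : R -> R).

Definition Fc f (xi : R) : R := \int[mu]_x (f x * cos (xi * x)).
Definition Fs f (xi : R) : R := \int[mu]_x (f x * sin (xi * x)).

Lemma norm_cos_le1 (x : R) : `|cos x| <= 1.
Proof. by rewrite ler_norml cos_geN1 cos_le1. Qed.
Lemma norm_sin_le1 (x : R) : `|sin x| <= 1.
Proof. by rewrite ler_norml sin_geN1 sin_le1. Qed.

Lemma measurable_kcos : measurable_fun setT (fun z : R * R => cos (z.1 * z.2)).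
Proof.
apply: (measurableT_comp (f := cos)).
- by apply: continuous_measurable_fun; exact: continuous_cos.
- exact: measurable_funM.
Qed.

Lemma measurable_ksin : measurable_fun setT (fun z : R * R => sin (z.1 * z.2)).
Proof.
apply: (measurableT_comp (f := sin)).
- by apply: continuous_measurable_fun; exact: continuous_sin.
- exact: measurable_funM.
Qed.

Lemma measurable_sinM (z : R) : measurable_fun setT (fun x : R => sin (z * x)).
Proof. exact: (measurableT_comp measurable_ksin (pair1_measurable z)). Qed.

Lemma intgMr f (k : R -> R) (M : R) : intg f -> measurable_fun setT k -> (forall x, `|k x| <= M) ->
  intg (fun x => f x * k x).
Proof.
move=> If mk kM; rewrite (_ : (fun x => _) = (fun x => k x * f x)); first exact: (intgM mk kM).
by apply/funext => x; rewrite mulrC.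
Qed.

Lemma intg_cos f z : intg f -> intg (fun x => f x * cos (z * x)).
Proof. by move=> If; apply: intgMr => //; [exact: measurable_cosM|move=> x; exact: norm_cos_le1]. Qed.

Lemma intg_sin f z : intg f -> intg (fun x => f x * sin (z * x)).
Proof. by move=> If; apply: intgMr => //; [exact: measurable_sinM|move=> x; exact: norm_sin_le1]. Qed.

Lemma measurable_Fc f : intg f -> measurable_fun setT (Fc f).
Proof.
by move=> If; apply: (@measurable_kernel_int R f (fun xi x => cos (xi * x)) 1) => //;
  [exact: measurable_kcos|move=> *; exact: norm_cos_le1].
Qed.

Lemma measurable_Fs f : intg f -> measurable_fun setT (Fs f).
Proof.
by move=> If; apply: (@measurable_kernel_int R f (fun xi x => sin (xi * x)) 1) => //;
  [exact: measurable_ksin|move=> *; exact: norm_sin_le1].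
Qed.

Lemma Fc_bound f xi : intg f -> `|Fc f xi| <= \int[mu]_x `|f x|.
Proof.
move=> If; apply: Rint_norm_le; [exact: intg_cos|exact: intg_norm|move=> x].
by rewrite normrM -[leRHS]mulr1 ler_wpM2l// norm_cos_le1.
Qed.

Lemma Fs_bound f xi : intg f -> `|Fs f xi| <= \int[mu]_x `|f x|.
Proof.
move=> If; apply: Rint_norm_le; [exact: intg_sin|exact: intg_norm|move=> x].
by rewrite normrM -[leRHS]mulr1 ler_wpM2l// norm_sin_le1.
Qed.

Lemma FcB f g xi : intg f -> intg g -> Fc (fun x => f x - g x) xi = Fc f xi - Fc g xi.
Proof.
move=> If Ig; rewrite /Fc -RintB; [|exact: intg_cos|exact: intg_cos].
by apply: eq_Rintegral => x _; rewrite mulrBl.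
Qed.

Lemma FsB f g xi : intg f -> intg g -> Fs (fun x => f x - g x) xi = Fs f xi - Fs g xi.
Proof.
move=> If Ig; rewrite /Fs -RintB; [|exact: intg_sin|exact: intg_sin].
by apply: eq_Rintegral => x _; rewrite mulrBl.
Qed.

Lemma FcN f xi : Fc f (- xi) = Fc f xi.
Proof. by apply: eq_Rintegral => x _; rewrite mulNr cosN. Qed.

Lemma FsN f xi : intg f -> Fs f (- xi) = - Fs f xi.
Proof.
move=> If; rewrite /Fs -[RHS]mulN1r -RintZ; last exact: intg_sin.
by apply: eq_Rintegral => x _; rewrite mulNr sinN; ring.
Qed.

Lemma intg_abelM e (k : R -> R) (M : R) : 0 < e -> measurable_fun setT k -> (forall x, `|k x| <= M) ->
  intg (fun x => abel e x * k x).
Proof. by move=> e0; apply: intgMr; exact: intg_abel. Qed.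

(** T is the cosine or the sine transform of f. One exchange of integrals writes A as a transform
of abel * T, and a second one produces the quadratic form. *)
Let abel_quad f e (k : R -> R -> R) : 0 < e -> intg f ->
  measurable_fun setT (fun z : R * R => k z.1 z.2) -> (forall x y, `|k x y| <= 1) ->
  (forall x y, k x y = k y x) ->
  let T xi := \int[mu]_x (f x * k xi x) in
  let A x := \int[mu]_y (f y * \int[mu]_xi (abel e xi * k x xi * k y xi)) in
  [/\ intg (fun x => f x * A x), intg (fun xi => abel e xi * T xi ^+ 2) &
  \int[mu]_xi (abel e xi * T xi ^+ 2) = \int[mu]_x (f x * A x)].
Proof.
move=> e0 If mk k1 ks T A.
have kx x : measurable_fun setT (k x) by exact: (measurableT_comp mk (pair1_measurable x)).
have mT : measurable_fun setT T by exact: (measurable_kernel_int mk k1).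
have TB xi : `|T xi| <= \int[mu]_x `|f x|.
  apply: Rint_norm_le; [exact: intgMr (kx xi) (k1 xi)|exact: intg_norm|move=> x].
  by rewrite normrM -[leRHS]mulr1 ler_wpM2l.
have IaT : intg (fun xi => abel e xi * T xi) by exact: intg_abelM mT TB.
have AE x : A x = \int[mu]_xi (abel e xi * T xi * k x xi).
  rewrite /A.
  have := @swap_kernel R f (fun xi => abel e xi * k x xi) k 1 mk k1 If.
  rewrite (_ : (fun x0 => f x0 * \int[mu]_y (abel e y * k x y * k x0 y)) =
    (fun y => f y * \int[mu]_xi (abel e xi * k x xi * k y xi)))// => ->; last first.
    exact: intg_abelM (kx x) (k1 x).
  apply: eq_Rintegral => xi _; rewrite -mulrA [k x xi * _]mulrC mulrA; congr (_ * _ * _).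
  by apply: eq_Rintegral => y _; rewrite ks.
have mA : measurable_fun setT A.
  rewrite (_ : A = fun x => \int[mu]_xi (abel e xi * T xi * k x xi)); last exact/funext.
  exact: (measurable_kernel_int mk k1).
have AB x : `|A x| <= \int[mu]_xi `|abel e xi * T xi|.
  rewrite AE; apply: Rint_norm_le; [exact: intgMr (kx x) (k1 x)|exact: intg_norm|move=> xi].
  by rewrite normrM -[leRHS]mulr1 ler_wpM2l.
split.
- exact: intgMr mA AB.
- rewrite (_ : (fun xi => _) = (fun xi => abel e xi * T xi * T xi)); first exact: intgMr mT TB.
  by apply/funext => xi; rewrite expr2 mulrA.
- have := @swap_kernel R (fun xi => abel e xi * T xi) f k 1 mk k1 IaT If.
  rewrite (_ : (fun x => abel e x * T x * _) = (fun xi => abel e xi * T xi ^+ 2)).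
    move=> ->; apply: eq_Rintegral => x _; congr (_ * _); rewrite AE.
    by apply: eq_Rintegral => xi _; rewrite ks.
  by apply/funext => xi; rewrite expr2 mulrA.
Qed.

(** The squared modulus of the Fourier transform of a real function. *)
Definition sqr_FT f xi : R := Fc f xi ^+ 2 + Fs f xi ^+ 2.

Lemma sqr_FT_ge0 f xi : 0 <= sqr_FT f xi. Proof. by rewrite addr_ge0 ?sqr_ge0. Qed.

(** The quadratic forms of the cosine and of the sine add up to one with kernel
cos ((x - y) xi), and the integral of this against the Abel weight is the Poisson kernel. *)
Lemma abel_sqr_FT f e : 0 < e -> intg f ->
  intg (fun xi => abel e xi * sqr_FT f xi) /\
  \int[mu]_xi (abel e xi * sqr_FT f xi) =
  \int[mu]_x (f x * \int[mu]_y (f y * (2 * e / (e ^+ 2 + (x - y) ^+ 2)))).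
Proof.
move=> e0 If.
have [I1 J1 E1] := abel_quad e0 If measurable_kcos (fun x y => norm_cos_le1 _) (fun x y => congr1 cos (mulrC x y)).
have [I2 J2 E2] := abel_quad e0 If measurable_ksin (fun x y => norm_sin_le1 _) (fun x y => congr1 sin (mulrC x y)).
have -> : (fun xi => abel e xi * sqr_FT f xi) = (fun xi => abel e xi * Fc f xi ^+ 2 + abel e xi * Fs f xi ^+ 2).
  by apply/funext => xi; rewrite /sqr_FT mulrDr.
split; first exact: intgD.
etransitivity; first exact: (RintD J1 J2).
rewrite E1 E2 -(RintD I1 I2).
apply: eq_Rintegral => x _; rewrite -mulrDr; congr (_ * _).
have mkc y : intg (fun xi => abel e xi * cos (x * xi) * cos (y * xi)).
  by apply: intg_cos; exact: intg_cos (intg_abel e0).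
have mks y : intg (fun xi => abel e xi * sin (x * xi) * sin (y * xi)).
  by apply: intg_sin; exact: intg_sin (intg_abel e0).
rewrite -RintD.
- apply: eq_Rintegral => y _; rewrite -mulrDr; congr (_ * _).
  rewrite -RintD// -(Rint_abel_cos _ e0); apply: eq_Rintegral => xi _.
  by rewrite mulrBl cosB; ring.
- apply: (@intgMr _ _ (\int[mu]_xi `|abel e xi * cos (x * xi)|)) => //.
    apply: (@measurable_kernel_int R (fun xi => abel e xi * cos (x * xi)) (fun y xi => cos (y * xi)) 1).
    + exact: measurable_kcos.
    + by move=> *; exact: norm_cos_le1.
    + exact: intg_cos (intg_abel e0).
  move=> y; apply: Rint_norm_le => //; first exact/intg_norm/intg_cos/intg_abel.
  by move=> xi; rewrite normrM -[leRHS]mulr1 ler_wpM2l// norm_cos_le1.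
- apply: (@intgMr _ _ (\int[mu]_xi `|abel e xi * sin (x * xi)|)) => //.
    apply: (@measurable_kernel_int R (fun xi => abel e xi * sin (x * xi)) (fun y xi => sin (y * xi)) 1).
    + exact: measurable_ksin.
    + by move=> *; exact: norm_sin_le1.
    + exact: intg_sin (intg_abel e0).
  move=> y; apply: Rint_norm_le => //; first exact/intg_norm/intg_sin/intg_abel.
  by move=> xi; rewrite normrM -[leRHS]mulr1 ler_wpM2l// norm_sin_le1.
Qed.

Definition poisson (e t : R) : R := 2 * e / (e ^+ 2 + t ^+ 2).

Lemma poisson_ge0 e t : 0 < e -> 0 <= poisson e t.
Proof.
move=> e0; apply: divr_ge0; first by rewrite mulr_ge0// ltW.
by rewrite addr_ge0// sqr_ge0.
Qed.

Lemma poisson_le e t : 0 < e -> poisson e t <= 2 * e / e ^+ 2.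
Proof.
move=> e0; have e2 : 0 < e ^+ 2 by exact: exprn_gt0.
have p : 0 < e ^+ 2 + t ^+ 2 by rewrite ltr_pwDl ?sqr_ge0.
rewrite /poisson ler_wpM2l ?mulr_ge0 ?(ltW e0)// lef_pV2 ?posrE//.
by rewrite lerDl sqr_ge0.
Qed.

Lemma norm_poisson_le e t : 0 < e -> `|poisson e t| <= 2 * e / e ^+ 2.
Proof. by move=> e0; rewrite ger0_norm ?poisson_ge0// poisson_le. Qed.

Lemma continuous_poisson e : 0 < e -> continuous (poisson e).
Proof.
move=> e0 t; apply: cvgM; first exact: cvg_cst.
apply: cvgV; first by rewrite lt0r_neq0// ltr_pwDl ?sqr_ge0 ?exprn_gt0.
apply: cvgD; first exact: cvg_cst.
exact: exprn_continuous.
Qed.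

Lemma measurable_poisson e : 0 < e -> measurable_fun setT (fun z : R * R => poisson e (z.1 - z.2)).
Proof.
move=> e0; apply: (measurableT_comp (f := poisson e)).
- by apply: continuous_measurable_fun; exact: continuous_poisson.
- exact: measurable_funB.
Qed.

Lemma poisson_scale f e x : 0 < e -> intg f ->
  \int[mu]_y (f y * poisson e (x - y)) = \int[mu]_z (f (e * z + x) * cauchy_dens z).
Proof.
move=> e0 If.
have e2 : 0 < e ^+ 2 by exact: exprn_gt0.
have Ih : intg (fun y => f y * poisson e (x - y)).
  apply: (@intgMr _ _ (2 * e / e ^+ 2)) => //.
    exact: (measurableT_comp (measurable_poisson e0) (pair1_measurable x)).
  by move=> y; exact: norm_poisson_le.
rewrite (@Rint_affine R e x _ (lt0r_neq0 e0) Ih) gtr0_norm// -RintZ; last first.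
  exact: (intg_affine x (lt0r_neq0 e0) Ih).
apply: eq_Rintegral => z _; rewrite /cauchy_dens /poisson.
have n1 : 1 + z ^+ 2 != 0 by rewrite lt0r_neq0// ltr_pwDl ?sqr_ge0.
rewrite (_ : x - (e * z + x) = - (e * z)); last by ring.
rewrite sqrrN exprMn (_ : e ^+ 2 + _ = e ^+ 2 * (1 + z ^+ 2)); last by ring.
by field; rewrite n1 lt0r_neq0.
Qed.

(** The Poisson integrals of f are bounded and tend pointwise to 2 pi f, because f is bounded and
continuous. Hence the Abel means of |f^|^2 tend to 2 pi ||f||^2. Fatou's lemma makes |f^|^2
integrable, and dominated convergence shows that its Abel means tend to its integral. *)
Lemma plancherel_cont f (M : R) : intg f -> (forall x, `|f x| <= M) ->
  continuous f ->
  intg (sqr_FT f) /\ \int[mu]_xi sqr_FT f xi = 2 * pi * nsq f.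
Proof.
move=> If fM cf.
have M0 : 0 <= M by exact: le_trans (fM 0).
have mf := intg_meas If.
pose e_ (n : nat) : R := n.+1%:R^-1.
have e0 n : 0 < e_ n by rewrite /e_ invr_gt0.
have ce : e_ n @[n --> \oo] --> (0 : R) by exact: cvg_harmonic.
pose In n x := \int[mu]_y (f y * poisson (e_ n) (x - y)).
have InE n x : In n x = \int[mu]_z (f (e_ n * z + x) * cauchy_dens z).
  exact: poisson_scale.
have mIn n : measurable_fun setT (In n).
  apply: (@measurable_kernel_int R f (fun x y => poisson (e_ n) (x - y)) (2 * e_ n / e_ n ^+ 2)) => //.
    exact: measurable_poisson.
  by move=> x y; exact: norm_poisson_le.
have Icd : intg (fun z => M * cauchy_dens z) by apply: intgZ; exact: intg_cauchy_dens.
have mcd : measurable_fun setT (@cauchy_dens R) by apply: intg_meas; exact: intg_cauchy_dens.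
have mfc n x : measurable_fun setT (fun z => f (e_ n * z + x) * cauchy_dens z).
  by apply: measurable_funM => //; exact: measurable_comp_affine.
have bfc n x z : `|f (e_ n * z + x) * cauchy_dens z| <= M * cauchy_dens z.
  by rewrite normrM (ger0_norm (cauchy_dens_ge0 z)) ler_wpM2r// cauchy_dens_ge0.
have bIn n x : `|In n x| <= M * (2 * pi).
  rewrite InE -Rint_cauchy_dens -RintZ; last exact: intg_cauchy_dens.
  by apply: Rint_norm_le => //; exact: intg_le Icd.
have cIn : {ae mu, forall x, In n x @[n --> \oo] --> f x * (2 * pi)}.
  apply: aeW => x; have cx := cf x.
  under eq_cvg do rewrite InE.
  rewrite -Rint_cauchy_dens -RintZ; last exact: intg_cauchy_dens.
  apply: (Rdct (g := fun z => M * cauchy_dens z) _ _ _ Icd _).2 => //.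
  - by apply: measurable_funM.
  - apply: aeW => z; apply: cvgM; last exact: cvg_cst.
    have hz : e_ n * z + x @[n --> \oo] --> x.
      rewrite -[X in _ --> X]add0r -[X in _ --> X + _](mul0r z).
      by apply: cvgD; [apply: cvgM => //|]; exact: cvg_cst.
    exact: (cvg_comp _ _ hz cx).
pose Q n := \int[mu]_xi (abel (e_ n) xi * sqr_FT f xi).
have QE n : Q n = \int[mu]_x (f x * In n x) by have [_] := abel_sqr_FT (e0 n) If.
have IQ n : intg (fun xi => abel (e_ n) xi * sqr_FT f xi) by have [] := abel_sqr_FT (e0 n) If.
have Ig : intg (fun x => M * (2 * pi) * `|f x|) by apply: intgZ; exact: intg_norm.
have bQ n x : `|f x * In n x| <= M * (2 * pi) * `|f x|.
  by rewrite normrM mulrC ler_wpM2r.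
have mfI n : measurable_fun setT (fun x => f x * In n x) by exact: measurable_funM.
have Qlim : Q n @[n --> \oo] --> 2 * pi * nsq f.
  under eq_cvg do rewrite QE.
  have [] := Rdct (f := fun x => f x * (f x * (2 * pi))) mfI _ _ Ig bQ.
  - by apply: measurable_funM => //; exact: measurable_funM.
  - by apply: aeS cIn => x cx; apply: cvgM => //; exact: cvg_cst.
  move=> I1; rewrite (_ : \int[mu]_x _ = 2 * pi * nsq f)//.
  rewrite /nsq -RintZ; first by apply: eq_Rintegral => x _; ring.
  by case: (intg_bounded_l2 If fM).
have mp : measurable_fun setT (sqr_FT f).
  by apply: measurable_funD; apply: measurable_funX; [exact: measurable_Fc|exact: measurable_Fs].
have ca xi : abel (e_ n) xi @[n --> \oo] --> (1 : R).
  rewrite -expR0 -oppr0 -[X in expR (- X)](mul0r `|xi|).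
  have h : - (e_ n * `|xi|) @[n --> \oo] --> - (0 * `|xi|).
    by apply: cvgN; apply: cvgM => //; exact: cvg_cst.
  exact: (cvg_comp _ _ h (@continuous_expR R _)).
have cap xi : abel (e_ n) xi * sqr_FT f xi @[n --> \oo] --> sqr_FT f xi.
  by rewrite -[X in _ --> X]mul1r; apply: cvgM => //; exact: cvg_cst.
have [Ip _] : intg (sqr_FT f) /\ \int[mu]_xi sqr_FT f xi <= \int[mu]_x (M * (2 * pi) * `|f x|).
  apply: (@Rfatou _ (fun n xi => abel (e_ n) xi * sqr_FT f xi)) => //.
  - by move=> n xi; rewrite mulr_ge0// ?sqr_FT_ge0// ltW// abel_gt0.
  - by move=> xi; exact: sqr_FT_ge0.
  - exact: aeW.
  - move=> n; rewrite -/(Q n) QE; apply: le_trans (ler_norm _) _.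
    by apply: Rint_norm_le => //; exact: intg_le Ig.
split=> //.
have acap : {ae mu, forall xi, abel (e_ n) xi * sqr_FT f xi @[n --> \oo] --> sqr_FT f xi}.
  exact: aeW.
have [|_ Q2] := Rdct (fun n => intg_meas (IQ n)) mp acap Ip.
  move=> n xi; rewrite ger0_norm; last by rewrite mulr_ge0// ?sqr_FT_ge0// ltW// abel_gt0.
  by rewrite -[leRHS]mul1r ler_wpM2r ?sqr_FT_ge0// abel_le1.
exact: cvg_unique Q2 Qlim.
Qed.

End Plancherel.

(** * Square integrable complex functions *)

Section PairL2.
Context {R : realType}.
Local Notation mu := (@lebesgue_measure R).

(** Complex-valued functions as pairs of a real and an imaginary part: this is a real vector space,
and the real part of the Hermitian product makes it a semi-inner product space. The regular
module R^o provides the scaling of the two components. *)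
Definition pfun : lmodType R := ((R -> R^o) * (R -> R^o))%type.

Definition pl2 (p : pfun) : Prop := l2 p.1 /\ l2 p.2.

Definition dot (p q : pfun) : R :=
  \int[mu]_x (p.1 x * q.1 x) + \int[mu]_x (p.2 x * q.2 x).

Lemma dot_semi_inner : semi_inner pl2 dot.
Proof.
split.
- by move=> p q [p1 p2] [q1 q2]; split; exact: l2D.
- by move=> a p [p1 p2]; split; exact: l2Z.
- by move=> p q; rewrite /dot; congr (_ + _); apply: eq_Rintegral => x _; rewrite mulrC.
- move=> p q r [p1 p2] [q1 q2] [r1 r2]; rewrite /dot/=.
  under eq_Rintegral do rewrite mulrDl.
  under [X in _ + X = _]eq_Rintegral do rewrite mulrDl.
  by rewrite !RintD; [ring|exact: l2M..].
- move=> a p q [p1 p2] [q1 q2]; rewrite /dot/=.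
  under eq_Rintegral do rewrite -mulrA.
  under [X in _ + X = _]eq_Rintegral do rewrite -mulrA.
  by rewrite !RintZ; [ring|exact: l2M..].
- by move=> p _; rewrite addr_ge0//; apply: Rint_ge0 => x; rewrite -expr2 sqr_ge0.
Qed.

Local Notation H := dot_semi_inner.

Lemma dot_nsq (p : pfun) : dot p p = nsq p.1 + nsq p.2.
Proof. by rewrite /dot /nsq; congr (_ + _); apply: eq_Rintegral => x _; rewrite expr2. Qed.

Lemma l2_0 : l2 (0 : R -> R). Proof. exact: l20. Qed.

Definition rfun (f : R -> R) : pfun := (f, 0).

Lemma pl2_rfun f : l2 f -> pl2 (rfun f).
Proof. by move=> lf; split=> //; exact: l2_0. Qed.

Lemma dot_rfun f g : dot (rfun f) (rfun g) = \int[mu]_x (f x * g x).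
Proof.
rewrite /dot/= [X in _ + X](_ : _ = 0) ?addr0//.
under eq_Rintegral do rewrite mul0r.
by rewrite /Rintegral integral0.
Qed.

Definition pae (p q : pfun) : Prop :=
  {ae mu, forall x, p.1 x = q.1 x} /\ {ae mu, forall x, p.2 x = q.2 x}.

Lemma pae_refl p : pae p p.
Proof. by split; apply: aeW. Qed.

Lemma pae_sym p q : pae p q -> pae q p.
Proof. by move=> [h1 h2]; split; [apply: aeS h1|apply: aeS h2]. Qed.

Lemma pae_lin (a : R) p q p' q' : pae p p' -> pae q q' -> pae (p + a *: q) (p' + a *: q').
Proof.
move=> [h1 h2] [k1 k2]; split.
- by apply: aeS2 h1 k1 => x hx kx; rewrite -[LHS]/(p.1 x + a * q.1 x) hx kx.
- by apply: aeS2 h2 k2 => x hx kx; rewrite -[LHS]/(p.2 x + a * q.2 x) hx kx.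
Qed.

Lemma dot_ae p q p' q' : pl2 p -> pl2 q -> pl2 p' -> pl2 q' -> pae p p' -> pae q q' ->
  dot p q = dot p' q'.
Proof.
move=> [p1 p2] [q1 q2] [p1' p2'] [q1' q2'] [h1 h2] [k1 k2].
rewrite /dot; congr (_ + _); apply: eq_ae_Rint.
- exact: intg_meas (l2M p1 q1).
- exact: intg_meas (l2M p1' q1').
- by apply: aeS2 h1 k1 => x -> ->.
- exact: intg_meas (l2M p2 q2).
- exact: intg_meas (l2M p2' q2').
- by apply: aeS2 h2 k2 => x -> ->.
Qed.

Lemma dot_eq0_ae p : pl2 p -> dot p p = 0 -> pae p 0.
Proof.
move=> [p1 p2]; rewrite dot_nsq => h.
have n1 := nsq_ge0 p.1; have n2 := nsq_ge0 p.2.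
by split; apply: l2_sqr_eq0 => //; rewrite -/(nsq _); lra.
Qed.

Lemma subr_ae0 p q : pae (p - q) 0 -> pae p q.
Proof. by move=> [h1 h2]; split; [apply: aeS h1|apply: aeS h2] => x /= /eqP; rewrite subr_eq0 => /eqP. Qed.

Definition ncvg (P : nat -> pfun) (p : pfun) := null_seq (fun n => dot (P n - p) (P n - p)).

Lemma null_seq_sqrt (a : nat -> R) : null_seq a -> null_seq (fun n => Num.sqrt (a n)).
Proof.
move=> ha; have := cvg_comp _ _ ha (@sqrt_continuous R 0).
by rewrite sqrtr0.
Qed.

Lemma null_seq_sqr (a : nat -> R) : null_seq a -> null_seq (fun n => a n ^+ 2).
Proof.
move=> ha; have h : a n * a n @[n --> \oo] --> (0 * 0 : R) by exact: cvgM.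
rewrite mulr0 in h.
by rewrite /null_seq (_ : (fun n => a n ^+ 2) = (fun n => a n * a n)).
Qed.

Lemma null_seqD (a b : nat -> R) : null_seq a -> null_seq b -> null_seq (fun n => a n + b n).
Proof. by move=> ha hb; rewrite /null_seq -[X in _ --> X](addr0 0); exact: cvgD. Qed.

Lemma null_seqZ c (a : nat -> R) : null_seq a -> null_seq (fun n => c * a n).
Proof. by move=> ha; rewrite /null_seq -[X in _ --> X](mulr0 c); apply: cvgM => //; exact: cvg_cst. Qed.

Lemma null_cst_eq0 (a : R) : null_seq (fun=> a) -> a = 0.
Proof. by move=> h; apply: (cvg_unique _ _ h) => //; exact: cvg_cst. Qed.

Lemma ncvg_dot P p : (forall n, pl2 (P n)) -> pl2 p -> ncvg P p ->
  dot (P n) (P n) @[n --> \oo] --> dot p p.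
Proof.
move=> lP lp h.
have hn : nm dot (P n) @[n --> \oo] --> nm dot p.
  apply/cvgrPdist_le => e e0.
  have /cvgrPdist_le/(_ e e0) := null_seq_sqrt h.
  apply: filterS => n; rewrite sub0r normrN (ger0_norm (sqrtr_ge0 _)) distrC.
  by apply: le_trans; exact: (nmB_le H).
have h2 : nm dot (P n) * nm dot (P n) @[n --> \oo] --> nm dot p * nm dot p by exact: cvgM.
rewrite -(sqr_nm H lp) expr2.
rewrite (_ : (fun n => dot (P n) (P n)) = (fun n => nm dot (P n) * nm dot (P n)))//.
by apply/funext => n; rewrite -expr2 (sqr_nm H).
Qed.

Lemma ncvg_lin P Q p q (a : R) : (forall n, pl2 (P n)) -> (forall n, pl2 (Q n)) -> pl2 p -> pl2 q ->
  ncvg P p -> ncvg Q q -> ncvg (fun n => P n + a *: Q n) (p + a *: q).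
Proof.
move=> lP lQ lp lq hp hq; rewrite /ncvg.
have L1 n : pl2 (P n - p) by exact: (carB H).
have L2 n : pl2 (Q n - q) by exact: (carB H).
apply: (@null_seq_le _ _ (fun n => (nm dot (P n - p) + `|a| * nm dot (Q n - q)) ^+ 2)).
- by move=> n; apply: (dot_ge0 H); apply: (carB H); apply: (carD H) => //; exact: (carZ H).
- move=> n; have -> : P n + a *: Q n - (p + a *: q) = (P n - p) + a *: (Q n - q).
    by rewrite scalerBr opprD addrACA.
  have La : pl2 (a *: (Q n - q)) by exact: (carZ H).
  have Lb : pl2 (P n - p + a *: (Q n - q)) by exact: (carD H).
  rewrite -(sqr_nm H Lb) lerXn2r// ?nnegrE ?nm_ge0//.
  + by rewrite addr_ge0 ?mulr_ge0 ?nm_ge0.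
  + by apply: le_trans (nmD H (L1 n) La) _; rewrite (nmZ H).
- apply: null_seq_sqr; apply: null_seqD; first exact: null_seq_sqrt.
  by apply: null_seqZ; exact: null_seq_sqrt.
Qed.

Lemma ncvg_unique P p q : (forall n, pl2 (P n)) -> pl2 p -> pl2 q ->
  ncvg P p -> ncvg P q -> pae p q.
Proof.
move=> lP lp lq hp hq; apply/pae_sym/subr_ae0/dot_eq0_ae; first exact: (carB H).
apply: null_cst_eq0.
have := ncvg_lin (-1) lP lP lp lq hp hq; rewrite /ncvg.
under eq_fun do rewrite scaleN1r subrr sub0r scaleN1r.
move=> h; apply: (@null_seq_le _ _ _ _ _ h) => n; first by apply: (dot_ge0 H); exact: (carB H).
by rewrite opprB.
Qed.

Lemma ncvg_ext P Q p : (forall n, P n = Q n) -> ncvg P p -> ncvg Q p.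
Proof. by move=> e; rewrite (_ : P = Q)//; apply/funext. Qed.

Lemma pair_complete (P : nat -> pfun) : (forall n, pl2 (P n)) ->
  (forall e, 0 < e -> exists N, forall m n, (N <= m)%N -> (N <= n)%N ->
     dot (P m - P n) (P m - P n) <= e) ->
  exists2 p, pl2 p & ncvg P p.
Proof.
move=> lP cP.
have [|f lf hf] := @riesz_fischer R (fun n => (P n).1) (fun n => (lP n).1).
  move=> e e0; have [N hN] := cP e e0; exists N => m n Nm Nn.
  apply: le_trans (hN m n Nm Nn); rewrite dot_nsq lerDl; exact: nsq_ge0.
have [|g lg hg] := @riesz_fischer R (fun n => (P n).2) (fun n => (lP n).2).
  move=> e e0; have [N hN] := cP e e0; exists N => m n Nm Nn.
  apply: le_trans (hN m n Nm Nn); rewrite dot_nsq lerDr; exact: nsq_ge0.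
exists (f, g) => //.
rewrite /ncvg; under eq_fun do rewrite dot_nsq.
exact: null_seqD.
Qed.

End PairL2.

(** * Density of bounded continuous functions *)

Section Density.
Context {R : realType}.
Local Notation mu := (@lebesgue_measure R).
Implicit Types (f g h : R -> R).

Definition clamp (K t : R) : R := Num.max (- K) (Num.min t K).

Lemma clamp_id K t : `|t| <= K -> clamp K t = t.
Proof.
by rewrite ler_norml => /andP[h1 h2]; rewrite /clamp min_l// max_r.
Qed.

Lemma clamp_bound K t : 0 <= K -> `|clamp K t| <= K.
Proof.
move=> K0; rewrite ler_norml /clamp le_max lexx/= ge_max.
by rewrite ge_min lexx orbT andbT; lra.
Qed.

Lemma clamp_lip K s t : `|clamp K s - clamp K t| <= `|s - t|.
Proof.
have h1 := ler_norm (s - t); have h2 := ler_norm (t - s); rewrite (distrC t s) in h2.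
rewrite /clamp ler_norml /Order.max /Order.min.
by case: (ltP s K) => ?; case: (ltP t K) => ?; case: (ltP (- K) s) => ?;
  case: (ltP (- K) t) => ?; case: (ltP (- K) K) => ?; apply/andP; split; lra.
Qed.

Lemma continuous_clamp K : continuous (clamp K).
Proof.
move=> t; apply/cvgrPdist_le => e e0; near=> s.
apply: le_trans (clamp_lip _ _ _) _; near: s.
by apply/nbhs_ballP; exists e => // y; rewrite /ball/= => /ltW.
Unshelve. all: by end_near. Qed.

Lemma measurable_clamp K : measurable_fun setT (clamp K).
Proof. by apply: continuous_measurable_fun; exact: continuous_clamp. Qed.

Lemma intg_restrict f (E : set R) : measurable E -> mu.-integrable E (EFin \o f) ->
  intg (fun x => \1_E x * f x).
Proof.
move=> mE If; have := (@integrable_mkcond _ _ R mu E (EFin \o f) mE).1 If.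
congr (integrable _ _ _); apply/funext => x /=; rewrite /patch indicE.
by case: ifPn => xE /=; rewrite ?mul1r ?mul0r.
Qed.

Lemma Rint_restrict f (E : set R) : measurable E ->
  \int[mu]_(x in E) f x = \int[mu]_x (\1_E x * f x).
Proof.
move=> mE; rewrite Rintegral_mkcond; apply: eq_Rintegral => x _.
by rewrite /patch indicE; case: ifPn => xE /=; rewrite ?mul1r ?mul0r.
Qed.

Lemma indic_le1 (E : set R) x : `|\1_E x : R| <= 1.
Proof. by rewrite indicE; case: (_ \in _); rewrite ?normr1 ?normr0. Qed.

Let cutset f k : set R := [set x | `|x| <= k%:R /\ `|f x| <= k%:R].

Let measurable_cutset f k : measurable_fun setT f -> measurable (cutset f k).
Proof.
move=> mf.
have -> : cutset f k = ((fun x : R => `|x|) @^-1` `]-oo, k%:R]) `&` ((fun x => `|f x|) @^-1` `]-oo, k%:R]).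
  by apply/seteqP; split=> x /=; rewrite !in_itv/=.
apply: measurableI.
- rewrite -[X in measurable X]setTI.
  have h : measurable_fun setT (fun x : R => `|x|) by exact: measurableT_comp.
  by apply: h => //; exact: measurable_itv.
- rewrite -[X in measurable X]setTI.
  have h : measurable_fun setT (fun x : R => `|f x|) by exact: measurableT_comp.
  by apply: h => //; exact: measurable_itv.
Qed.

(** Restriction to the set where both |x| and |f x| are at most k; then k tends to infinity. *)
Lemma cut_approx f (e : R) : intg f -> l2 f -> 0 < e -> exists k : nat, exists g,
  [/\ intg g, l2 g, forall x, `|g x| <= k%:R, forall x, k%:R < `|x| -> g x = 0 &
      \int[mu]_x `|f x - g x| <= e /\ nsq (fun x => f x - g x) <= e].
Proof.
move=> If lf e0.
pose g (k : nat) x := \1_(cutset f k) x * f x.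
have mf := intg_meas If.
have mI k : measurable_fun setT (\1_(cutset f k) : R -> R).
  by apply: measurable_indic; exact: measurable_cutset.
have Ig k : intg (g k) by apply: intgM (mI k) _ If => x; exact: indic_le1.
have lg k : l2 (g k) by apply: l2_bounded (mI k) _ lf => x; exact: indic_le1.
have fg k x : `|f x - g k x| <= `|f x|.
  by rewrite /g indicE; case: (_ \in _); rewrite ?mul1r ?mul0r ?subrr ?normr0 ?subr0.
have cg x : \forall k \near \oo, f x - g k x = 0.
  have [K hK] : exists K : nat, Num.max `|x| `|f x| <= K%:R.
    exists (Num.truncn (Num.max `|x| `|f x|)).+1.
    by apply/ltW/truncnS_gt.
  exists K => // k /= Kk; rewrite /g indicE mem_set ?mul1r ?subrr//.
  move: hK; rewrite ge_max => /andP[h1 h2].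
  by split; [apply: le_trans h1 _|apply: le_trans h2 _]; rewrite ler_nat.
have c1 : \int[mu]_x `|f x - g k x| @[k --> \oo] --> (0 : R).
  have -> : (0 : R) = \int[mu]_x (cst 0 x) by rewrite /Rintegral integral0.
  apply: (Rdct (g := fun x => `|f x|) _ _ _ (intg_norm If) _).2 => //.
  - move=> k; apply: measurableT_comp => //; apply: measurable_funB => //; exact: intg_meas.
  - apply: aeW => x; apply: cvg_near_cst.
    by apply: filterS (cg x) => k ->; rewrite normr0.
  - by move=> k x; rewrite normr_id.
have c2 : nsq (fun x => f x - g k x) @[k --> \oo] --> (0 : R).
  have -> : (0 : R) = \int[mu]_x (cst 0 x) by rewrite /Rintegral integral0.
  apply: (Rdct (g := fun x => f x ^+ 2) _ _ _ lf.2 _).2 => //.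
  - by move=> k; apply: measurable_funX; apply: measurable_funB => //; exact: intg_meas.
  - apply: aeW => x; apply: cvg_near_cst.
    by apply: filterS (cg x) => k ->; rewrite expr0n.
  - move=> k x; rewrite normrX -[f x ^+ 2]real_normK ?num_real//.
    by rewrite lerXn2r// nnegrE.
move/cvgrPdist_le : c1 => /(_ e e0) [K1 _ h1].
move/cvgrPdist_le : c2 => /(_ e e0) [K2 _ h2].
exists (maxn K1 K2), (g (maxn K1 K2)); split => //.
- move=> x; rewrite /g indicE; have [|_] := boolP (_ \in _); last by rewrite mul0r normr0.
  by rewrite inE => -[_]; rewrite mul1r.
- move=> x kx; rewrite /g indicE memNset ?mul0r// => -[].
  by rewrite leNgt kx.
- split.
  + have := h1 (maxn K1 K2) (leq_maxl _ _).
    by rewrite sub0r normrN; apply: le_trans; exact: ler_norm.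
  + have := h2 (maxn K1 K2) (leq_maxr _ _).
    by rewrite sub0r normrN; apply: le_trans; exact: ler_norm.
Qed.

Definition plateau (K x : R) : R := (clamp 1 (2 * (K - `|x|) - 1) + 1) / 2.

Lemma continuous_plateau K : continuous (plateau K).
Proof.
move=> x; apply: cvgM; last exact: cvg_cst.
apply: cvgD; last exact: cvg_cst.
apply: (@continuous_comp _ _ _ (fun x : R => 2 * (K - `|x|) - 1) (clamp 1)); last exact: continuous_clamp.
apply: cvgB; last exact: cvg_cst.
apply: cvgM; first exact: cvg_cst.
apply: cvgB; first exact: cvg_cst.
exact: norm_continuous.
Qed.

Lemma plateau_itv K x : 0 <= plateau K x <= 1.
Proof. by have := clamp_bound (2 * (K - `|x|) - 1) ler01; rewrite ler_norml /plateau; lra. Qed.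

Lemma plateau1 K x : `|x| <= K - 1 -> plateau K x = 1.
Proof.
move=> h; rewrite /plateau (_ : clamp _ _ = 1); first by field.
by rewrite /clamp min_r ?max_r//; lra.
Qed.

Lemma plateau0 K x : K <= `|x| -> plateau K x = 0.
Proof.
move=> h; rewrite /plateau (_ : clamp _ _ = -1); first by field.
by rewrite /clamp min_l ?max_l//; lra.
Qed.

(** A cut-off of f is approximated in L^1 by continuous functions on a compact interval. Clamping
their height and multiplying them by a plateau does not increase the distance, and for functions
bounded by K the square of the L^2 norm is at most 2 K times the L^1 norm. *)
Lemma cont_dense f (e : R) : intg f -> l2 f -> 0 < e -> exists g,
  [/\ intg g, l2 g, exists M, forall x, `|g x| <= M, continuous g &
      \int[mu]_x `|f x - g x| <= e /\ nsq (fun x => f x - g x) <= e].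
Proof.
move=> If lf e0.
have e4 : 0 < e / 4 by rewrite divr_gt0.
have [k [h [Ih lh hk h0 [d1 d2]]]] := cut_approx If lf e4.
(* The plateau is 1 on [-k, k], where h is supported, and 0 outside [-K, K]. *)
pose K : R := k%:R + 1.
have k0 : (0 : R) <= k%:R by exact: ler0n.
have K0 : 0 < K by rewrite /K; lra.
have hK x : `|h x| <= K by apply: le_trans (hk x) _; rewrite /K; lra.
pose E : set R := `[- K, K]%classic.
have mE : measurable E by exact: measurable_itv.
have muE : (mu E < +oo)%E.
  by rewrite lebesgue_measure_itv/=; case: ifPn => _; rewrite ?ltry// -EFinB ltry.
have IhE : mu.-integrable E (EFin \o h) by apply: (integrableS measurableT).
have [u [cu Iu hu]] := approximation_continuous_integrable mE muE IhE.
pose g n x := plateau K x * clamp K (u n x).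
have cg n : continuous (g n).
  move=> x; apply: cvgM; first exact: continuous_plateau.
  apply: (@continuous_comp _ _ _ (u n) (clamp K)); first exact: cu.
  exact: continuous_clamp.
have mg n : measurable_fun setT (g n) by exact: continuous_measurable_fun.
have np x : `|plateau K x| = plateau K x by rewrite ger0_norm//; have /andP[] := plateau_itv K x.
have gK n x : `|g n x| <= K.
  rewrite /g normrM -[leRHS]mul1r; apply: ler_pM => //.
    by rewrite np; have /andP[] := plateau_itv K x.
  by apply: clamp_bound; exact: ltW.
have inE x : x \in E = (`|x| <= K) by rewrite ler_norml; apply/idP/idP; rewrite inE /E/= in_itv.
have pE x : plateau K x <= \1_E x.
  rewrite indicE inE; case: (leP `|x| K) => xK; first by have /andP[] := plateau_itv K x.
  by rewrite plateau0// ltW.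
have Ig n : intg (g n).
  have I1 : intg (fun x => \1_E x * K).
    apply: (@intg_restrict (fun=> K)) => //; apply/integrableP; split.
      by apply/measurable_EFinP; exact: measurable_cst.
    have -> : (\int[mu]_(x in E) `|(EFin \o (fun=> K)) x| = \int[mu]_(x in E) cst K%:E x)%E.
      by apply: eq_integral => x _ /=; rewrite ger0_norm// ltW.
    by rewrite integral_cst// lte_mul_pinfty// lee_fin ltW.
  apply: intg_le I1 => // x; rewrite /g normrM np; apply: ler_pM => //.
    by have /andP[] := plateau_itv K x.
  by rewrite clamp_bound// ltW.
have hg n x : `|h x - g n x| <= \1_E x * `|h x - u n x|.
  have [xk|xk] := leP `|x| k%:R.
    rewrite /g plateau1 ?mul1r ?indicE ?inE; last by rewrite /K addrK.
    rewrite (_ : `|x| <= K) ?mul1r; last by rewrite /K; lra.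
    by rewrite -{1}(clamp_id (hK x)); exact: clamp_lip.
  rewrite h0// !sub0r !normrN /g normrM np; apply: ler_pM => //.
    by have /andP[] := plateau_itv K x.
  have := clamp_lip K (u n x) 0; rewrite [clamp K 0]clamp_id ?normr0 ?(ltW K0)//.
  by rewrite !subr0.
have Ihu n : intg (fun x => \1_E x * `|h x - u n x|).
  have := intg_norm (intgB (intg_restrict mE IhE) (intg_restrict mE (Iu n))).
  congr intg; apply/funext => x; rewrite -mulrBr normrM.
  by rewrite (ger0_norm (_ : 0 <= \1_E x :> R))// indicE.
(* Bounds the L^1 error by e / 4 and, times 2 K, the square of the L^2 error by e / 4. *)
pose de := Num.min (e / 4) (e / 4 / (2 * K)).
have de0 : 0 < de by rewrite lt_min e4 divr_gt0// mulr_gt0.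
have [n hn] : exists n, \int[mu]_x (\1_E x * `|h x - u n x|) <= de.
  have : (\int[mu]_x (\1_E x * `|h x - u n x|)%:E)%E @[n --> \oo] --> 0%E.
    apply: cvg_trans hu; apply: near_eq_cvg; apply: nearW => n.
    rewrite integral_mkcond; apply: eq_integral => x _.
    by rewrite /patch indicE; case: ifPn => xE /=; rewrite ?mul1r ?mul0r.
  move=> /fine_cvgP[_ /cvgrPdist_le/(_ _ de0)][N _ hN].
  exists N; have := hN N (leqnn _); rewrite sub0r normrN; apply: le_trans; exact: ler_norm.
have lg : l2 (g n) by exact: intg_bounded_l2 (Ig n) (gK n).
have Idg : intg (fun x => `|h x - g n x|) by exact/intg_norm/intgB.
have I1 : \int[mu]_x `|h x - g n x| <= de.
  by apply: le_trans hn; apply: Rint_le.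
have I2 : nsq (fun x => h x - g n x) <= e / 4.
  apply: (@le_trans _ _ (2 * K * de)); last first.
    by rewrite mulrC -ler_pdivlMr ?mulr_gt0//; rewrite /de ge_min lexx orbT.
  apply: (@le_trans _ _ (2 * K * \int[mu]_x `|h x - g n x|)); last first.
    by rewrite ler_pM2l// mulr_gt0.
  rewrite -RintZ//.
  apply: Rint_le; [by case: (l2B lh lg)|exact: intgZ|move=> x].
  rewrite -[leLHS]real_normK ?num_real// expr2 ler_wpM2r//.
  by apply: le_trans (ler_normB _ _) _; have := hK x; have := gK n x; lra.
exists (g n); split => //; first by exists K.
split.
- apply: (@le_trans _ _ (\int[mu]_x (`|f x - h x| + `|h x - g n x|))).
    apply: Rint_le; [exact/intg_norm/intgB|apply: intgD => //; exact/intg_norm/intgB|move=> x].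
    by rewrite (_ : f x - g n x = (f x - h x) + (h x - g n x)) ?ler_normD//; ring.
  rewrite RintD//; last exact/intg_norm/intgB.
  have : de <= e / 4 by rewrite /de ge_min lexx.
  by move: I1 d1; lra.
- have lfh := l2B lf lh; have lhg := l2B lh lg.
  apply: (@le_trans _ _ (\int[mu]_x (2 * (f x - h x) ^+ 2 + 2 * (h x - g n x) ^+ 2))).
    apply: Rint_le; [by case: (l2B lf lg)|apply: intgD; apply: intgZ; [by case: lfh|by case: lhg]|move=> x].
    rewrite (_ : f x - g n x = (f x - h x) + (h x - g n x)); last by ring.
    by move: (f x - h x) (h x - g n x) => a b; have := sqr_ge0 (a - b); nra.
  rewrite RintD; [|by apply: intgZ; case: lfh|by apply: intgZ; case: lhg].
  rewrite !RintZ; [|by case: lhg|by case: lfh].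
  by rewrite -/(nsq _) -[X in _ + _ * X]/(nsq _); lra.
Qed.

End Density.

(** * The Fourier transform on L^2 *)

Section PlancherelL2.
Context {R : realType}.
Local Notation mu := (@lebesgue_measure R).
Local Notation H := (@dot_semi_inner R).
Implicit Types (f g h : R -> R).

Lemma pi2_gt0 : 0 < 2 * pi :> R. Proof. by rewrite mulr_gt0// pi_gt0. Qed.

Lemma approx_seq f : intg f -> l2 f -> exists g : nat -> R -> R,
  [/\ forall n, intg (g n) /\ l2 (g n),
      forall n, intg (sqr_FT (g n)) /\ \int[mu]_xi sqr_FT (g n) xi = 2 * pi * nsq (g n),
      null_seq (fun n => \int[mu]_x `|f x - g n x|) &
      null_seq (fun n => nsq (fun x => f x - g n x))].
Proof.
move=> If lf.
have h n : exists g, [/\ intg g, l2 g, exists M, forall x, `|g x| <= M, continuous g &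
      \int[mu]_x `|f x - g x| <= n.+1%:R^-1 /\ nsq (fun x => f x - g x) <= n.+1%:R^-1].
  by apply: cont_dense => //; rewrite invr_gt0.
pose g n := sval (cid (h n)).
have hg n := svalP (cid (h n)).
have ch : null_seq (fun n => n.+1%:R^-1 : R) by exact: cvg_harmonic.
exists g; split.
- by move=> n; have [] := hg n.
- by move=> n; have [Ig _ [M gM] cg _] := hg n; exact: plancherel_cont gM cg.
- apply: null_seq_le ch => n; first by apply: Rint_ge0.
  by have [_ _ _ _ []] := hg n.
- apply: null_seq_le ch => n; first exact: nsq_ge0.
  by have [_ _ _ _ []] := hg n.
Qed.

Lemma null_cvg (u : nat -> R) (l : R) (e : nat -> R) :
  (forall n, `|u n - l| <= e n) -> null_seq e -> u n @[n --> \oo] --> l.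
Proof.
move=> ue e0; apply/cvgrPdist_le => eps eps0.
have /cvgrPdist_le/(_ eps eps0) := e0; apply: filterS => n.
rewrite sub0r normrN distrC => h; apply: le_trans (ue n) _.
by apply: le_trans h; exact: ler_norm.
Qed.

Lemma nsq_cvg f (g : nat -> R -> R) : l2 f -> (forall n, l2 (g n)) ->
  null_seq (fun n => nsq (fun x => f x - g n x)) -> nsq (g n) @[n --> \oo] --> nsq f.
Proof.
move=> lf lg h.
have := @ncvg_dot R (fun n => rfun (g n)) (rfun f) (fun n => pl2_rfun (lg n)) (pl2_rfun lf).
under eq_cvg do rewrite dot_rfun.
rewrite dot_rfun /nsq => /(_ _) H1.
rewrite (_ : (fun n => \int[mu]_x (g n x ^+ 2)) = (fun n => \int[mu]_x (g n x * g n x))); last first.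
  by apply/funext => n; apply: eq_Rintegral => x _; rewrite expr2.
rewrite (_ : \int[mu]_x (f x ^+ 2) = \int[mu]_x (f x * f x)); last first.
  by apply: eq_Rintegral => x _; rewrite expr2.
apply: H1; apply: null_seq_le h => n; first by apply: (dot_ge0 H); apply: (carB H); exact: pl2_rfun.
rewrite dot_nsq/= -[leRHS]addr0 le_eqVlt; apply/orP; left; apply/eqP; congr (_ + _).
- by apply: eq_Rintegral => x _; rewrite -[LHS]sqrrN opprB.
- rewrite /nsq (_ : (fun x => _) = cst (0 : R)) /Rintegral ?integral0//.
  by apply/funext => x; rewrite -[LHS]/((0 - 0) ^+ 2) subrr expr0n.
Qed.

(** The transforms of the approximations converge pointwise, since they do in L^1; Fatou's lemma
gives one half of the identity. *)
Let sqr_FT_le f : intg f -> l2 f -> intg (sqr_FT f) /\ \int[mu]_xi sqr_FT f xi <= 2 * pi * nsq f.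
Proof.
move=> If lf; have [g [Lg Pg g1 g2]] := approx_seq If lf.
have Ig n := (Lg n).1; have lg n := (Lg n).2.
have cF (xi : R) : Fc (g n) xi @[n --> \oo] --> Fc f xi.
  apply: (null_cvg _ g1) => n.
  by rewrite -normrN opprB -FcB//; apply: Fc_bound; exact: intgB.
have cS (xi : R) : Fs (g n) xi @[n --> \oo] --> Fs f xi.
  apply: (null_cvg _ g1) => n.
  by rewrite -normrN opprB -FsB//; apply: Fs_bound; exact: intgB.
have cp (xi : R) : sqr_FT (g n) xi @[n --> \oo] --> sqr_FT f xi.
  rewrite /sqr_FT !expr2; under eq_cvg do rewrite !expr2.
  by apply: cvgD; apply: cvgM.
have mp : measurable_fun setT (sqr_FT f).
  by apply: measurable_funD; apply: measurable_funX; [exact: measurable_Fc|exact: measurable_Fs].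
have key (e : R) : 0 < e -> intg (sqr_FT f) /\ \int[mu]_xi sqr_FT f xi <= 2 * pi * nsq f + e.
  move=> e0.
  have c : 2 * pi * nsq (g n) @[n --> \oo] --> 2 * pi * nsq f.
    by apply: cvgM; [exact: cvg_cst|exact: nsq_cvg].
  move/cvgrPdist_le : c => /(_ e e0)[N _ hN].
  apply: (@Rfatou _ (fun n => sqr_FT (g (n + N)%N))).
  - by move=> n; have [] := Pg (n + N)%N.
  - by move=> n x; exact: sqr_FT_ge0.
  - by [].
  - exact: sqr_FT_ge0.
  - by apply: aeW => xi; rewrite (cvg_shiftn N (fun n => sqr_FT (g n) xi)).
  - move=> n; have [_ ->] := Pg (n + N)%N.
    have := hN (n + N)%N (leq_addl _ _); rewrite ler_norml => /andP[+ _]; lra.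
split; first by have [] := key 1 ltr01.
by apply/ler_addgt0Pr => e e0; have [] := key e e0.
Qed.

(** The real and imaginary part of the integral of exp (- i xi x) (p.1 x + i p.2 x). *)
Definition FT (p : @pfun R) : @pfun R :=
  ((fun xi => Fc p.1 xi + Fs p.2 xi), (fun xi => Fc p.2 xi - Fs p.1 xi)).

Definition pintg (p : @pfun R) := intg p.1 /\ intg p.2.

Lemma l2_Fc f : intg f -> l2 f -> l2 (Fc f).
Proof.
move=> If lf; have [Ip _] := sqr_FT_le If lf; split; first exact: measurable_Fc.
apply: (intg_le _ _ Ip); first by apply: measurable_funX; exact: measurable_Fc.
by move=> x; rewrite ger0_norm ?sqr_ge0// lerDl sqr_ge0.
Qed.

Lemma l2_Fs f : intg f -> l2 f -> l2 (Fs f).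
Proof.
move=> If lf; have [Ip _] := sqr_FT_le If lf; split; first exact: measurable_Fs.
apply: (intg_le _ _ Ip); first by apply: measurable_funX; exact: measurable_Fs.
by move=> x; rewrite ger0_norm ?sqr_ge0// lerDr sqr_ge0.
Qed.

Lemma l2_FT p : pintg p -> pl2 p -> pl2 (FT p).
Proof.
move=> [i1 i2] [l1 l2']; split.
- by apply: l2D; [exact: l2_Fc|exact: l2_Fs].
- by apply: l2B; [exact: l2_Fc|exact: l2_Fs].
Qed.

(** The product is odd, as cosine transforms are even and sine transforms are odd. *)
Lemma Fc_Fs_orth f g : intg f -> l2 f -> intg g -> l2 g ->
  \int[mu]_xi (Fc f xi * Fs g xi) = 0.
Proof.
move=> If lf Ig lg; apply: odd_Rint.
- by apply: l2M; [exact: l2_Fc|exact: l2_Fs].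
- by move=> x; rewrite FcN FsN// mulrN.
Qed.

Lemma dot_FT p : pintg p -> pl2 p ->
  dot (FT p) (FT p) = \int[mu]_xi sqr_FT p.1 xi + \int[mu]_xi sqr_FT p.2 xi.
Proof.
move=> [i1 i2] [l1 l2']; rewrite dot_nsq /nsq /FT/=.
have c1 := l2_Fc i1 l1; have s1 := l2_Fs i1 l1.
have c2 := l2_Fc i2 l2'; have s2 := l2_Fs i2 l2'.
have E1 : \int[mu]_x ((Fc p.1 x + Fs p.2 x) ^+ 2) = nsq (Fc p.1) + nsq (Fs p.2).
  have -> : \int[mu]_x ((Fc p.1 x + Fs p.2 x) ^+ 2) =
     \int[mu]_x ((Fc p.1 x ^+ 2 + Fs p.2 x ^+ 2) + 2 * (Fc p.1 x * Fs p.2 x)).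
    by apply: eq_Rintegral => x _; ring.
  rewrite (RintD (intgD c1.2 s2.2) (intgZ 2 (l2M c1 s2))) (RintZ 2 (l2M c1 s2)).
  by rewrite (Fc_Fs_orth i1 l1 i2 l2') mulr0 addr0 (RintD c1.2 s2.2).
have E2 : \int[mu]_x ((Fc p.2 x - Fs p.1 x) ^+ 2) = nsq (Fc p.2) + nsq (Fs p.1).
  have -> : \int[mu]_x ((Fc p.2 x - Fs p.1 x) ^+ 2) =
     \int[mu]_x ((Fc p.2 x ^+ 2 + Fs p.1 x ^+ 2) + (- 2) * (Fc p.2 x * Fs p.1 x)).
    by apply: eq_Rintegral => x _; ring.
  rewrite (RintD (intgD c2.2 s1.2) (intgZ (-2) (l2M c2 s1))) (RintZ (-2) (l2M c2 s1)).
  by rewrite (Fc_Fs_orth i2 l2' i1 l1) mulr0 addr0 (RintD c2.2 s1.2).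
have P f : intg f -> l2 f -> \int[mu]_xi sqr_FT f xi = nsq (Fc f) + nsq (Fs f).
  by move=> If lf; exact: (RintD (l2_Fc If lf).2 (l2_Fs If lf).2).
rewrite E1 E2 (P _ i1 l1) (P _ i2 l2').
by move: (nsq (Fc p.1)) (nsq (Fs p.1)) (nsq (Fc p.2)) (nsq (Fs p.2)) => a b c d; ring.
Qed.

Lemma FTB p q : pintg p -> pintg q -> FT (p - q) = FT p - FT q.
Proof.
move=> [p1 p2] [q1 q2]; congr (_, _); apply/funext => xi.
- rewrite -[RHS]/((Fc p.1 xi + Fs p.2 xi) - (Fc q.1 xi + Fs q.2 xi)).
  by rewrite [Fc _ xi](FcB xi p1 q1) [Fs _ xi](FsB xi p2 q2); ring.
- rewrite -[RHS]/((Fc p.2 xi - Fs p.1 xi) - (Fc q.2 xi - Fs q.1 xi)).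
  by rewrite [Fc _ xi](FcB xi p2 q2) [Fs _ xi](FsB xi p1 q1); ring.
Qed.

(** The inequality sqr_FT_le, applied to differences, shows that the transforms of the continuous
approximations converge in L^2, so that the identity passes to the limit. *)
Lemma plancherel_L1L2 f : intg f -> l2 f -> \int[mu]_xi sqr_FT f xi = 2 * pi * nsq f.
Proof.
move=> If lf; have [g [Lg Pg g1 g2]] := approx_seq If lf.
have E h : intg h -> l2 h -> \int[mu]_xi sqr_FT h xi = dot (FT (rfun h)) (FT (rfun h)).
  move=> Ih lh; rewrite dot_FT//=; first last.
  - exact: pl2_rfun.
  - by split=> //; exact: integrable0.
  rewrite [X in _ + X](_ : _ = 0) ?addr0//.
  rewrite (_ : sqr_FT _ = cst (0 : R)) /Rintegral ?integral0//.
  apply/funext => xi; rewrite /sqr_FT /Fc /Fs.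
  under eq_Rintegral do rewrite mul0r.
  under [X in _ + X ^+ 2]eq_Rintegral do rewrite mul0r.
  by rewrite /Rintegral integral0 expr0n addr0.
have i0 h : intg h -> pintg (rfun h) by move=> Ih; split=> //; exact: integrable0.
have Ig n := (Lg n).1; have lg n := (Lg n).2.
have c : ncvg (fun n => FT (rfun (g n))) (FT (rfun f)).
  apply: (@null_seq_le _ _ (fun n => 2 * pi * nsq (fun x => f x - g n x))).
  - by move=> n; apply: (dot_ge0 H); apply: (carB H); apply: l2_FT; by [exact: i0|exact: pl2_rfun].
  - move=> n; rewrite -FTB; [|exact: i0..].
    have -> : rfun (g n) - rfun f = rfun (fun x => g n x - f x).
      by congr (_, _); apply/funext => x; exact: subrr.
    rewrite -E; [|exact: intgB|exact: l2B].
    apply: le_trans (sqr_FT_le _ _).2 _; [exact: intgB|exact: l2B|].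
    rewrite ler_pM2l ?pi2_gt0//.
    rewrite (_ : nsq _ = nsq (fun x => f x - g n x))//.
    by apply: eq_Rintegral => x _; rewrite -[LHS]sqrrN opprB.
  - exact: null_seqZ.
have := ncvg_dot _ _ c.
rewrite -E// => /(_ _ _) L1.
have L2 : dot (FT (rfun (g n))) (FT (rfun (g n))) @[n --> \oo] --> 2 * pi * nsq f.
  have -> : (fun n => dot (FT (rfun (g n))) (FT (rfun (g n)))) = (fun n => 2 * pi * nsq (g n)).
    by apply/funext => n; rewrite -E//; have [_ ->] := Pg n.
  by apply: cvgM; [exact: cvg_cst|exact: nsq_cvg].
apply: (cvg_unique _ (L1 _ _) L2) => //.
- by move=> n; apply: l2_FT; [exact: i0|exact: pl2_rfun].
- by apply: l2_FT; [exact: i0|exact: pl2_rfun].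
Qed.

Lemma plancherel_pair p : pintg p -> pl2 p -> dot (FT p) (FT p) = 2 * pi * dot p p.
Proof.
move=> ip lp; rewrite dot_FT//; case: ip => i1 i2; case: lp => l1 l2'.
by rewrite !plancherel_L1L2// dot_nsq; ring.
Qed.

Definition box (n : nat) : set R := `[- n%:R, n%:R]%classic.

Definition ptrunc (p : @pfun R) (n : nat) : @pfun R :=
  ((fun x => \1_(box n) x * p.1 x), (fun x => \1_(box n) x * p.2 x)).

Definition isFT (p P : @pfun R) : Prop :=
  pl2 P /\ ncvg (fun n => FT (ptrunc p n)) P.

Lemma measurable_box n : measurable (box n). Proof. exact: measurable_itv. Qed.

Lemma mu_box n : (mu (box n) < +oo)%E.
Proof.
by rewrite /box lebesgue_measure_itv/=; case: ifPn => _; rewrite ?ltry// -EFinB ltry.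
Qed.

Lemma l2_trunc f n : l2 f -> l2 (fun x => \1_(box n) x * f x).
Proof.
by apply: l2_bounded; [apply: measurable_indic; exact: measurable_box|exact: indic_le1].
Qed.

Lemma intg_trunc f n : l2 f -> intg (fun x => \1_(box n) x * f x).
Proof.
move=> lf; rewrite (_ : (fun x => _) = (fun x => \1_(box n) x * (\1_(box n) x * f x))).
  apply: l2M; last exact: l2_trunc.
  split; first by apply: measurable_indic; exact: measurable_box.
  have := @intg_restrict _ (fun=> 1) _ (measurable_box n).
  rewrite (_ : (fun x => \1_(box n) x * 1) = (fun x => \1_(box n) x ^+ 2)); last first.
    by apply/funext => x; rewrite indicE; case: (_ \in _); rewrite ?mul1r ?mul0r ?expr1n ?expr0n.
  apply; apply/integrableP; split; first by apply/measurable_EFinP; exact: measurable_cst.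
  have -> : (\int[mu]_(x in box n) `|(EFin \o (fun=> 1%R)) x| = \int[mu]_(x in box n) cst 1%E x)%E.
    by apply: eq_integral => x _ /=; rewrite normr1.
  rewrite integral_cst; last exact: measurable_box.
  by rewrite mul1e; exact: mu_box.
by apply/funext => x; rewrite indicE; case: (_ \in _); rewrite ?mul1r ?mul0r.
Qed.

Lemma pl2_trunc p n : pl2 p -> pl2 (ptrunc p n).
Proof. by move=> [l1 l2']; split; exact: l2_trunc. Qed.

Lemma pintg_trunc p n : pl2 p -> pintg (ptrunc p n).
Proof. by move=> [l1 l2']; split; exact: intg_trunc. Qed.

Lemma nsq_trunc_cvg f : l2 f -> null_seq (fun n => nsq (fun x => \1_(box n) x * f x - f x)).
Proof.
move=> lf; rewrite /null_seq (_ : (0 : R) = \int[mu]_x (cst 0 x)); last first.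
  by rewrite /Rintegral integral0.
apply: (Rdct (g := fun x => f x ^+ 2) _ _ _ lf.2 _).2 => //.
- by move=> n; case: (l2B (l2_trunc n lf) lf) => mh _; exact: measurable_funX.
- apply: aeW => x; apply: cvg_near_cst.
  exists (Num.truncn `|x|).+1 => // n /= hn.
  rewrite indicE mem_set ?mul1r ?subrr ?expr0n//= /box/= in_itv/= -ler_norml.
  by apply/ltW; apply: lt_le_trans (truncnS_gt _) _; rewrite ler_nat.
- move=> n x; rewrite normrX -[f x ^+ 2]real_normK ?num_real// lerXn2r// ?nnegrE//.
  by rewrite indicE; case: (_ \in _); rewrite ?mul1r ?mul0r ?subrr ?normr0 ?sub0r ?normrN.
Qed.

Lemma ptrunc_cvg p : pl2 p -> ncvg (ptrunc p) p.
Proof.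
move=> [l1 l2']; rewrite /ncvg; under eq_fun do rewrite dot_nsq.
by apply: null_seqD; exact: nsq_trunc_cvg.
Qed.

(** The truncations form a Cauchy sequence, and Plancherel's identity carries this over to their
transforms. *)
Lemma isFT_exists p : pl2 p -> exists P, isFT p P.
Proof.
move=> lp; have lt n := pl2_trunc n lp; have it n := pintg_trunc n lp.
have [||P lP hP] := @pair_complete R (fun n => FT (ptrunc p n)); last by exists P.
- by move=> n; exact: l2_FT.
move=> e e0.
pose e' := e / (8 * pi).
have p0 := @pi_gt0 R.
have e'0 : 0 < e' by rewrite divr_gt0// mulr_gt0.
have [N hN] := (null_seqP (fun n => dot_ge0 H (carB H (lt n) lp))).1 (ptrunc_cvg lp) e' e'0.
exists N => m n Nm Nn; rewrite -FTB// plancherel_pair; first last.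
- exact: (carB H).
- by split; apply: intgB; [case: (it m)|case: (it n)|case: (it m)|case: (it n)].
set a := ptrunc p m - p; set b := ptrunc p n - p.
have -> : ptrunc p m - ptrunc p n = a - b by rewrite /a /b opprB addrA subrK.
have La : pl2 a by exact: (carB H). have Lb : pl2 b by exact: (carB H).
have Lab := carB H La Lb.
have ha : dot a a <= e' by exact: hN. have hb : dot b b <= e' by exact: hN.
have : dot (a - b) (a - b) <= 2 * dot a a + 2 * dot b b.
  have := dot_ge0 H (carD H La Lb); rewrite -[a - b]/(a + - b) -(scaleN1r b).
  rewrite (dot_sqrD H La (carZ H (-1) Lb)) (dot_sqrD H La Lb) (dotZZ H _ Lb) (dotZr H _ Lb La).
  by rewrite sqrrN expr1n mul1r; move: (dot a a) (dot a b) (dot b b) => x y z h; clear -h; lra.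
have pn : pi != 0 :> R by exact: lt0r_neq0.
have -> : e = 2 * pi * (4 * e').
  rewrite (_ : 2 * pi * (4 * e') = e' * (8 * pi)); last by ring.
  by rewrite /e' divfK// mulf_neq0.
rewrite ler_pM2l ?pi2_gt0// => h; apply: le_trans h _; clear -ha hb; lra.
Qed.

Lemma isFT_norm p P : pl2 p -> isFT p P -> dot P P = 2 * pi * dot p p.
Proof.
move=> lp [lP hP].
have h1 := ncvg_dot (fun n => l2_FT (pintg_trunc n lp) (pl2_trunc n lp)) lP hP.
have h2 := ncvg_dot (fun n => pl2_trunc n lp) lp (ptrunc_cvg lp).
have h3 : 2 * pi * dot (ptrunc p n) (ptrunc p n) @[n --> \oo] --> 2 * pi * dot p p.
  by apply: cvgM => //; exact: cvg_cst.
apply: (cvg_unique _ h1) => //.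
rewrite (_ : (fun n => _) = (fun n => 2 * pi * dot (ptrunc p n) (ptrunc p n)))//.
by apply/funext => n; rewrite plancherel_pair//; [exact: pintg_trunc|exact: pl2_trunc].
Qed.

(** The transforms of the truncations of p tend to FT p by Plancherel's identity. *)
Lemma isFT_L1 p : pintg p -> pl2 p -> isFT p (FT p).
Proof.
move=> ip lp; split; first exact: l2_FT.
have := null_seqZ (2 * pi) (ptrunc_cvg lp); apply: null_seq_le => n.
  apply: (dot_ge0 H); apply: (carB H); apply: l2_FT => //; by [exact: pintg_trunc|exact: pl2_trunc].
have [t1 t2] := pintg_trunc n lp.
rewrite -(FTB (pintg_trunc n lp) ip) plancherel_pair//; last by apply: (carB H) => //; exact: pl2_trunc.
by case: ip => i1 i2; split; exact: intgB.
Qed.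

Lemma FcL f g a xi : intg f -> intg g -> Fc (fun x => f x + a * g x) xi = Fc f xi + a * Fc g xi.
Proof.
move=> If Ig; rewrite /Fc -(RintZ a (intg_cos xi Ig)) -(RintD (intg_cos xi If) (intgZ a (intg_cos xi Ig))).
by apply: eq_Rintegral => x _; ring.
Qed.

Lemma FsL f g a xi : intg f -> intg g -> Fs (fun x => f x + a * g x) xi = Fs f xi + a * Fs g xi.
Proof.
move=> If Ig; rewrite /Fs -(RintZ a (intg_sin xi Ig)) -(RintD (intg_sin xi If) (intgZ a (intg_sin xi Ig))).
by apply: eq_Rintegral => x _; ring.
Qed.

Lemma FT_lin p q a : pintg p -> pintg q -> FT (p + a *: q) = FT p + a *: FT q.
Proof.
move=> [p1 p2] [q1 q2]; congr (_, _); apply/funext => xi.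
- rewrite -[RHS]/((Fc p.1 xi + Fs p.2 xi) + a * (Fc q.1 xi + Fs q.2 xi)).
  by rewrite [Fc _ xi](FcL a xi p1 q1) [Fs _ xi](FsL a xi p2 q2); ring.
- rewrite -[RHS]/((Fc p.2 xi - Fs p.1 xi) + a * (Fc q.2 xi - Fs q.1 xi)).
  by rewrite [Fc _ xi](FcL a xi p2 q2) [Fs _ xi](FsL a xi p1 q1); ring.
Qed.

Lemma isFT_lin p q P Q a : pl2 p -> pl2 q -> isFT p P -> isFT q Q ->
  isFT (p + a *: q) (P + a *: Q).
Proof.
move=> lp lq [lP hP] [lQ hQ]; split; first by apply: (carD H) => //; exact: (carZ H).
apply: (@ncvg_ext _ (fun n => FT (ptrunc p n) + a *: FT (ptrunc q n))).
  move=> n; rewrite -FT_lin; [|exact: pintg_trunc..]; congr FT; congr (_, _); apply/funext => x.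
  - by rewrite -[LHS]/(_ * _ + a * (_ * _)) -[RHS]/(_ * (p.1 x + a * q.1 x))/=; ring.
  - by rewrite -[LHS]/(_ * _ + a * (_ * _)) -[RHS]/(_ * (p.2 x + a * q.2 x))/=; ring.
by apply: ncvg_lin => // n; apply: l2_FT; by [exact: pintg_trunc|exact: pl2_trunc].
Qed.

(** By polarization of isFT_norm. *)
Lemma parseval p q P Q : pl2 p -> pl2 q -> isFT p P -> isFT q Q ->
  dot P Q = 2 * pi * dot p q.
Proof.
move=> lp lq hp hq; have [lP _] := hp; have [lQ _] := hq.
have := isFT_norm (carD H lp (carZ H 1 lq)) (isFT_lin 1 lp lq hp hq).
rewrite !scale1r (dot_sqrD H lP lQ) (dot_sqrD H lp lq) (isFT_norm lp hp) (isFT_norm lq hq).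
move: (dot P Q) (dot p q) (dot p p) (dot q q) => a b c d h; clear -h; lra.
Qed.

End PlancherelL2.

(** * The L^2 transform of complex-valued functions *)

Import ComplexField.Normc.
Local Open Scope complex_scope.

Section ComplexLink.
Context {R : realType}.
Local Notation mu := (@lebesgue_measure R).
Local Notation H := (@dot_semi_inner R).

Definition c2p (h : R -> R[i]) : @pfun R :=
  ((fun x => complex.Re (h x)), (fun x => complex.Im (h x))).

Lemma c2pB h k : c2p (fun x => h x - k x) = c2p h - c2p k.
Proof.
by congr (_, _); apply/funext => x; rewrite -[RHS]/(_ - _)/=; case: (h x) => a b; case: (k x).
Qed.

Lemma normcE (z : R[i]) : normc z = Num.sqrt (complex.Re z ^+ 2 + complex.Im z ^+ 2).
Proof. by case: z. Qed.

Lemma sqr_normcE (z : R[i]) : normc z ^+ 2 = complex.Re z ^+ 2 + complex.Im z ^+ 2.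
Proof. by rewrite normcE sqr_sqrtr// addr_ge0 ?sqr_ge0. Qed.

Lemma L2norm_integral (h : R -> R[i]) :
  L2norm h = ((\int[mu]_x (complex.Re (h x) ^+ 2 + complex.Im (h x) ^+ 2)%:E) `^ 2^-1)%E.
Proof.
rewrite /L2norm unlock /Lnorm; congr (_ `^ _)%E.
apply: eq_integral => x _ /=.
rewrite ger0_norm; last by rewrite normcE sqrtr_ge0.
by rewrite powR_mulrn ?sqr_normcE// normcE sqrtr_ge0.
Qed.

Lemma intg_sqr_sum (f g : R -> R) : l2 f -> l2 g -> intg (fun x => f x ^+ 2 + g x ^+ 2).
Proof. by move=> [_ If] [_ Ig]; exact: intgD. Qed.

Lemma L2normE h : pl2 (c2p h) -> L2norm h = (nm dot (c2p h))%:E.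
Proof.
move=> [l1 l2']; rewrite L2norm_integral intg_fin; last exact: intg_sqr_sum l1 l2'.
rewrite (RintD l1.2 l2'.2) poweR_EFin; congr EFin.
by rewrite /nm dot_nsq powR12_sqrt// addr_ge0// nsq_ge0.
Qed.

Lemma inL2P h : inL2 h <-> pl2 (c2p h).
Proof.
split=> [[m1 m2 hoo]|[l1 l2']]; last first.
  split; [by case: l1|by case: l2'|].
  by rewrite L2normE// ltry.
have fin : (\int[mu]_x (complex.Re (h x) ^+ 2 + complex.Im (h x) ^+ 2)%:E < +oo)%E.
  move: hoo; rewrite L2norm_integral => hoo; apply: (@lty_poweRy _ _ 2^-1) => //.
have I : intg (fun x => complex.Re (h x) ^+ 2 + complex.Im (h x) ^+ 2).
  apply: ge0_intg => //; first by apply: measurable_funD; exact: measurable_funX.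
  by move=> x; rewrite addr_ge0 ?sqr_ge0.
split; split => //.
- apply: intg_le I; first exact: measurable_funX.
  by move=> x; rewrite ger0_norm ?sqr_ge0// lerDl sqr_ge0.
- apply: intg_le I; first exact: measurable_funX.
  by move=> x; rewrite ger0_norm ?sqr_ge0// lerDr sqr_ge0.
Qed.

Lemma L2_limP (F : nat -> R -> R[i]) h : (forall n, pl2 (c2p (F n))) ->
  L2_lim F h <-> pl2 (c2p h) /\ ncvg (fun n => c2p (F n)) (c2p h).
Proof.
move=> lF; rewrite /L2_lim.
have E : pl2 (c2p h) -> (fun n => L2norm (fun x => F n x - h x)) =
    (fun n => (nm dot (c2p (F n) - c2p h))%:E).
  move=> lh; apply/funext => n; rewrite L2normE c2pB//; exact: (carB H).
split=> [[/inL2P lh]|[lh hn]].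
- rewrite E// => /fine_cvgP[_ hc]; split=> //.
  have := null_seq_sqr hc; apply: null_seq_le => n; first by apply: (dot_ge0 H); exact: (carB H).
  by rewrite /= (sqr_nm H)//; exact: (carB H).
- split; first exact/inL2P; rewrite E//; apply: cvg_EFin; first exact: nearW.
  exact: null_seq_sqrt.
Qed.

Lemma Rint_box (f : R -> R) n :
  \int[mu]_(x in `[- n%:R, n%:R]) f x = \int[mu]_x (\1_(box n) x * f x).
Proof. exact: Rint_restrict (measurable_box n). Qed.

Lemma c2p_trunc_FT w n : pl2 (c2p w) ->
  c2p (fun xi => cintegral `[- n%:R, n%:R] (fun x => expi (- (xi * x)) * w x)) =
  FT (ptrunc (c2p w) n).
Proof.
move=> lw; have [i1 i2] := pintg_trunc n lw.
congr (_, _); apply/funext => xi; rewrite /= Rint_box.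
- rewrite -(RintD (intg_cos xi i1) (intg_sin xi i2)); apply: eq_Rintegral => x _ /=.
  by rewrite /expi cosN sinN; case: (w x) => a b /=; ring.
- rewrite -(RintB (intg_cos xi i2) (intg_sin xi i1)); apply: eq_Rintegral => x _ /=.
  by rewrite /expi cosN sinN; case: (w x) => a b /=; ring.
Qed.

(** The choice in the definition of fourierL2 is made from a nonempty set by isFT_exists. *)
Lemma fourierL2_isFT w : pl2 (c2p w) -> isFT (c2p w) (c2p (fourierL2 w)).
Proof.
move=> lw.
set S := [set W | L2_lim (fun n xi =>
    cintegral `[- n%:R, n%:R] (fun x => expi (- (xi * x)) * w x)) W].
have lF n : pl2 (c2p (fun xi => cintegral `[- n%:R, n%:R] (fun x => expi (- (xi * x)) * w x))).
  by rewrite c2p_trunc_FT//; apply: l2_FT; [exact: pintg_trunc|exact: pl2_trunc].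
have SP W : S W <-> isFT (c2p w) (c2p W).
  rewrite /S/= (L2_limP _ lF) /isFT.
  suff -> : (fun n => c2p (fun xi => cintegral `[- n%:R, n%:R] (fun x => expi (- (xi * x)) * w x))) =
    (fun n => FT (ptrunc (c2p w) n)) by [].
  by apply/funext => n; rewrite c2p_trunc_FT.
apply/SP; apply: xgetPex.
have [P hP] := isFT_exists lw.
exists (fun x => P.1 x +i* P.2 x); apply/SP.
by case: P hP => P1 P2 hP; exact: hP.
Qed.

(** Conjugation exchanges the kernels exp (i xi x) and exp (- i xi x), and so reduces the inverse
transform to the direct one. *)
Definition conjp (p : @pfun R) : @pfun R := (p.1, (fun x => - p.2 x)).

Lemma pl2_conjp p : pl2 p -> pl2 (conjp p).
Proof. by move=> [l1 l2']; split=> //; exact: l2N. Qed.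

Lemma dot_conjp p : dot (conjp p) (conjp p) = dot p p.
Proof.
rewrite !dot_nsq; congr (_ + _); apply: eq_Rintegral => x _ /=.
by rewrite sqrrN.
Qed.

Lemma conjpB p q : conjp (p - q) = conjp p - conjp q.
Proof.
congr (_, _); apply/funext => x; rewrite -[LHS]/(- (p.2 x - q.2 x)).
by rewrite -[RHS]/(- p.2 x - - q.2 x); ring.
Qed.

Lemma c2p_itrunc W n : pl2 (c2p W) ->
  c2p (fun x => ((2 * pi)^-1)%:C * cintegral `[- n%:R, n%:R] (fun xi => expi (xi * x) * W xi)) =
  (2 * pi)^-1 *: conjp (FT (ptrunc (conjp (c2p W)) n)).
Proof.
move=> lw; have [i1 i2] := pintg_trunc n (pl2_conjp lw).
congr (_, _); apply/funext => x; rewrite -[RHS]/(_ * _)/= !Rint_box mul0r ?subr0 ?addr0.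
- congr (_ * _); rewrite -(RintD (intg_cos x i1) (intg_sin x i2)); apply: eq_Rintegral => xi _ /=.
  by rewrite /expi [xi * x]mulrC; case: (W xi) => a b /=; ring.
- congr (_ * _); rewrite opprB -(RintB (intg_sin x i1) (intg_cos x i2)); apply: eq_Rintegral => xi _ /=.
  by rewrite /expi [xi * x]mulrC; case: (W xi) => a b /=; ring.
Qed.

(** Up to the factor (2 pi)^-1 and to conjugations, the inverse transform is the transform,
which multiplies squared norms by 2 pi. *)
Lemma ifourierL2_norm W : pl2 (c2p W) ->
  L2norm (ifourierL2 W) = (Num.sqrt ((2 * pi)^-1 * dot (c2p W) (c2p W)))%:E.
Proof.
move=> lW.
set F := fun n x => ((2 * pi)^-1)%:C *
    cintegral `[- n%:R, n%:R] (fun xi => expi (xi * x) * W xi).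
have lc := pl2_conjp lW.
have FE n : c2p (F n) = (2 * pi)^-1 *: conjp (FT (ptrunc (conjp (c2p W)) n)).
  exact: c2p_itrunc.
have lFT n : pl2 (FT (ptrunc (conjp (c2p W)) n)).
  by apply: l2_FT; [exact: pintg_trunc|exact: pl2_trunc].
have lF n : pl2 (c2p (F n)) by rewrite FE; apply: (carZ H); exact: pl2_conjp.
have [P hP] := isFT_exists lc; have [lP cP] := hP.
have lQ : pl2 ((2 * pi)^-1 *: conjp P) by apply: (carZ H); exact: pl2_conjp.
have cQ : ncvg (fun n => c2p (F n)) ((2 * pi)^-1 *: conjp P).
  have := null_seqZ ((2 * pi)^-1 ^+ 2) cP; apply: null_seq_le => n.
    by apply: (dot_ge0 H); exact: (carB H).
  rewrite FE -scalerBr -conjpB (dotZZ H); last by apply: pl2_conjp; exact: (carB H).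
  by rewrite dot_conjp.
have SP h : L2_lim F h <-> pl2 (c2p h) /\ ncvg (fun n => c2p (F n)) (c2p h) by exact: L2_limP.
have : L2_lim F (ifourierL2 W).
  apply: (@xgetPex _ (fun=> 0) [set w | L2_lim F w]).
  exists (fun x => ((2 * pi)^-1 * P.1 x) +i* ((2 * pi)^-1 * - P.2 x)); apply/SP.
  exact: (conj lQ cQ).
move=> /SP[lw cw]; rewrite L2normE//; congr (Num.sqrt _)%:E.
have [e1 e2] := ncvg_unique lF lw lQ cw cQ.
rewrite (dot_ae lw lw lQ lQ (conj e1 e2) (conj e1 e2)).
rewrite (dotZZ H) ?dot_conjp; last exact: pl2_conjp.
rewrite (isFT_norm lc hP) dot_conjp.
have pn := lt0r_neq0 (@pi2_gt0 R).
by rewrite expr2 -mulrA mulKf.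
Qed.

End ComplexLink.

(** * Sobolev norms and the uniform bound *)

Section Sobolev.
Context {R : realType}.
Local Notation mu := (@lebesgue_measure R).
Local Notation H := (@dot_semi_inner R).
Implicit Types (f g w : R -> R).

Definition hat w : @pfun R := c2p (fourierL2 (cfun w)).

Lemma hat_isFT w : l2 w -> isFT (rfun w) (hat w).
Proof. by move=> lw; apply: fourierL2_isFT; exact: pl2_rfun. Qed.

Lemma pl2_hat w : l2 w -> pl2 (hat w).
Proof. by move=> lw; have [] := hat_isFT lw. Qed.

Lemma hat_parseval f g : l2 f -> l2 g -> dot (hat f) (hat g) = 2 * pi * \int[mu]_x (f x * g x).
Proof.
move=> lf lg; rewrite -dot_rfun.
by apply: parseval; [exact: pl2_rfun..|exact: hat_isFT|exact: hat_isFT].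
Qed.

Lemma rfun_lin f g (a : R) : rfun f + a *: rfun g = rfun (fun x => f x + a * g x).
Proof. by congr (_, _); apply/funext => x; rewrite -[LHS]/(0 + a * 0) mulr0 addr0. Qed.

Lemma isFT_hat_comb u v w (a : R) : l2 u -> l2 v -> l2 w ->
  isFT (rfun (fun x => u x - v x - a * w x)) (hat u - hat v - a *: hat w).
Proof.
move=> lu lv lw.
have := isFT_lin (-1) (pl2_rfun lu) (pl2_rfun lv) (hat_isFT lu) (hat_isFT lv).
rewrite rfun_lin scaleN1r => h1.
have l1 : l2 (fun x => u x + -1 * v x) by apply: l2D => //; exact: l2Z.
have := isFT_lin (- a) (pl2_rfun l1) (pl2_rfun lw) h1 (hat_isFT lw).
rewrite rfun_lin scaleNr => h2.
by rewrite (_ : (fun x => u x - v x - a * w x) = (fun x => u x + -1 * v x + - a * w x))//;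
  apply/funext => x; ring.
Qed.

Lemma hat_comb u v w (a : R) : l2 u -> l2 v -> l2 w ->
  dot (hat u - hat v - a *: hat w) (hat u - hat v - a *: hat w) =
  2 * pi * nsq (fun x => u x - v x - a * w x).
Proof.
move=> lu lv lw.
have lc : l2 (fun x => u x - v x - a * w x) by apply: l2B; [exact: l2B|exact: l2Z].
rewrite (isFT_norm (pl2_rfun lc) (isFT_hat_comb a lu lv lw)) dot_rfun; congr (_ * _).
Qed.

(** That is, (1 + |x|)^2 <= 2 (1 + x^2): the weights are compared with powers of 1 + |x|, which have
an elementary antiderivative on the right half line. *)
Let lnweight_le (x : R) : 2 * ln (1 + `|x|) - ln 2 <= ln (1 + x ^+ 2).
Proof.
have x0 : 0 < 1 + `|x| by rewrite ltr_pwDl.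
have x2 : 0 < 1 + x ^+ 2 by rewrite ltr_pwDl ?sqr_ge0.
rewrite lerBlDr -lnM ?posrE// mulr_natl -lnXn// ler_ln ?posrE ?mulr_gt0 ?exprn_gt0//.
rewrite -(real_normK (num_real x)); set a := `|x|.
by have := sqr_ge0 (1 - a); nra.
Qed.

Let is_derive_wprim (s x : R) : 2^-1 < s -> 0 <= x ->
  is_derive x 1 (fun y => (1 - 2 * s)^-1 * expR ((1 - 2 * s) * ln (1 + 1 * y)))
    (expR (- (2 * s) * ln (1 + x))).
Proof.
move=> hs x0; have x1 : 0 < 1 + x by rewrite ltr_pwDl.
have s1 : 1 - 2 * s != 0 by apply/negP => /eqP; lra.
have dl : is_derive x 1 (fun y => ln (1 + 1 * y)) ((1 + x)^-1 * (0 + 1)).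
  apply: is_derive_compf; first by rewrite mul1r; exact: is_derive1_ln.
  by apply: is_deriveDf; exact: is_derive_lin.
have de : is_derive x 1 (fun y => expR ((1 - 2 * s) * ln (1 + 1 * y)))
    (expR ((1 - 2 * s) * ln (1 + 1 * x)) * ((1 - 2 * s) * ((1 + x)^-1 * (0 + 1)))).
  by apply: is_derive_compf; exact: is_deriveZf.
apply: (is_derive_eq (is_deriveZf (1 - 2 * s)^-1 de)).
rewrite mul1r mulrBl mul1r expRD lnK ?posrE// mulNr add0r mulr1.
by field; rewrite s1 lt0r_neq0.
Qed.

Let integral_half (s : R) : 2^-1 < s ->
  (\int[mu]_(x in [set x | (0 <= x)%R]) (expR (- (2 * s) * ln (1 + `|x|)))%:E = ((2 * s - 1)^-1)%:E)%E.
Proof.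
move=> hs.
have s1 : 0 < 2 * s - 1 by lra.
have -> : [set x : R | 0 <= x] = `[0, +oo[%classic.
  by apply/seteqP; split=> x /=; rewrite in_itv/= andbT.
transitivity (\int[mu]_(x in `[0%R, +oo[) (expR (- (2 * s) * ln (1 + x)))%:E)%E.
  apply: eq_integral => x; rewrite inE/= in_itv/= andbT => x0.
  by rewrite ger0_norm.
rewrite (@ge0_continuous_FTC2y R _
  (fun y => (1 - 2 * s)^-1 * expR ((1 - 2 * s) * ln (1 + 1 * y))) 0 0).
- rewrite -EFinB; congr EFin; rewrite mulr0 addr0 ln1 mulr0 expR0 mulr1 sub0r -invrN; congr (_^-1); ring.
- by move=> x _; exact: expR_ge0.
- apply/subspace_continuousP => x /=; rewrite in_itv/= andbT => x0.
  apply: cvg_within_filter.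
  have x1 : 0 < 1 + x by rewrite ltr_pwDl.
  apply: (@is_derive_cont _ (fun x => expR (- (2 * s) * ln (1 + x))) x
    (expR (- (2 * s) * ln (1 + x)) * (- (2 * s) * ((1 + x)^-1 * (0 + 1))))).
  have d1 := @is_deriveDf R (fun=> 1) (fun y => y) x 0 1 (is_derivecf 1 x) (is_derive_id _ _).
  have d2 := @is_derive_compf R (@ln R) _ x _ _ (is_derive1_ln x1) d1.
  exact: (@is_derive_compf R expR _ x _ _ (is_derive_expR _) (is_deriveZf _ d2)).
- rewrite -[X in _ --> X](mulr0 (1 - 2 * s)^-1); apply: cvgM; first exact: cvg_cst.
  have lim : (2 * s - 1) * ln (1 + 1 * x) @[x --> +oo] --> +oo.
    apply/cvgryPge => A; near=> x.
    have x0 : expR (A / (2 * s - 1)) <= x by near: x; apply: nbhs_pinfty_ge; exact: num_real.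
    rewrite -ler_pdivrMl// mulrC -[leLHS]expRK ler_ln ?posrE ?expR_gt0//; last first.
      by rewrite mul1r; apply: ltr_pwDl => //; exact: le_trans (expR_ge0 _) x0.
    by rewrite mul1r (le_trans x0)// lerDr.
  have := cvg_comp _ _ lim (@cvgr_expR R).
  apply: cvg_trans; apply: near_eq_cvg; apply: nearW => x /=; congr expR; ring.
- by move=> x x0; case: (is_derive_wprim hs (ltW x0)).
- by apply: cvg_at_right_filter; exact: (is_derive_cont (is_derive_wprim hs (lexx 0))).
- move=> x; rewrite in_itv/= andbT => x0; rewrite derive1E.
  by have [_ ->] := is_derive_wprim hs (ltW x0).
Unshelve. all: by end_near. Qed.

Let continuous_lnw (s : R) : continuous (fun x : R => expR (- (2 * s) * ln (1 + `|x|))).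
Proof.
move=> x; have x1 : 0 < 1 + `|x| by rewrite ltr_pwDl.
apply: (@continuous_comp _ _ _ (fun x : R => 1 + `|x|) (fun y => expR (- (2 * s) * ln y))).
  by apply: cvgD; [exact: cvg_cst|exact: norm_continuous].
apply: (@is_derive_cont _ (fun y => expR (- (2 * s) * ln y)) _
    (expR (- (2 * s) * ln (1 + `|x|)) * (- (2 * s) * (1 + `|x|)^-1))).
by apply: is_derive_compf; apply: is_deriveZf; exact: is_derive1_ln.
Qed.

Lemma weightE (s x : R) : (1 + x ^+ 2) `^ s = expR (s * ln (1 + x ^+ 2)).
Proof. by rewrite /powR gt_eqF// ltr_pwDl ?sqr_ge0. Qed.

Lemma continuous_weight (s : R) : continuous (fun x : R => (1 + x ^+ 2) `^ s).
Proof.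
move=> x; have x2 : 0 < 1 + x ^+ 2 by rewrite ltr_pwDl ?sqr_ge0.
rewrite (_ : (fun x : R => (1 + x ^+ 2) `^ s) = (fun x => expR (s * ln (1 + x ^+ 2)))); last first.
  by apply/funext => y; exact: weightE.
apply: (@continuous_comp _ _ _ (fun x : R => 1 + x ^+ 2) (fun y => expR (s * ln y))).
  by apply: cvgD; [exact: cvg_cst|exact: exprn_continuous].
apply: (@is_derive_cont _ (fun y => expR (s * ln y)) _
    (expR (s * ln (1 + x ^+ 2)) * (s * (1 + x ^+ 2)^-1))).
by apply: is_derive_compf; apply: is_deriveZf; exact: is_derive1_ln.
Qed.

Lemma measurable_weight (s : R) : measurable_fun setT (fun x : R => (1 + x ^+ 2) `^ s).
Proof. by apply: continuous_measurable_fun; exact: continuous_weight. Qed.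

Lemma intg_weight (s : R) : 2^-1 < s -> intg (fun x : R => (1 + x ^+ 2) `^ (- s)).
Proof.
move=> hs.
have I : intg (fun x : R => expR (- (2 * s) * ln (1 + `|x|))).
  apply: ge0_intg.
  - by apply: continuous_measurable_fun; exact: continuous_lnw.
  - by move=> x; exact: expR_ge0.
  - rewrite ge0_symfun_integralT; last 1 first.
    + by move=> x /=; rewrite normrN.
    + by rewrite integral_half// -EFinM ltry.
    + by move=> x; exact: expR_ge0.
    + exact: continuous_lnw.
apply: intg_le (intgZ (expR (s * ln 2)) I); first exact: measurable_weight.
move=> x; rewrite ger0_norm ?powR_ge0// weightE -expRD ler_expR.
have := lnweight_le x; have s0 : 0 < s by lra.
by move: (ln (1 + `|x|)) (ln 2) (ln (1 + x ^+ 2)) => a b c h; nra.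
Qed.

Lemma Hs_normE (s : R) w : l2 w -> (Hs_norm s w < +oo)%E ->
  intg (fun xi => (1 + xi ^+ 2) `^ s * ((hat w).1 xi ^+ 2 + (hat w).2 xi ^+ 2)) /\
  fine (Hs_norm s w) ^+ 2 = \int[mu]_xi ((1 + xi ^+ 2) `^ s * ((hat w).1 xi ^+ 2 + (hat w).2 xi ^+ 2)).
Proof.
move=> lw.
have -> : Hs_norm s w = ((\int[mu]_xi ((1 + xi ^+ 2) `^ s *
    ((hat w).1 xi ^+ 2 + (hat w).2 xi ^+ 2))%:E) `^ 2^-1)%E.
  congr (_ `^ _)%E; apply: eq_integral => x _; congr (EFin (_ * _)). rewrite (sqr_normcE (fourierL2 (cfun w) x)).
by rewrite /hat /c2p /=.
have [[m1 _] [m2 _]] := pl2_hat lw.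
have I0 x : 0 <= (1 + x ^+ 2) `^ s * ((hat w).1 x ^+ 2 + (hat w).2 x ^+ 2).
  by rewrite mulr_ge0 ?powR_ge0 ?addr_ge0 ?sqr_ge0.
move=> /lty_poweRy h; have {}h := h (_ : 2^-1 != 0).
have I : intg (fun xi => (1 + xi ^+ 2) `^ s * ((hat w).1 xi ^+ 2 + (hat w).2 xi ^+ 2)).
  apply: ge0_intg => //; last exact: h.
  apply: measurable_funM; first exact: measurable_weight.
  by apply: measurable_funD; exact: measurable_funX.
split=> //.
rewrite [X in fine (X `^ _)%E](intg_fin I) poweR_EFin/= powR12_sqrt; last exact: Rint_ge0.
by rewrite sqr_sqrtr//; exact: Rint_ge0.
Qed.

(** For s >= 0 the weight is at least 1. *)
Lemma Hs_L2_le (s : R) w : 0 <= s -> l2 w -> (Hs_norm s w < +oo)%E ->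
  2 * pi * nsq w <= fine (Hs_norm s w) ^+ 2.
Proof.
move=> s0 lw hw; have [I ->] := Hs_normE lw hw.
have lh := pl2_hat lw.
rewrite -[nsq w]/(\int[mu]_x (w x * w x)) -hat_parseval// dot_nsq -(RintD lh.1.2 lh.2.2); apply: Rint_le => //.
  exact: intgD lh.1.2 lh.2.2.
move=> x; rewrite -[leLHS]mul1r ler_wpM2r ?addr_ge0 ?sqr_ge0//.
rewrite weightE -[leLHS]expR0 ler_expR; apply: mulr_ge0 => //; apply: ln_ge0.
by rewrite lerDl sqr_ge0.
Qed.

(** The factor 1 / pi is (2 pi)^-1 from Parseval's identity, times 2 for the real and the imaginary
part of the transform. *)
Definition sobolev_cst (s : R) : R :=
  Num.sqrt (\int[mu]_x ((1 + x ^+ 2) `^ (- s))) / pi.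

(** Cauchy-Schwarz with the weight (1 + xi^2)^s, whose inverse is integrable. *)
Let comp_bound (s : R) (f : R -> R) (N : R) : 2^-1 < s -> 0 <= N -> measurable_fun setT f ->
  intg (fun xi => (1 + xi ^+ 2) `^ s * f xi ^+ 2) ->
  \int[mu]_xi ((1 + xi ^+ 2) `^ s * f xi ^+ 2) <= N ^+ 2 ->
  intg f /\ \int[mu]_xi `|f xi| <= Num.sqrt (\int[mu]_x ((1 + x ^+ 2) `^ (- s))) * N.
Proof.
move=> hs N0 mf If IN.
have Iw := intg_weight hs.
pose a (x : R) := (1 + x ^+ 2) `^ (- s / 2); pose b (x : R) := (1 + x ^+ 2) `^ (s / 2) * `|f x|.
have aE x : a x ^+ 2 = (1 + x ^+ 2) `^ (- s).
  by rewrite /a !weightE expr2 -expRD; congr expR; field.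
have bE x : b x ^+ 2 = (1 + x ^+ 2) `^ s * f x ^+ 2.
  rewrite /b exprMn real_normK ?num_real//; congr (_ * _).
  by rewrite !weightE expr2 -expRD; congr expR; field.
have ab x : `|f x| = a x * b x.
  rewrite /a /b mulrA !weightE -expRD (_ : _ + _ = 0) ?expR0 ?mul1r//.
  by rewrite mulNr; ring.
have la : l2 a.
  split; first exact: measurable_weight.
  by rewrite (_ : (fun x => _) = (fun x => (1 + x ^+ 2) `^ (- s)))//; apply/funext => x; exact: aE.
have lb : l2 b.
  split; first by apply: measurable_funM; [exact: measurable_weight|exact: measurableT_comp].
  by rewrite (_ : (fun x => _) = (fun x => (1 + x ^+ 2) `^ s * f x ^+ 2))//; apply/funext => x; exact: bE.
have Iab := l2M la lb.
split.
  by apply: intg_le Iab => // x; rewrite ab.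
have -> : \int[mu]_xi `|f xi| = \int[mu]_x (a x * b x) by apply: eq_Rintegral => x _; exact: ab.
rewrite -dot_rfun; apply: le_trans (ler_norm _) _.
apply: le_trans (cauchy_schwarz H (pl2_rfun la) (pl2_rfun lb)) _.
rewrite /nm !dot_rfun; apply: ler_pM; rewrite ?sqrtr_ge0//.
  rewrite le_eqVlt; apply/orP; left; apply/eqP; congr Num.sqrt.
  by apply: eq_Rintegral => x _; rewrite -expr2 aE.
rewrite -[leRHS]ger0_norm// -sqrtr_sqr ler_wsqrtr//.
apply: le_trans IN; rewrite le_eqVlt; apply/orP; left; apply/eqP.
by apply: eq_Rintegral => x _; rewrite -expr2 bE.
Qed.

(** By Parseval's identity the left-hand side is a pairing of transforms. The transform of w is
integrable by comp_bound, and that of phi is bounded by the L^1 norm of phi. The estimate is put in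
this dual form because it yields the uniform bound without Fourier inversion. *)
Lemma sobolev_dual (s : R) w phi : 2^-1 < s -> l2 w -> (Hs_norm s w < +oo)%E ->
  intg phi -> l2 phi ->
  `|\int[mu]_x (w x * phi x)| <= sobolev_cst s * fine (Hs_norm s w) * \int[mu]_x `|phi x|.
Proof.
move=> hs lw hw Ip lp; have [I IN] := Hs_normE lw hw.
have N0 : 0 <= fine (Hs_norm s w) by rewrite fine_ge0// poweR_ge0.
set N := fine _ in IN N0 *; have [[m1 _] [m2 _]] := pl2_hat lw.
have w0 x : 0 <= (1 + x ^+ 2) `^ s by exact: powR_ge0.
have comp (f : R -> R) : measurable_fun setT f ->
   (forall x, f x ^+ 2 <= (hat w).1 x ^+ 2 + (hat w).2 x ^+ 2) ->
   intg f /\ \int[mu]_xi `|f xi| <= Num.sqrt (\int[mu]_x ((1 + x ^+ 2) `^ (- s))) * N.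
  move=> mf fle.
  have If : intg (fun xi => (1 + xi ^+ 2) `^ s * f xi ^+ 2).
    apply: intg_le I; first by apply: measurable_funM; [exact: measurable_weight|exact: measurable_funX].
    by move=> x; rewrite ger0_norm ?ler_wpM2l//; exact: mulr_ge0 (w0 x) (sqr_ge0 _).
  by apply: comp_bound => //; rewrite IN; apply: Rint_le => // x; rewrite ler_wpM2l.
have [I1 B1] := comp _ m1 (fun x => ler_wpDr (sqr_ge0 _) (lexx _)).
have [I2 B2] := comp _ m2 (fun x => ler_wpDl (sqr_ge0 _) (lexx _)).
have ip : pintg (rfun phi) by split=> //; exact: integrable0.
have P := parseval (pl2_rfun lw) (pl2_rfun lp) (hat_isFT lw) (isFT_L1 ip (pl2_rfun lp)).
rewrite dot_rfun in P.
set A := \int[mu]_x `|phi x|.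
have A0 : 0 <= A by exact: Rint_ge0.
have FT1 x : `|(FT (rfun phi)).1 x| <= A.
  rewrite /FT/= (_ : Fs _ x = 0) ?addr0; first exact: Fc_bound.
  by rewrite /Fs; under eq_Rintegral do rewrite mul0r; rewrite /Rintegral integral0.
have FT2 x : `|(FT (rfun phi)).2 x| <= A.
  rewrite /FT/= (_ : Fc _ x = 0) ?sub0r ?normrN; first exact: Fs_bound.
  by rewrite /Fc; under eq_Rintegral do rewrite mul0r; rewrite /Rintegral integral0.
have lF := l2_FT ip (pl2_rfun lp).
have D : `|dot (hat w) (FT (rfun phi))| <= A * (2 * (Num.sqrt (\int[mu]_x ((1 + x ^+ 2) `^ (- s))) * N)).
  rewrite /dot; apply: le_trans (ler_normD _ _) _.
  move: (Num.sqrt _ * N) B1 B2 => B B1 B2.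
  rewrite (_ : A * (2 * B) = A * B + A * B); last by ring.
  apply: lerD.
  - apply: (@le_trans _ _ (A * \int[mu]_x `|(hat w).1 x|)); last by rewrite ler_wpM2l.
    rewrite -(RintZ A (intg_norm I1)); apply: Rint_norm_le.
    + by apply: l2M; [case: (pl2_hat lw)|case: lF].
    + exact/intgZ/intg_norm.
    + by move=> x; rewrite normrM mulrC ler_wpM2r.
  - apply: (@le_trans _ _ (A * \int[mu]_x `|(hat w).2 x|)); last by rewrite ler_wpM2l.
    rewrite -(RintZ A (intg_norm I2)); apply: Rint_norm_le.
    + by apply: l2M; [case: (pl2_hat lw)|case: lF].
    + exact/intgZ/intg_norm.
    + by move=> x; rewrite normrM mulrC ler_wpM2r.
have p0 := @pi2_gt0 R.
rewrite -(ler_pM2l p0) -[X in X * `|_|]gtr0_norm// -normrM -P.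
apply: le_trans D _; rewrite le_eqVlt; apply/orP; left; apply/eqP.
have p1 : (pi : R) != 0 by rewrite gt_eqF// pi_gt0.
have e : Num.sqrt (\int[mu]_x ((1 + x ^+ 2) `^ (- s))) = pi * sobolev_cst s.
  by rewrite /sobolev_cst mulrCA mulfV ?mulr1.
by rewrite e; ring.
Qed.

Lemma intg_indic (A : set R) : measurable A -> (mu A < +oo)%E -> intg (\1_A : R -> R).
Proof.
move=> mA Aoo; apply: ge0_intg; first exact: measurable_indic.
- by move=> x; rewrite indicE.
- by rewrite integral_indic// setIT.
Qed.

(** The indicator of the part of a bounded interval where w > C is a test function that violates the
hypothesis unless this part is null. *)
Let one_sided (w : R -> R) (C : R) : l2 w ->
  (forall phi, intg phi -> l2 phi -> \int[mu]_x (w x * phi x) <= C * \int[mu]_x `|phi x|) ->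
  {ae mu, forall x, w x <= C}.
Proof.
move=> lw hC.
suff h n : {ae mu, forall x, x \in box n -> w x <= C}.
  have : {ae mu, forall x, forall n, x \in box n -> w x <= C} by exact/ae_foralln.
  apply: aeS => x /(_ (Num.truncn `|x|).+1); apply.
  by rewrite inE /box/= in_itv/= -ler_norml; apply/ltW/truncnS_gt.
pose A := [set x | C < w x] `&` box n.
have mA : measurable A.
  apply: measurableI; last exact: measurable_box.
  rewrite -[X in measurable X]setTI (_ : [set x | C < w x] = w @^-1` `]C, +oo[%classic).
    by case: lw => mw _; apply: mw => //; exact: measurable_itv.
  by apply/seteqP; split=> x /=; rewrite in_itv/= andbT.
pose phi := \1_A : R -> R.
have Iphi : intg phi.
  have Ib : intg (\1_(box n) : R -> R) by apply: intg_indic; [exact: measurable_box|exact: mu_box].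
  apply: intg_le Ib; first exact: measurable_indic.
  move=> x; rewrite /phi !indicE; have [|_] := boolP (x \in A); last by rewrite normr0.
  by rewrite inE => -[_ xb]; rewrite mem_set// normr1.
have lphi : l2 phi by apply: (intg_bounded_l2 Iphi) => x; exact: indic_le1.
have p0 x : 0 <= phi x by rewrite /phi indicE.
have Iwp := l2M lw lphi.
have J := intgB Iwp (intgZ C Iphi).
have J0 x : 0 <= w x * phi x - C * phi x.
  rewrite -mulrBl /phi indicE; have [|_] := boolP (x \in A); last by rewrite mulr0.
  by rewrite inE mulr1 subr_ge0 => -[/= /ltW].
have JI : \int[mu]_x (w x * phi x - C * phi x) = 0.
  apply/eqP; rewrite eq_le Rint_ge0// andbT (RintB Iwp (intgZ C Iphi)) (RintZ C Iphi) subr_le0.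
  apply: le_trans (hC _ Iphi lphi) _; rewrite le_eqVlt; apply/orP; left; apply/eqP.
  by congr (_ * _); apply: eq_Rintegral => x _; rewrite ger0_norm.
apply: aeS (Rint_eq0 J J0 JI) => x /eqP; rewrite -mulrBl mulf_eq0 => /orP[|].
  by rewrite subr_eq0 => /eqP ->.
rewrite /phi indicE; have [|] := boolP (x \in A); first by rewrite oner_eq0.
move=> /negP h _ xb; rewrite leNgt; apply/negP => Cw; apply: h.
by rewrite inE; split=> //; move: xb; rewrite inE.
Qed.

Lemma sobolev_sup (s : R) w : 2^-1 < s -> l2 w -> (Hs_norm s w < +oo)%E ->
  {ae mu, forall x, `|w x| <= sobolev_cst s * fine (Hs_norm s w)}.
Proof.
move=> hs lw hw; set C := _ * _.
have h1 : {ae mu, forall x, w x <= C}.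
  apply: one_sided => // phi Ip lp; apply: le_trans (ler_norm _) _; exact: sobolev_dual.
have h2 : {ae mu, forall x, - w x <= C}.
  apply: one_sided; first exact: l2N.
  move=> phi Ip lp; apply: le_trans (sobolev_dual hs lw hw Ip lp).
  rewrite -normrN -mulN1r -(RintZ (-1) (l2M lw lp)); apply: le_trans (ler_norm _).
  rewrite le_eqVlt; apply/orP; left; apply/eqP; apply: eq_Rintegral => x _; ring.
by apply: aeS2 h1 h2 => x a b; rewrite ler_norml; apply/andP; split=> //; lra.
Qed.

Lemma sobolev_cst_ge0 s : 0 <= sobolev_cst s.
Proof. by rewrite divr_ge0 ?sqrtr_ge0// pi_ge0. Qed.

End Sobolev.

(** * Curves with values in H^s *)

Section Curves.
Context {R : realType}.
Local Notation mu := (@lebesgue_measure R).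
Local Notation H := (@dot_semi_inner R).
Implicit Types (u v : R -> R -> R).

Local Notation I0 := (@time_interval R +oo%E).

Lemma inHs_l2 (s : R) w : inHs s w -> l2 w.
Proof. by case=> /inL2P [lw _] _. Qed.

Lemma near_dnbhs (P : R -> Prop) (t : R) : (\forall r \near within I0 t^', P r) ->
  exists2 d : R, 0 < d & forall r, 0 <= r -> r != t -> `|r - t| < d -> P r.
Proof.
rewrite /within/= /dnbhs/= => /nbhs_ballP[d /= d0 hd]; exists d => // r r0 rt rd.
apply: hd => //; last by split=> //; exact: ltry.
by rewrite -ball_normE/= distrC.
Qed.

Lemma near_nbhs (P : R -> Prop) (t : R) : (\forall r \near within I0 (nbhs t), P r) ->
  exists2 d : R, 0 < d & forall r, 0 <= r -> `|r - t| < d -> P r.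
Proof.
rewrite /within/= => /nbhs_ballP[d /= d0 hd]; exists d => // r r0 rd.
apply: hd => //; last by split=> //; exact: ltry.
by rewrite -ball_normE/= distrC.
Qed.

Lemma near_small (T : Type) (F : set_system T) (FF : Filter F) (f : T -> \bar R) (e : R) : 0 < e ->
  (f x @[x --> F] --> 0%E) -> \forall x \near F, (f x < +oo)%E /\ fine (f x) <= e.
Proof.
move=> e0 /fine_cvgP[hf /cvgrPdist_le/(_ e e0)]; apply: filterS2 hf => x hx.
rewrite sub0r normrN /= => hle; split; last exact: le_trans (ler_norm _) hle.
by move: hx; rewrite fin_numE ltey => /andP[].
Qed.

Lemma nm_rfun_Hs (s e : R) w : 0 <= s -> l2 w -> (Hs_norm s w < +oo)%E ->
  fine (Hs_norm s w) <= e -> 2 * pi * nsq w <= e ^+ 2.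
Proof.
move=> s0 lw hw we; apply: le_trans (Hs_L2_le s0 lw hw) _.
have N0 : 0 <= fine (Hs_norm s w) by rewrite fine_ge0// poweR_ge0.
by rewrite ler_pXn2r ?nnegrE// (le_trans N0).
Qed.

(** The remainder is r - t times the error of the difference quotient; the H^s norm of this error
controls both its L^2 norm and its essential supremum. *)
Lemma Hs_taylor (s : R) u u' (t : R) : 2^-1 < s -> 0 <= t ->
  (forall r, 0 <= r -> l2 (u r)) -> l2 (u' t) -> Hs_derivative s I0 u u' ->
  forall e : R, 0 < e -> exists2 d : R, 0 < d & forall r : R, 0 <= r -> `|r - t| < d ->
    2 * pi * nsq (fun x => u r x - u t x - (r - t) * u' t x) <= (e * `|r - t|) ^+ 2 /\
    {ae mu, forall x, `|u r x - u t x - (r - t) * u' t x| <= e * `|r - t|}.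
Proof.
move=> hs t0 lu lu' hu e e0.
have s0 : 0 <= s by lra.
pose C := 1 + sobolev_cst s.
have C0 : 0 < C by rewrite ltr_pwDl ?sobolev_cst_ge0.
have It : I0 t by split=> //; exact: ltry.
pose eta := Num.min e (e / C).
have eta0 : 0 < eta by rewrite lt_min e0 divr_gt0.
have := near_small _ eta0 (hu t It).
move=> /(_ _)/near_dnbhs[d d0 hd]; exists d => // r r0 rd.
have [->|rt] := eqVneq r t.
  rewrite subrr normr0 mulr0; split.
    rewrite (_ : (fun x => _) = (fun=> 0)); last by apply/funext => x; rewrite mul0r subr0 subrr.
    by rewrite /nsq /Rintegral; under eq_integral do rewrite expr0n/=; rewrite integral0 mulr0 expr0n.
  by apply: aeW => x; rewrite mul0r subr0 subrr normr0.
have [hoo hle] := hd r r0 rt rd.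
have rt' : r - t != 0 by rewrite subr_eq0.
pose w x := (u r x - u t x) / (r - t) - u' t x.
have lw : l2 w.
  apply: l2B lu'; rewrite (_ : (fun x => _) = (fun x => (r - t)^-1 * (u r x - u t x))).
    by apply: l2Z; apply: l2B; exact: lu.
  by apply/funext => x; rewrite mulrC.
have wE x : u r x - u t x - (r - t) * u' t x = (r - t) * w x by rewrite /w; field.
split.
  rewrite (_ : nsq _ = (r - t) ^+ 2 * nsq w); last first.
    rewrite /nsq -(RintZ _ lw.2); apply: eq_Rintegral => x _.
    by rewrite wE exprMn.
  rewrite mulrCA exprMn real_normK ?num_real// mulrC ler_wpM2r ?sqr_ge0//.
  by apply: (@nm_rfun_Hs s) => //; apply: le_trans hle _; rewrite /eta ge_min lexx.
have := sobolev_sup hs lw hoo; apply: aeS => x hx.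
rewrite wE normrM mulrC ler_wpM2r//; apply: le_trans hx _.
have N0 : 0 <= fine (Hs_norm s w) by rewrite fine_ge0// poweR_ge0.
have he : fine (Hs_norm s w) <= e / C by apply: le_trans hle _; rewrite /eta ge_min lexx orbT.
rewrite ler_pdivlMr// mulrC in he.
apply: le_trans he; rewrite ler_wpM2r// /C; lra.
Qed.

Lemma pl2_comb (f g h : R -> R) (a : R) : l2 f -> l2 g -> l2 h ->
  nm dot (rfun f - rfun g - a *: rfun h) = Num.sqrt (nsq (fun x => f x - g x - a * h x)).
Proof.
move=> lf lg lh; rewrite -scaleN1r rfun_lin -scaleNr rfun_lin /nm dot_rfun.
congr Num.sqrt; apply: eq_Rintegral => x _; rewrite mulN1r mulNr; ring.
Qed.

Lemma pl2_hatB (f g : R -> R) : l2 f -> l2 g ->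
  dot (hat f - hat g) (hat f - hat g) = 2 * pi * nsq (fun x => f x - g x).
Proof.
move=> lf lg; have := hat_comb 0 lf lg lf; rewrite scale0r subr0 => ->.
by congr (_ * nsq _); apply/funext => x; rewrite mul0r subr0.
Qed.

Lemma hat_cdiff (s : R) u u' (t : R) : 2^-1 < s -> 0 <= t ->
  (forall r, 0 <= r -> l2 (u r)) -> l2 (u' t) -> Hs_derivative s I0 u u' ->
  cdiff dot (fun r => hat (u r)) (hat (u' t)) t.
Proof.
move=> hs t0 lu lu' hu e e0; have [d d0 hd] := Hs_taylor hs t0 lu lu' hu e0.
exists d => // r r0 rd; have [h _] := hd r r0 rd.
rewrite /nm hat_comb//; [|exact: lu..].
by rewrite -[leRHS]ger0_norm ?mulr_ge0// ?(ltW e0)// -sqrtr_sqr ler_wsqrtr.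
Qed.

Lemma rfun_cdiff (s : R) u u' (t : R) : 2^-1 < s -> 0 <= t ->
  (forall r, 0 <= r -> l2 (u r)) -> l2 (u' t) -> Hs_derivative s I0 u u' ->
  cdiff dot (fun r => rfun (u r)) (rfun (u' t)) t.
Proof.
move=> hs t0 lu lu' hu e e0; have [d d0 hd] := Hs_taylor hs t0 lu lu' hu e0.
exists d => // r r0 rd; have [h _] := hd r r0 rd.
rewrite pl2_comb//; [|exact: lu..].
rewrite -[leRHS]ger0_norm ?mulr_ge0// ?(ltW e0)// -sqrtr_sqr ler_wsqrtr//.
apply: le_trans h; rewrite -[leLHS]mul1r ler_wpM2r ?nsq_ge0//.
by have := @pi_ge2 R; move: (pi : R) => p; lra.
Qed.

Lemma hat_ccont (s : R) u (t : R) : 2^-1 < s -> 0 <= t ->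
  (forall r, 0 <= r -> l2 (u r)) -> Hs_continuous s I0 u ->
  ccont dot (fun r => hat (u r)) t.
Proof.
move=> hs t0 lu hu e e0.
have It : I0 t by split=> //; exact: ltry.
have s0 : 0 <= s by lra.
have := near_small _ e0 (hu t It).
move=> /(_ _)/near_nbhs[d d0 hd]; exists d => // r r0 rd.
have [hoo hle] := hd r r0 rd.
have lut := lu t t0; have lur := lu r r0.
rewrite /nm pl2_hatB// -[leRHS]ger0_norm ?(ltW e0)// -sqrtr_sqr ler_wsqrtr//.
by apply: (@nm_rfun_Hs s) => //; exact: l2B.
Qed.

Lemma Hs_unif_cont (s : R) u u' (t : R) : 2^-1 < s -> 0 <= t ->
  (forall r, 0 <= r -> inHs s (u r)) -> inHs s (u' t) -> Hs_derivative s I0 u u' ->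
  forall e : R, 0 < e -> exists2 d : R, 0 < d & forall r : R, 0 <= r -> `|r - t| < d ->
    {ae mu, forall x, `|u r x - u t x| <= e}.
Proof.
move=> hs t0 Hu Hu' hu e e0.
have lu r : 0 <= r -> l2 (u r) by move=> /Hu/inHs_l2.
have lu' := inHs_l2 Hu'.
have [d d0 hd] := Hs_taylor hs t0 lu lu' hu ltr01.
have hb := sobolev_sup hs lu' Hu'.2.
set M := _ * _ in hb.
have N0 : 0 <= fine (Hs_norm s (u' t)) by rewrite fine_ge0// poweR_ge0.
have M0 : 0 <= M by rewrite mulr_ge0 ?sobolev_cst_ge0.
have M1 : 0 < 1 + M by rewrite ltr_pwDl.
exists (Num.min d (e / (1 + M))) => [|r r0]; first by rewrite lt_min d0 divr_gt0.
rewrite lt_min => /andP[rd re]; have [_ h] := hd r r0 rd.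
apply: aeS2 h hb => x h1 h2.
have -> : u r x - u t x = (u r x - u t x - (r - t) * u' t x) + (r - t) * u' t x by ring.
apply: le_trans (ler_normD _ _) _; rewrite normrM.
have h3 : `|r - t| * `|u' t x| <= `|r - t| * M by rewrite ler_wpM2l.
move: re; rewrite ltr_pdivlMr// => re; nra.
Qed.

Lemma Hs_bounded (s : R) (w : R -> R) : 2^-1 < s -> inHs s w ->
  exists2 M : R, 0 <= M & {ae mu, forall x, `|w x| <= M}.
Proof.
move=> hs hw; exists (sobolev_cst s * fine (Hs_norm s w)); last exact: sobolev_sup (inHs_l2 hw) hw.2.
by rewrite mulr_ge0 ?sobolev_cst_ge0// fine_ge0// poweR_ge0.
Qed.

End Curves.

(** * Smooth bumps *)

Section Bump.
Context {R : realType}.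
Local Notation mu := (@lebesgue_measure R).
Implicit Types (P : {poly R}) (k : nat) (x y : R).

(** These products on (-1, 1), with P a polynomial, form a class which contains the standard bump
exp (- 1 / (1 - x^2)) and is closed under differentiation, so that smoothness of all its members
follows from one computation. *)
Definition bumpf P k x : R :=
  if `|x| < 1 then P.[x] * (1 - x ^+ 2)^-1 ^+ k * expR (- (1 - x ^+ 2)^-1) else 0.

Let den_gt0 x : `|x| < 1 -> 0 < 1 - x ^+ 2.
Proof. by move=> x1; rewrite subr_gt0 -real_normK ?num_real// expr_lt1. Qed.

Lemma powexp_le (i : R) n : 0 <= i -> i ^+ n.+1 * expR (- i) <= n.+1`!%:R.
Proof.
move=> i0; rewrite expRN ler_pdivrMr ?expR_gt0//.
have := expR_ge1Dxn n i0; have f0 : 0 < n.+1`!%:R :> R by rewrite ltr0n fact_gt0.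
move=> h; rewrite -ler_pdivrMl//; apply: le_trans h; by rewrite mulrC lerDr ler01.
Qed.

Lemma horner_bound P : exists2 M : R, 0 <= M & forall y, `|y| <= 1 -> `|P.[y]| <= M.
Proof.
exists (\sum_(i < size P) `|P`_i|) => [|y y1]; first by apply: sumr_ge0.
rewrite horner_coef; apply: le_trans (ler_norm_sum _ _ _) _.
apply: ler_sum => i _; rewrite normrM normrX -[leRHS]mulr1 ler_wpM2l//.
exact: exprn_ile1.
Qed.

(** The exponential decays faster than (1 - y^2)^(k + 2), and 1 - y^2 <= 2 |y - x| if |x| >= 1 > |y|.
This makes the derivative vanish at the endpoints as well as outside. *)
Lemma bump_flat P k : exists2 C : R, 0 <= C &
  forall x y, 1 <= `|x| -> `|bumpf P k y| <= C * (y - x) ^+ 2.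
Proof.
have [M M0 hM] := horner_bound P.
exists (4 * (M * k.+2`!%:R)) => [|x y x1]; first by rewrite !mulr_ge0.
rewrite /bumpf; case: ifPn => y1; last by rewrite normr0; apply: mulr_ge0; rewrite ?sqr_ge0// !mulr_ge0.
have z0 := den_gt0 y1; set z := 1 - y ^+ 2 in z0 *.
have i0 : 0 < z^-1 by rewrite invr_gt0.
have -> : P.[y] * z^-1 ^+ k * expR (- z^-1) = P.[y] * (z^-1 ^+ k.+2 * expR (- z^-1)) * z ^+ 2.
  by rewrite !exprS; field; exact: lt0r_neq0.
have zle : z <= 2 * `|y - x|.
  have h1 : `|x| - `|y| <= `|y - x| by rewrite distrC lerB_dist.
  have -> : z = (1 - `|y|) * (1 + `|y|) by rewrite /z -(real_normK (num_real y)); ring.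
  have y0 := normr_ge0 y; move: (`|y|) (`|x|) (`|y - x|) y1 y0 x1 h1 => a b c; nra.
have J0 : 0 <= z^-1 ^+ k.+2 * expR (- z^-1) by rewrite mulr_ge0 ?expR_ge0// exprn_ge0// ltW.
rewrite normrM (ger0_norm (sqr_ge0 z)) normrM (ger0_norm J0).
rewrite (_ : 4 * _ * _ = (M * k.+2`!%:R) * (4 * (y - x) ^+ 2)); last by ring.
apply: ler_pM; rewrite ?sqr_ge0//.
- by rewrite mulr_ge0.
- apply: ler_pM => //.
  + by apply: hM; exact: ltW.
  + by apply: powexp_le; exact: ltW.
- have -> : 4 * (y - x) ^+ 2 = (2 * `|y - x|) ^+ 2.
    by rewrite exprMn real_normK ?num_real// -natrX.
  by rewrite ler_pXn2r ?nnegrE// ?(ltW z0)// mulr_ge0.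
Qed.

Lemma flat_is_derive (f : R -> R) (C x : R) : 0 <= C -> f x = 0 ->
  (forall y, `|f y| <= C * (y - x) ^+ 2) -> is_derive x 1 f 0.
Proof.
move=> C0 fx0 fle.
have h : h^-1 *: ((f \o shift x) (h *: 1) - f x) @[h --> 0^'] --> (0 : R).
  apply/cvgrPdist_le => e e0; near=> h; rewrite sub0r normrN fx0 subr0/=.
  have h0 : h != 0 by near: h; exact: nbhs_dnbhs_neq.
  have hd : `|h| < e / (C + 1).
    by near: h; apply: dnbhs0_lt; rewrite divr_gt0// ltr_wpDl.
  rewrite normrM normfV ler_pdivrMl ?normr_gt0//.
  have := fle (h *: 1 + x); rewrite addrK -[h *: 1]/(h * 1) mulr1 => {}fle.
  apply: le_trans fle _; rewrite -real_normK ?num_real// expr2.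
  rewrite ltr_pdivlMr in hd; last by rewrite ltr_wpDl.
  have := normr_ge0 h; move: (`|h|) hd => a hd a0; nra.
by split; [apply/cvg_ex; exists 0|exact: cvg_lim h].
Unshelve. all: by end_near. Qed.

Let is_derive_inv1 x : `|x| < 1 ->
  is_derive x 1 (fun y : R => (1 - y ^+ 2)^-1) (2 * x * (1 - x ^+ 2)^-1 ^+ 2).
Proof.
move=> x1; have z0 := den_gt0 x1.
have d : is_derive x 1 (fun y : R => 1 - y ^+ 2) (- (2 * x)).
  have := is_deriveDf (is_derivecf 1 x) (is_deriveZf (-1) (is_deriveMf (is_derive_id x (1:R)) (is_derive_id x (1:R)))).
  rewrite (_ : (fun y => _) = (fun y : R => 1 - y ^+ 2)); last first.
    by apply/funext => y; rewrite expr2 mulN1r.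
  by move=> h; apply: is_derive_eq h _; ring.
apply: is_derive_eq; first by apply: (@is_deriveV _ (fun y : R => 1 - y ^+ 2)); exact: lt0r_neq0.
rewrite /GRing.scale/=; field; exact: lt0r_neq0.
Qed.

Let is_derive_invX k x : `|x| < 1 ->
  is_derive x 1 (fun y : R => (1 - y ^+ 2)^-1 ^+ k) (2 * k%:R * x * (1 - x ^+ 2)^-1 ^+ k.+1).
Proof.
move=> x1; elim: k => [|k IH].
  by under eq_fun do rewrite expr0; apply: is_derive_eq (is_derivecf 1 x) _; ring.
under eq_fun do rewrite exprS; apply: is_derive_eq (is_deriveMf (is_derive_inv1 x1) IH) _.
rewrite -[k.+1%:R]natr1 !exprS; ring.
Qed.

(** The polynomial in the derivative of bumpf P k, over the common denominator (1 - x^2)^(k + 2). *)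
Definition dbump P k : {poly R} :=
  P^`() * (1 - 'X ^+ 2) ^+ 2 + (2 * k%:R) *: ('X * P * (1 - 'X ^+ 2)) - 2 *: ('X * P).

Lemma dbumpE P k x : (dbump P k).[x] = P^`().[x] * (1 - x ^+ 2) ^+ 2
  + 2 * k%:R * (x * P.[x] * (1 - x ^+ 2)) - 2 * (x * P.[x]).
Proof.
by rewrite /dbump !(hornerD, hornerN, hornerM, hornerZ, hornerXn, hornerX, hornerC, horner_exp).
Qed.

Lemma is_derive_bump P k x : is_derive x 1 (bumpf P k) (bumpf (dbump P k) k.+2 x).
Proof.
have [x1|x1] := ltP `|x| 1; last first.
  have [C C0 hC] := bump_flat P k.
  have E Q n : bumpf Q n x = 0 by rewrite /bumpf ltNge x1.
  by rewrite E; apply: (flat_is_derive C0) => // y; exact: hC.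
have o : open [set y : R | `|y| < 1].
  apply: (@open_comp _ _ (fun y : R => `|y|) [set y | y < 1]); last exact: open_lt.
  by move=> y _; exact: norm_continuous.
have E0 : \forall y \near x, P.[y] * (1 - y ^+ 2)^-1 ^+ k * expR (- (1 - y ^+ 2)^-1) = bumpf P k y.
  have := open_nbhs_nbhs (conj o x1 : open_nbhs x _); apply: filterS => y /= y1.
  by rewrite /bumpf y1.
apply: (near_eq_is_derive E0); rewrite /bumpf x1; have z0 := den_gt0 x1.
have d1 := @is_derive_compf R expR _ x _ _ (is_derive_expR _) (is_deriveZf (-1) (is_derive_inv1 x1)).
have := is_deriveMf (is_deriveMf (is_derive_poly P x) (is_derive_invX k x1)) d1.
rewrite (_ : (fun y => _) = (fun y : R => P.[y] * (1 - y ^+ 2)^-1 ^+ k * expR (- (1 - y ^+ 2)^-1))); last first.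
  by apply/funext => y; rewrite mulN1r.
move=> h; apply: is_derive_eq h _.
rewrite !mulN1r; set e := expR _.
rewrite dbumpE !exprS; set I := (1 - x ^+ 2)^-1 ^+ k.
by field; exact: lt0r_neq0.
Qed.

Definition tbump (a b : R) P k x : R := bumpf P k (a * x + b).

Lemma is_derive_tbump a b P k x :
  is_derive x 1 (tbump a b P k) (tbump a b (a *: dbump P k) k.+2 x).
Proof.
have d : is_derive x 1 (fun y => a * y + b) (a + 0).
  exact: is_deriveDf (is_derive_lin a x) (is_derivecf b x).
have h := @is_derive_compf R (bumpf P k) (fun y => a * y + b) x _ _ (is_derive_bump P k (a * x + b)) d.
apply: is_derive_eq h _.
by rewrite /tbump /bumpf addr0; case: ifP => _; rewrite ?mul0r// hornerZ; ring.
Qed.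

Lemma derive1n_tbump a b P k n : exists Q m, derive1n n (tbump a b P k) = tbump a b Q m.
Proof.
elim: n => [|n [Q [m IH]]]; first by exists P, k.
exists (a *: dbump Q m), m.+2; rewrite derive1nS IH; apply/funext => x.
by rewrite derive1E; have [_ ->] := is_derive_tbump a b Q m x.
Qed.

Lemma tbump_supp a b P k x : 1 <= `|a * x + b| -> tbump a b P k x = 0.
Proof. by move=> h; rewrite /tbump /bumpf ltNge h. Qed.

Lemma test_tbump a b P k : a != 0 -> test_function (tbump a b P k).
Proof.
move=> a0; split.
  move=> n x; have [Q [m ->]] := derive1n_tbump a b P k n.
  by have [] := is_derive_tbump a b Q m x.
exists ((1 + `|b|) / `|a|) => x; rewrite ltr_pdivrMr ?normr_gt0// -normrM => h.
apply: tbump_supp; rewrite mulrC.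
have := lerB_dist (x * a) (- b); rewrite normrN opprK => h2; lra.
Qed.

Lemma continuous_tbump a b P k : continuous (tbump a b P k).
Proof. by move=> x; exact: is_derive_cont (is_derive_tbump a b P k x). Qed.

End Bump.

(** * Transforms of derivatives and of convolutions *)

Section Distributional.
Context {R : realType}.
Local Notation mu := (@lebesgue_measure R).
Implicit Types (f g h b psi : R -> R).

Lemma intg_box f (M : R) (n : nat) : measurable_fun setT f -> (forall x, `|f x| <= M) ->
  (forall x, n%:R < `|x| -> f x = 0) -> intg f.
Proof.
move=> mf fM f0.
have Ib : intg (\1_(box n) : R -> R) by apply: intg_indic; [exact: measurable_box|exact: mu_box].
have := intgZ M Ib; apply: intg_le => // x; rewrite indicE.
have [xb|] := boolP (x \in _); first by rewrite mulr1.
have [/f0 ->|xn] := ltP n%:R `|x|; first by rewrite normr0 mulr0.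
by rewrite notin_setE /box/= in_itv/= -ler_norml xn.
Qed.

Lemma Rint_derive0 (F f : R -> R) (n : nat) : (0 < n)%N ->
  (forall x : R, is_derive x 1 F (f x)) -> continuous f ->
  (forall x, n%:R <= `|x| -> F x = 0) -> (forall x, n%:R < `|x| -> f x = 0) ->
  \int[mu]_x f x = 0.
Proof.
move=> n0 dF cf F0 f0.
have nn : (- n%:R : R) < n%:R by apply: gtrN; rewrite ltr0n.
transitivity (\int[mu]_x (\1_(box n) x * f x)).
  apply: eq_Rintegral => x _; rewrite indicE.
  have [_|] := boolP (x \in _); first by rewrite mul1r.
  have [/f0 ->|xn] := ltP n%:R `|x|; first by rewrite mulr0.
  by rewrite notin_setE /box/= in_itv/= -ler_norml xn.
rewrite -Rint_box /Rintegral (@continuous_FTC2 _ f F)//.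
- by rewrite !F0 ?normrN ?ger0_norm// -EFinB subrr.
- exact: continuous_subspaceT.
- split.
  + by move=> x _; case: (dF x).
  + by apply: cvg_at_right_filter; exact: (is_derive_cont (dF _)).
  + by apply: cvg_at_left_filter; exact: (is_derive_cont (dF _)).
- by move=> x _; rewrite derive1E; have [_ ->] := dF x.
Qed.

(** The pair (C, S) is (cos, sin) or (sin, - cos) at frequency xi, so that both transforms are covered.
The left-hand side minus the right-hand side is the integral of the derivative of
r' C + xi r S, which has compact support. *)
Lemma Rint_by_parts2 (r r1 r2 C S : R -> R) (n : nat) (xi : R) : (0 < n)%N ->
  (forall x : R, is_derive x 1 r (r1 x)) -> (forall x : R, is_derive x 1 r1 (r2 x)) -> continuous r2 ->
  (forall x, n%:R <= `|x| -> r x = 0 /\ r1 x = 0 /\ r2 x = 0) ->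
  (forall x : R, is_derive x 1 C (- (xi * S x))) -> (forall x : R, is_derive x 1 S (xi * C x)) ->
  intg (fun x => r x * C x) -> intg (fun x => r2 x * C x) ->
  \int[mu]_x (r2 x * C x) = - (xi ^+ 2 * \int[mu]_x (r x * C x)).
Proof.
move=> n0 d1 d2 c2 z dC dS I1 I2.
have I3 := intgZ (xi ^+ 2) I1.
suff h : \int[mu]_x (r2 x * C x + xi ^+ 2 * (r x * C x)) = 0.
  by rewrite (RintD I2 I3) (RintZ _ I1) in h; lra.
apply: (@Rint_derive0 (fun x => r1 x * C x + xi * (r x * S x)) _ n) => //.
- move=> x; have h := is_deriveDf (is_deriveMf (d2 x) (dC x)) (is_deriveZf xi (is_deriveMf (d1 x) (dS x))).
  by apply: is_derive_eq h _; ring.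
- move=> x; apply: cvgD; first by apply: cvgM; [exact: c2|exact: is_derive_cont (dC x)].
  apply: cvgM; first exact: cvg_cst.
  by apply: cvgM; [exact: is_derive_cont (d1 x)|exact: is_derive_cont (dC x)].
- by move=> x /z[-> [-> _]]; rewrite !mul0r mulr0 addr0.
- by move=> x /ltW/z[-> [_ ->]]; rewrite !mul0r mulr0 addr0.
Qed.

Lemma tbump_box (a c : R) : a != 0 -> exists2 n : nat, (0 < n)%N &
  forall P k (x : R), n%:R <= `|x| -> tbump a c P k x = 0.
Proof.
move=> a0; exists (Num.truncn ((1 + `|c|) / `|a|)).+1 => // P k x h.
apply: tbump_supp; have h1 := truncnS_gt ((1 + `|c|) / `|a|).
have h2 : (1 + `|c|) / `|a| <= `|x| by apply/ltW/(lt_le_trans h1).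
rewrite ler_pdivrMr ?normr_gt0// -normrM mulrC in h2.
have := lerB_dist (a * x) (- c); rewrite normrN opprK => h3; lra.
Qed.

Lemma tbump_bound (a c : R) P k : exists2 M : R, 0 <= M & forall x, `|tbump a c P k x| <= M.
Proof.
have [C C0 hC] := bump_flat P k; exists (C * 4) => [|x]; first by rewrite mulr_ge0.
rewrite /tbump; move: (a * x + c) => y.
have [y1|y1] := ltP `|y| 1; last by rewrite /bumpf ltNge y1/= normr0 mulr_ge0.
apply: le_trans (hC 1 y _) _; first by rewrite normr1.
by rewrite ler_wpM2l//; move: y1; rewrite ltr_norml => /andP[]; nra.
Qed.

Lemma tbump_meas (a c : R) P k : measurable_fun setT (tbump a c P k).
Proof. by apply: continuous_measurable_fun; exact: continuous_tbump. Qed.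

Lemma tbump_intg (a c : R) P k : a != 0 -> intg (tbump a c P k).
Proof.
move=> a0; have [n n0 hn] := tbump_box c a0; have [M M0 hM] := tbump_bound a c P k.
by apply: (@intg_box _ M n) => // [|x /ltW/hn]; first exact: tbump_meas.
Qed.

Lemma tbump_l2 (a c : R) P k : a != 0 -> l2 (tbump a c P k).
Proof.
move=> a0; have [M M0 hM] := tbump_bound a c P k.
by apply: intg_bounded_l2 hM; exact: tbump_intg.
Qed.

Lemma is_derive_cosM (xi x : R) : is_derive x 1 (fun y => cos (xi * y)) (- (xi * sin (xi * x))).
Proof.
have h := @is_derive_compf R cos _ x _ _ (is_derive_cos (xi * x)) (is_derive_lin xi x).
by apply: is_derive_eq h _; ring.
Qed.

Lemma is_derive_sinM (xi x : R) : is_derive x 1 (fun y => sin (xi * y)) (xi * cos (xi * x)).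
Proof.
have h := @is_derive_compf R sin _ x _ _ (is_derive_sin (xi * x)) (is_derive_lin xi x).
by apply: is_derive_eq h _; ring.
Qed.

Lemma F_tbump2 (a c : R) P k : a != 0 -> exists Q m,
  [/\ derive1n 2 (tbump a c P k) = tbump a c Q m,
   forall xi, Fc (tbump a c Q m) xi = - (xi ^+ 2 * Fc (tbump a c P k) xi) &
   forall xi, Fs (tbump a c Q m) xi = - (xi ^+ 2 * Fs (tbump a c P k) xi)].
Proof.
move=> a0; set P1 := a *: dbump P k; set P2 := a *: dbump P1 k.+2.
exists P2, k.+4; have [n n0 hn] := tbump_box c a0.
have I1 := tbump_intg c P k a0; have I2 := tbump_intg c P2 k.+4 a0.
have hz x : n%:R <= `|x| -> tbump a c P k x = 0 /\ tbump a c P1 k.+2 x = 0 /\ tbump a c P2 k.+4 x = 0.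
  by move=> h; rewrite !hn.
split.
- apply/funext => x; rewrite derive1nS derive1n1 derive1E.
  rewrite (_ : derive1 _ = tbump a c P1 k.+2).
    by have [_ ->] := is_derive_tbump a c P1 k.+2 x.
  by apply/funext => y; rewrite derive1E; have [_ ->] := is_derive_tbump a c P k y.
- move=> xi; apply: (@Rint_by_parts2 _ (tbump a c P1 k.+2) _ (fun x => cos (xi * x)) (fun x => sin (xi * x)) n) => //.
  + exact: is_derive_tbump.
  + exact: is_derive_tbump.
  + exact: continuous_tbump.
  + exact: is_derive_cosM.
  + exact: is_derive_sinM.
  + exact: intg_cos.
  + exact: intg_cos.
- move=> xi; apply: (@Rint_by_parts2 (tbump a c P k) (tbump a c P1 k.+2) (tbump a c P2 k.+4) (fun x => sin (xi * x)) (fun x => - cos (xi * x)) n) => //.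
  + exact: is_derive_tbump.
  + exact: is_derive_tbump.
  + exact: continuous_tbump.
  + by move=> x; apply: is_derive_eq (is_derive_sinM xi x) _; ring.
  + move=> x; have h := is_deriveZf (-1) (is_derive_cosM xi x).
    under eq_fun do rewrite -mulN1r.
    by apply: is_derive_eq h _; ring.
  + exact: intg_sin.
  + exact: intg_sin.
Qed.

(** For fixed x the integral in y of the absolute value is |psi x| times the L^1 norm of b. *)
Lemma intg2_conv b psi : intg b -> intg psi -> intg2 (fun z => b (z.1 - z.2) * psi z.1).
Proof.
move=> Ib Ip.
have mF : measurable_fun setT (fun z : R * R => b (z.1 - z.2) * psi z.1).
  apply: measurable_funM.
  - apply: (@measurableT_comp _ _ _ _ _ _ b _ (fun z : R * R => z.1 - z.2)); first exact: intg_meas.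
    exact: measurable_funB.
  - by apply: (measurableT_comp (intg_meas Ip)).
have m1 : (-1 : R) != 0 by rewrite oppr_eq0 oner_eq0.
have [mb bo] := integrableP _ _ _ Ib; have [mp po] := integrableP _ _ _ Ip.
apply/integrable12ltyP; first exact/measurable_EFinP.
rewrite (_ : (fun x => _) = (fun x => `|psi x|%:E * \int[mu]_y `|b y|%:E)%E); last first.
  apply/funext => x.
  rewrite (@ge0_integral_affine _ (-1) x (fun y => `|b y|%:E))//; last first.
    by apply/measurable_EFinP; apply: measurableT_comp => //; exact: intg_meas.
  rewrite normrN1 mul1e -ge0_integralZl_EFin//; last first.
    apply/measurable_EFinP; apply: measurableT_comp => //.
    by apply: measurable_comp_affine; exact: intg_meas.
  by apply: eq_integral => y _ /=; rewrite normrM mulrC -EFinM mulN1r addrC.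
rewrite ge0_integralZr//.
- by apply: lte_mul_pinfty => //; [exact: integral_ge0|rewrite ge0_fin_numE//; exact: integral_ge0].
- by apply/measurable_EFinP; apply: measurableT_comp => //; exact: intg_meas.
- exact: integral_ge0.
Qed.

(** The adjoint of the convolution with b: convolution with the reflection of b. *)
Definition tconv b psi (y : R) : R := \int[mu]_x (b (x - y) * psi x).

Lemma intg_tconv b psi : intg b -> intg psi -> intg (tconv b psi).
Proof. by move=> Ib Ip; have [_ ] := Rfubini (intg2_conv Ib Ip). Qed.

Lemma tconv_bound b psi (M : R) : intg b -> measurable_fun setT psi -> (forall x, `|psi x| <= M) ->
  forall y, `|tconv b psi y| <= M * \int[mu]_x `|b x|.
Proof.
move=> Ib mp pM y.
have o1 : (1 : R) != 0 by exact: oner_neq0.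
have Ia : intg (fun x => b (x - y)).
  by have := intg_affine (- y) o1 Ib; under eq_fun do rewrite mul1r.
have E : \int[mu]_x `|b x| = \int[mu]_x `|b (x - y)|.
  rewrite (Rint_affine (- y) o1 (intg_norm Ib)) normr1 mul1r.
  by apply: eq_Rintegral => x _; rewrite mul1r.
rewrite E -(RintZ M (intg_norm Ia)); apply: Rint_norm_le.
- exact: intgMr Ia mp pM.
- exact/intgZ/intg_norm.
- by move=> x; rewrite normrM mulrC ler_wpM2r.
Qed.

Lemma conv_swap b psi (m : R -> R) (M K : R) : intg b -> intg psi -> (forall x, `|psi x| <= K) ->
  measurable_fun setT m ->
  (forall y, `|m y| <= M) ->
  \int[mu]_x (\int[mu]_y (b (x - y) * m y) * psi x) = \int[mu]_y (m y * tconv b psi y).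
Proof.
move=> Ib Ip pK mm mM.
have m1 : (-1 : R) != 0 by rewrite oppr_eq0 oner_eq0.
have mm2 : measurable_fun setT (fun z : R * R => m z.2) by apply: (measurableT_comp mm).
have IF := intg2M mm2 (fun z => mM z.2) (intg2_conv Ib Ip).
have [_ _] := Rfubini IF => /=.
rewrite (_ : \int[mu]_x (\int[mu]_y _) = \int[mu]_x (\int[mu]_y (b (x - y) * m y) * psi x)); last first.
  apply: eq_Rintegral => x _.
  have Ix : intg (fun y => b (x - y)).
    have := intg_affine x m1 Ib; congr intg; apply/funext => y; congr b; ring.
  by rewrite mulrC -(RintZ _ (intgMr Ix mm mM)); apply: eq_Rintegral => y _; ring.
move=> ->; apply: eq_Rintegral => y _.
rewrite /tconv -RintZ//; apply: (intgMr _ (intg_meas Ip) pK).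
have o1 : (1 : R) != 0 by exact: oner_neq0.
by have := intg_affine (- y) o1 Ib; under eq_fun do rewrite mul1r.
Qed.

(** The reflection conjugates the transform of b, which is harmless here because Fs b xi = 0 makes
this transform real at xi. *)
Lemma Fc_tconv b psi (K xi : R) : intg b -> intg psi -> (forall x, `|psi x| <= K) -> Fs b xi = 0 ->
  Fc (tconv b psi) xi = Fc b xi * Fc psi xi /\ Fs (tconv b psi) xi = Fc b xi * Fs psi xi.
Proof.
move=> Ib Ip pK b0.
have m1 : (-1 : R) != 0 by rewrite oppr_eq0 oner_eq0.
have Ic := intg_cos xi Ib; have Is := intg_sin xi Ib.
have Ix x : intg (fun y => b (x - y)).
  by have := intg_affine x m1 Ib; congr intg; apply/funext => y; congr b; ring.
have sub (k : R -> R) (M x : R) : measurable_fun setT k -> (forall y, `|k y| <= M) ->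
    \int[mu]_y (b (x - y) * k y) = \int[mu]_z (b z * k (x - z)).
  move=> mk kM; rewrite (Rint_affine x m1 (intgMr (Ix x) mk kM)) normrN1 mul1r.
  by apply: eq_Rintegral => z _; congr (b _ * k _); ring.
split.
- rewrite /Fc; transitivity (\int[mu]_y (cos (xi * y) * tconv b psi y)).
    by apply: eq_Rintegral => y _; rewrite mulrC.
  rewrite -(conv_swap Ib Ip pK (measurable_cosM xi) (fun y => norm_cos_le1 _)).
  rewrite -(RintZ _ (intg_cos xi Ip)); apply: eq_Rintegral => x _.
  rewrite (sub _ _ x (measurable_cosM xi) (fun y => norm_cos_le1 _)).
  transitivity (\int[mu]_z (cos (xi * x) * (b z * cos (xi * z)) + sin (xi * x) * (b z * sin (xi * z))) * psi x).
    congr (_ * _); apply: eq_Rintegral => z _; rewrite mulrBr cosB; ring.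
  rewrite (RintD (intgZ _ Ic) (intgZ _ Is)) (RintZ _ Ic) (RintZ _ Is).
  by rewrite -[X in _ + _ * X]/(Fs b xi) b0 mulr0 addr0; ring.
- rewrite {1}/Fs; transitivity (\int[mu]_y (sin (xi * y) * tconv b psi y)).
    by apply: eq_Rintegral => y _; rewrite mulrC.
  rewrite -(conv_swap Ib Ip pK (measurable_sinM xi) (fun y => norm_sin_le1 _)).
  rewrite -(RintZ _ (intg_sin xi Ip)); apply: eq_Rintegral => x _.
  rewrite (sub _ _ x (measurable_sinM xi) (fun y => norm_sin_le1 _)).
  transitivity (\int[mu]_z (sin (xi * x) * (b z * cos (xi * z)) - cos (xi * x) * (b z * sin (xi * z))) * psi x).
    congr (_ * _); apply: eq_Rintegral => z _; rewrite mulrBr sinB; ring.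
  rewrite (RintB (intgZ _ Ic) (intgZ _ Is)) (RintZ _ Ic) (RintZ _ Is).
  by rewrite -[X in _ - _ * X]/(Fs b xi) b0 mulr0 subr0 -[X in _ * X * _]/(Fc b xi); ring.
Qed.

(** f is replaced by its clamped version, which is bounded everywhere and equal to f almost
everywhere, so that Fubini's theorem applies. *)
Lemma conv_test b f psi (M K : R) : intg b -> intg psi -> (forall x, `|psi x| <= K) ->
  measurable_fun setT f -> 0 <= M -> {ae mu, forall x, `|f x| <= M} ->
  \int[mu]_x (convolution b f x * psi x) = \int[mu]_y (f y * tconv b psi y).
Proof.
move=> Ib Ip pK mf M0 fM.
have m1 : (-1 : R) != 0 by rewrite oppr_eq0 oner_eq0.
have mcf : measurable_fun setT (fun x => clamp M (f x)) by exact: measurableT_comp (measurable_clamp M) mf.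
have fE : {ae mu, forall x, f x = clamp M (f x)} by apply: aeS fM => x /clamp_id.
have Ix (x : R) : measurable_fun setT (fun y : R => b (x - y)).
  apply: intg_meas; have := intg_affine x m1 Ib; congr intg; apply/funext => y; congr b; ring.
have cE x : convolution b f x = \int[mu]_y (b (x - y) * clamp M (f y)).
  apply: eq_ae_Rint; [exact: measurable_funM..|].
  by apply: aeS fE => y <-.
transitivity (\int[mu]_x (\int[mu]_y (b (x - y) * clamp M (f y)) * psi x)).
  by apply: eq_Rintegral => x _; rewrite cE.
rewrite (conv_swap Ib Ip pK mcf (fun y => clamp_bound _ M0)).
have mt := intg_meas (intg_tconv Ib Ip).
apply: eq_ae_Rint; [exact: measurable_funM..|].
by apply: aeS fE => y <-.
Qed.

End Distributional.

(** * The wave equation in Fourier variables *)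

Section FourierEquation.
Context {R : realType}.
Local Notation mu := (@lebesgue_measure R).
Local Notation H := (@dot_semi_inner R).
Implicit Types (f g h b : R -> R) (p q D : @pfun R).

Definition mulp (w : R -> R) p : @pfun R := ((fun x => w x * p.1 x), (fun x => w x * p.2 x)).

Lemma dot_mulp w p q : dot (mulp w p) q = dot p (mulp w q).
Proof. by congr (_ + _); apply: eq_Rintegral => x _ /=; ring. Qed.

Lemma pl2_mulp (w : R -> R) (M : R) p : measurable_fun setT w -> (forall x, `|w x| <= M) -> pl2 p ->
  pl2 (mulp w p).
Proof. by move=> mw wM [l1 l2']; split; exact: l2_bounded wM _. Qed.

(** The function i f. As dot is only the real part of the Hermitian product, vanishing of the latter
is tested on both rfun and ifun. *)
Definition ifun f : @pfun R := ((fun=> 0), f).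

Lemma pl2_ifun f : l2 f -> pl2 (ifun f).
Proof. by move=> lf; split=> //; exact: l20. Qed.

Lemma dot_rfun_ifun f g : dot (rfun f) (ifun g) = 0.
Proof.
rewrite /dot/=; under eq_Rintegral do rewrite mulr0; rewrite /Rintegral integral0 add0r.
rewrite (eq_integral (cst 0%E)) ?integral0// => x _.
by rewrite -[_ * _]/(0 * g x) mul0r.
Qed.

Lemma Fc0 xi : Fc (fun=> 0) xi = 0 :> R.
Proof. by rewrite /Fc; under eq_Rintegral do rewrite mul0r; rewrite /Rintegral integral0. Qed.

Lemma Fs0 xi : Fs (fun=> 0) xi = 0 :> R.
Proof. by rewrite /Fs; under eq_Rintegral do rewrite mul0r; rewrite /Rintegral integral0. Qed.

Lemma FT_rfun f : FT (rfun f) = (Fc f, (fun xi => - Fs f xi)).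
Proof.
congr (_, _); apply/funext => xi /=.
  by rewrite -[X in _ + X]/(Fs (fun=> 0) xi) Fs0 addr0.
by rewrite -[X in X - _]/(Fc (fun=> 0) xi) Fc0 add0r.
Qed.

Lemma FT_ifun f : FT (ifun f) = (Fs f, Fc f).
Proof. by congr (_, _); apply/funext => xi /=; rewrite ?Fc0 ?Fs0 ?add0r ?subr0. Qed.

Lemma intg0 : intg (fun=> 0 : R).
Proof. exact: integrable0. Qed.

Lemma pintg_rfun f : intg f -> pintg (rfun f).
Proof. by move=> If; split=> //; exact: intg0. Qed.

Lemma pintg_ifun f : intg f -> pintg (ifun f).
Proof. by move=> If; split=> //; exact: intg0. Qed.

(** The standard bump, moved to c and rescaled to width 1 / (n + 1). *)
Let tb (n : nat) (c : R) : R -> R := tbump n.+1%:R (- (n.+1%:R * c)) 1 0.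

Let tbE n c x : tb n c x = tb n 0 (x - c).
Proof. by rewrite /tb /tbump; congr (bumpf _ _ _); ring. Qed.

Let nz n : n.+1%:R != 0 :> R. Proof. by rewrite pnatr_eq0. Qed.

Let tb_intg n c : intg (tb n c). Proof. exact: tbump_intg. Qed.
Let tb_l2 n c : l2 (tb n c). Proof. exact: tbump_l2. Qed.

Let tb0E n x : tb n 0 x = bumpf 1 0 (n.+1%:R * x).
Proof. by rewrite /tb /tbump mulr0 oppr0 addr0. Qed.

Lemma bumpfN x : bumpf 1 0 (- x) = bumpf 1 0 x :> R.
Proof. by rewrite /bumpf normrN sqrrN !hornerC. Qed.

Lemma bumpf_ge0 (x : R) : 0 <= bumpf 1 0 x.
Proof. by rewrite /bumpf; case: ifP => // _; rewrite hornerC expr0 !mul1r expR_ge0. Qed.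

Lemma bumpf_gt0 (x : R) : `|x| < 1 -> 0 < bumpf 1 0 x.
Proof. by rewrite /bumpf => ->; rewrite hornerC expr0 !mul1r expR_gt0. Qed.

Let Fs_tb0 n xi : Fs (tb n 0) xi = 0.
Proof.
apply: odd_Rint; first exact: intg_sin.
by move=> x; rewrite !tb0E mulrN bumpfN mulrN sinN mulrN.
Qed.

Let o1 : (1 : R) != 0. Proof. exact: oner_neq0. Qed.

Let Fc_tb n c xi : Fc (tb n c) xi = cos (xi * c) * Fc (tb n 0) xi.
Proof.
have Ic := intg_cos xi (tb_intg n 0); have Is := intg_sin xi (tb_intg n 0).
rewrite {1}/Fc (Rint_affine c o1 (intg_cos xi (tb_intg n c))) normr1 mul1r.
transitivity (\int[mu]_x (cos (xi * c) * (tb n 0 x * cos (xi * x)) - sin (xi * c) * (tb n 0 x * sin (xi * x)))).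
  apply: eq_Rintegral => x _; rewrite tbE mul1r addrK mulrDr cosD; ring.
rewrite (RintB (intgZ _ Ic) (intgZ _ Is)) (RintZ _ Ic) (RintZ _ Is).
by rewrite -[X in _ - _ * X]/(Fs (tb n 0) xi) Fs_tb0 mulr0 subr0.
Qed.

Let Fs_tb n c xi : Fs (tb n c) xi = sin (xi * c) * Fc (tb n 0) xi.
Proof.
have Ic := intg_cos xi (tb_intg n 0); have Is := intg_sin xi (tb_intg n 0).
rewrite {1}/Fs (Rint_affine c o1 (intg_sin xi (tb_intg n c))) normr1 mul1r.
transitivity (\int[mu]_x (sin (xi * c) * (tb n 0 x * cos (xi * x)) + cos (xi * c) * (tb n 0 x * sin (xi * x)))).
  apply: eq_Rintegral => x _; rewrite tbE mul1r addrK mulrDr sinD; ring.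
rewrite (RintD (intgZ _ Ic) (intgZ _ Is)) (RintZ _ Ic) (RintZ _ Is).
by rewrite -[X in _ + _ * X]/(Fs (tb n 0) xi) Fs_tb0 mulr0 addr0.
Qed.

(** On the support of the bump |xi x| < 1 < pi / 2, so that the integrand is nonnegative there, and
positive on an interval. *)
Let Fc_tb_gt0 n xi : `|xi| <= n.+1%:R -> 0 < Fc (tb n 0) xi.
Proof.
move=> xin; have I := intg_cos xi (tb_intg n 0).
have n0 : (0 : R) < n.+1%:R by rewrite ltr0n.
have cpos (x : R) : `|x| < n.+1%:R^-1 -> 0 < cos (xi * x).
  move=> xn; apply: cos_gt0_pihalf.
  have h : `|xi * x| < 1.
    rewrite normrM; have [->|x0] := eqVneq (`|x|) 0; first by rewrite mulr0.
    have x1 : 0 < `|x| by rewrite lt_neqAle eq_sym x0 normr_ge0.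
    rewrite -(mulfV (nz n)); apply: (@le_lt_trans _ _ (n.+1%:R * `|x|)); first by rewrite ler_wpM2r.
    by rewrite ltr_pM2l.
  rewrite -ltr_norml; apply: lt_le_trans h _; exact: pihalf_ge1.
have insupp (x : R) : `|x| < n.+1%:R^-1 <-> `|n.+1%:R * x| < 1.
  by rewrite normrM (gtr0_norm n0) -ltr_pdivlMl// mulr1.
have J0 x : 0 <= tb n 0 x * cos (xi * x).
  rewrite tb0E; have [h|h] := ltP `|n.+1%:R * x| 1.
    by rewrite mulr_ge0 ?bumpf_ge0// ltW//; apply: cpos; apply/insupp.
  by rewrite /bumpf ltNge h/= mul0r.
rewrite lt_neqAle Rint_ge0// andbT eq_sym; apply/negP => /eqP I0.
pose A : set R := `](- n.+1%:R^-1), n.+1%:R^-1[%classic.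
have mA : measurable A by exact: measurable_itv.
have A0 : {ae mu, forall x, \1_A x = 0 :> R}.
  apply: aeS (Rint_eq0 I J0 I0) => x h; rewrite indicE; apply/eqP; rewrite pnatr_eq0 eqb0.
  apply/negP; rewrite inE /A/= in_itv/= -ltr_norml => xn.
  have : 0 < tb n 0 x * cos (xi * x).
    by rewrite mulr_gt0 ?cpos// tb0E bumpf_gt0//; apply/insupp.
  by rewrite h ltxx.
have i0 : 0 < n.+1%:R^-1 :> R by rewrite invr_gt0.
have muA : mu A = (n.+1%:R^-1 + n.+1%:R^-1)%:E.
  by rewrite /A lebesgue_measure_itv/= lte_fin ifT ?EFinB ?opprK//; exact: gtrN.
have E : (\int[mu]_x (\1_A x)%:E = mu A)%E by rewrite integral_indic// setIT.
have := @eq_ae_Rint _ (\1_A : R -> R) (fun=> 0) (measurable_indic mA) (measurable_cst _) A0.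
rewrite {2}/Rintegral integral0 /Rintegral [X in fine X = _]E muA/= => h.
by move/eqP: h; rewrite gt_eqF// addr_gt0.
Qed.

(** Let rho be the transform of a bump centred at 0; it is real and bounded. The transform of the
bump centred at c is exp (- i c xi) rho, so the orthogonality relations say that the
Fourier transform of D rho, which is in both L^1 and L^2, vanishes identically. By Plancherel's
identity D rho = 0 almost everywhere, and rho > 0 on an interval that grows as the bump gets
narrower. *)
Lemma orth_tests_ae0 D : pl2 D ->
  (forall (a c : R) P k, a != 0 -> dot D (FT (rfun (tbump a c P k))) = 0 /\
     dot D (FT (ifun (tbump a c P k))) = 0) ->
  pae D 0.
Proof.
move=> lD hD.
suff h n : {ae mu, forall x, `|x| <= n.+1%:R -> D.1 x = 0 /\ D.2 x = 0}.
  have {}h : {ae mu, forall x, forall n, `|x| <= n.+1%:R -> D.1 x = 0 /\ D.2 x = 0}.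
    exact/ae_foralln.
  have loc (x : R) : `|x| <= (Num.truncn `|x|).+1%:R by apply/ltW/truncnS_gt.
  by split; apply: aeS h => x /(_ _ (loc x)) [].
pose r := Fc (tb n 0); have It := tb_intg n 0; have lt := tb_l2 n 0.
have lr : l2 r by exact: l2_Fc.
have rM x : `|r x| <= \int[mu]_x `|tb n 0 x| by exact: Fc_bound.
have mr : measurable_fun setT r by case: lr.
pose q := mulp r D.
have lq : pl2 q by exact: pl2_mulp rM lD.
have Iq : pintg q.
  by split; [exact: l2M lr lD.1|exact: l2M lr lD.2].
have Fq0 : FT q = 0.
  (* Centring the bump at c gives the value of the transform at - c. *)
  suff E c : Fc q.1 c - Fs q.2 c = 0 /\ Fs q.1 c + Fc q.2 c = 0.
    congr (_, _); apply/funext => c /=.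
    - by have [] := E (- c); rewrite FcN FsN ?opprK//; case: Iq.
    - have [_] := E (- c); rewrite FcN FsN; last by case: Iq.
      by rewrite addrC.
  have [] := hD _ (- (n.+1%:R * c)) 1 0 (nz n).
  rewrite -/(tb n c) FT_rfun FT_ifun /dot/= => e1 e2.
  have c1 : measurable_fun setT (fun x : R => cos (c * x)) by exact: measurable_cosM.
  split.
  - rewrite -[RHS]e1 -[X in _ = _ + X]opprK; congr (_ - _).
      by apply: eq_Rintegral => x _; rewrite Fc_tb /q/= /r mulrC [x * c]mulrC; ring.
    rewrite -[RHS]mulN1r -RintZ; last first.
      apply: l2M; first by case: lD.
      apply: l2N; exact: l2_Fs.
    by apply: eq_Rintegral => x _; rewrite Fs_tb /q/= /r [x * c]mulrC; ring.
  - rewrite -[RHS]e2; congr (_ + _); apply: eq_Rintegral => x _.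
      by rewrite Fs_tb /q/= /r [x * c]mulrC; ring.
    by rewrite Fc_tb /q/= /r [x * c]mulrC; ring.
have q0 : dot q q = 0.
  have := plancherel_pair Iq lq; rewrite Fq0 => /esym/eqP.
  rewrite (_ : dot 0 0 = 0); last first.
    have l0 : pl2 (0 : @pfun R) := pl2_rfun (@l2_0 R).
    by have := dotZl H 0 l0 l0; rewrite scale0r mul0r.
  by rewrite mulf_eq0 gt_eqF ?pi2_gt0//= => /eqP.
have [a1 a2] := dot_eq0_ae lq q0.
apply: aeS2 a1 a2 => x h1 h2 xn; have rx := Fc_tb_gt0 xn.
split.
- by move: h1 => /eqP; rewrite /q/= mulf_eq0 gt_eqF//= => /eqP.
- by move: h2 => /eqP; rewrite /q/= mulf_eq0 gt_eqF//= => /eqP.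
Qed.

(** In the weak form of h = (b * f)_xx the convolution and the derivatives act on the test function.
Parseval's identity then turns it into orthogonality of h^ + xi^2 b^ f^ to the transforms of all
bumps. Bounded weights keep everything in L^2. *)
Lemma eq_fourier b f h (C M : R) : intg b -> (forall xi, Fs b xi = 0) ->
  (forall xi, `|xi ^+ 2 * Fc b xi| <= C) ->
  l2 f -> 0 <= M -> {ae mu, forall x, `|f x| <= M} -> l2 h ->
  (forall phi, test_function phi ->
     \int[mu]_x (convolution b f x * derive1n 2 phi x) = \int[mu]_x (h x * phi x)) ->
  pae (hat h + mulp (fun xi => xi ^+ 2 * Fc b xi) (hat f)) 0.
Proof.
move=> Ib b0 bC lf M0 fM lh htest.
set W := fun xi => _.
have mW : measurable_fun setT W.
  by apply: measurable_funM; [exact: measurable_funX|exact: measurable_Fc].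
have lW : pl2 (mulp W (hat f)) by apply: pl2_mulp bC _ => //; exact: pl2_hat.
have lh' := pl2_hat lh; have lf' := pl2_hat lf.
apply: orth_tests_ae0; first exact: (carD H).
move=> a c P k a0; set ph := tbump a c P k.
have Iph : intg ph by exact: tbump_intg.
have lph : l2 ph by exact: tbump_l2.
have [Q [m [d2 e1 e2]]] := F_tbump2 c P k a0.
rewrite -/ph in d2 e1 e2.
have Ips := tbump_intg c Q m a0; have [K K0 hK] := tbump_bound a c Q m.
set ps := tbump a c Q m in d2 e1 e2 Ips hK.
set ka := tconv b ps.
have Ika : intg ka by exact: intg_tconv.
have lka : l2 ka by apply: intg_bounded_l2 Ika (tconv_bound Ib (intg_meas Ips) hK).
have Fck xi : Fc ka xi = - (W xi * Fc ph xi).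
  by have [-> _] := Fc_tconv Ib Ips hK (b0 xi); rewrite e1 /W; ring.
have Fsk xi : Fs ka xi = - (W xi * Fs ph xi).
  by have [_ ->] := Fc_tconv Ib Ips hK (b0 xi); rewrite e2 /W; ring.
have T : \int[mu]_x (f x * ka x) = \int[mu]_x (h x * ph x).
  rewrite -(htest ph); last exact: test_tbump.
  by rewrite d2 (conv_test Ib Ips hK _ M0 fM)//; case: lf.
have lr (g : R -> R) : intg g -> l2 g -> pl2 (FT (rfun g)).
  by move=> Ig lg; apply: l2_FT; [exact: pintg_rfun|exact: pl2_rfun].
have li (g : R -> R) : intg g -> l2 g -> pl2 (FT (ifun g)).
  by move=> Ig lg; apply: l2_FT; [exact: pintg_ifun|exact: pl2_ifun].
have Pr (w g : R -> R) : l2 w -> intg g -> l2 g -> dot (hat w) (FT (rfun g)) = 2 * pi * \int[mu]_x (w x * g x).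
  move=> lw Ig lg; rewrite -dot_rfun; apply: parseval; [exact: pl2_rfun..|exact: hat_isFT|].
  by apply: isFT_L1; [exact: pintg_rfun|exact: pl2_rfun].
have Pi (w g : R -> R) : l2 w -> intg g -> l2 g -> dot (hat w) (FT (ifun g)) = 0.
  move=> lw Ig lg; rewrite -(mulr0 (2 * pi)) -(dot_rfun_ifun w g).
  apply: parseval; [exact: pl2_rfun|exact: pl2_ifun|exact: hat_isFT|].
  by apply: isFT_L1; [exact: pintg_ifun|exact: pl2_ifun].
have Er : mulp W (FT (rfun ph)) = - FT (rfun ka).
  by rewrite !FT_rfun; congr (_, _); apply/funext => xi /=; rewrite -[RHS]/(- _) ?Fck ?Fsk ?opprK ?mulrN.
have Ei : mulp W (FT (ifun ph)) = - FT (ifun ka).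
  by rewrite !FT_ifun; congr (_, _); apply/funext => xi /=; rewrite -[RHS]/(- _) ?Fck ?Fsk ?opprK.
have Fr : dot (hat f) (mulp W (FT (rfun ph))) = - (2 * pi * \int[mu]_x (h x * ph x)).
  by rewrite Er -scaleN1r (dotZr H _ (lr _ Ika lka) lf') (Pr _ _ lf Ika lka) T mulN1r.
have Fi : dot (hat f) (mulp W (FT (ifun ph))) = 0.
  by rewrite Ei -scaleN1r (dotZr H _ (li _ Ika lka) lf') (Pi _ _ lf Ika lka) mulr0.
split.
- rewrite (dotDl H) ?dot_mulp//; last exact: lr.
  by apply: etrans (congr2 +%R (Pr _ _ lh Iph lph) Fr) _; rewrite subrr.
- rewrite (dotDl H) ?dot_mulp//; last exact: li.
  by apply: etrans (congr2 +%R (Pi _ _ lh Iph lph) Fi) _; rewrite addr0.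
Qed.

End FourierEquation.

(** * Functions of two real variables *)

Section PlaneFunctions.
Context {R : realType}.
Implicit Types (g G : R * R -> R) (p q : R * R).

Lemma is_derive_dir1 g (s y d : R) : is_derive (s, y) dir1 g d ->
  is_derive s 1 (fun r => g (r, y)) d.
Proof.
have E : (fun h : R => h^-1 *: ((g \o shift (s, y)) (h *: dir1) - g (s, y))) =
         (fun h : R => h^-1 *: (((fun r => g (r, y)) \o shift s) (h *: 1) - g (s, y))).
  apply/funext => h; congr (_ *: (g _ - _)); congr (_, _).
  by rewrite -[LHS]/(h * 0 + y) mulr0 add0r.
by case; rewrite /derivable /derive E => dg <-.
Qed.

Lemma is_derive_dir2 g (s y d : R) : is_derive (y, s) dir2 g d ->
  is_derive s 1 (fun r => g (y, r)) d.
Proof.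
have E : (fun h : R => h^-1 *: ((g \o shift (y, s)) (h *: dir2) - g (y, s))) =
         (fun h : R => h^-1 *: (((fun r => g (y, r)) \o shift s) (h *: 1) - g (y, s))).
  apply/funext => h; congr (_ *: (g _ - _)); congr (_, _).
  by rewrite -[LHS]/(h * 0 + y) mulr0 add0r.
by case; rewrite /derivable /derive E => dg <-.
Qed.

Lemma MVT_line (f f' : R -> R) (K a b : R) : `|a| <= K -> `|b| <= K ->
  (forall x : R, is_derive x 1 f (f' x)) ->
  exists c, [/\ `|c| <= K, `|c - a| <= `|b - a| & f b - f a = f' c * (b - a)].
Proof.
move=> aK bK df.
have cf : continuous f by move=> x; exact: is_derive_cont (df x).
have main (a' b' : R) : `|a'| <= K -> `|b'| <= K -> a' <= b' ->
    exists c, [/\ `|c| <= K, a' <= c <= b' & f b' - f a' = f' c * (b' - a')].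
  move=> aK' bK' ab; have [|c cab fE] := @MVT_segment _ f f' a' b' ab (fun x _ => df x).
    exact: continuous_subspaceT.
  move: cab; rewrite in_itv/= => /andP[c1 c2]; exists c; split=> //; last by rewrite c1.
  move: aK' bK'; rewrite !ler_norml => /andP[h1 h2] /andP[h3 h4].
  by rewrite (le_trans h1 c1) (le_trans c2 h4).
have [ab|ba] := leP a b.
- have [c [cK /andP[c1 c2] E]] := main a b aK bK ab; exists c; split=> //.
  by rewrite !ger0_norm ?subr_ge0// lerB.
- have [c [cK /andP[c1 c2] E]] := main b a bK aK (ltW ba); exists c; split=> //.
  + by rewrite distrC (distrC b) !ger0_norm ?subr_ge0 ?(ltW ba)//; lra.
  + by rewrite -opprB E; ring.
Qed.

Lemma continuous_bounded_box g (K : R) : continuous g ->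
  exists2 M : R, 0 <= M & forall p, `|p.1| <= K -> `|p.2| <= K -> `|g p| <= M.
Proof.
move=> cg; pose B := `[- K, K]%classic `*` `[- K, K]%classic : set (R * R).
have cB : compact B by apply: compact_setX; exact: segment_compact.
have /compact_bounded[M [_ hM]] : compact (g @` B).
  by apply: continuous_compact => //; exact: continuous_subspaceT.
exists (`|M| + 1) => [|p p1 p2]; first by rewrite addr_ge0.
apply: hM; first by rewrite (le_lt_trans (ler_norm M))// ltrDl.
by exists p => //; split; rewrite /= in_itv/= -ler_norml.
Qed.

(** One moves along two sides of a rectangle, which stay in the box. *)
Lemma grad_lip G (g1 g2 : R * R -> R) (K : R) :
  (forall p, is_derive p dir1 G (g1 p)) -> (forall p, is_derive p dir2 G (g2 p)) ->
  continuous g1 -> continuous g2 -> exists2 L : R, 0 <= L &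
  forall p q, `|p.1| <= K -> `|p.2| <= K -> `|q.1| <= K -> `|q.2| <= K ->
    `|G q - G p| <= L * (`|q.1 - p.1| + `|q.2 - p.2|).
Proof.
move=> D1 D2 c1 c2.
have [L1 L10 h1] := continuous_bounded_box K c1; have [L2 L20' h2] := continuous_bounded_box K c2.
exists (L1 + L2) => [|[p1 p2] [q1 q2] /= P1 P2 Q1 Q2]; first by rewrite addr_ge0.
have [c [cK _ E1]] := MVT_line P1 Q1 (fun x => is_derive_dir1 (D1 (x, q2))).
have [d [dK _ E2]] := MVT_line P2 Q2 (fun x => is_derive_dir2 (D2 (p1, x))).
have -> : G (q1, q2) - G (p1, p2) = g1 (c, q2) * (q1 - p1) + g2 (p1, d) * (q2 - p2).
  by rewrite -E1 -E2; ring.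
apply: le_trans (ler_normD _ _) _; rewrite !normrM.
have hc : `|g1 (c, q2)| <= L1 by exact: (h1 (c, q2)).
have hd : `|g2 (p1, d)| <= L2 by exact: (h2 (p1, d)).
have n1 := normr_ge0 (q1 - p1); have n2 := normr_ge0 (q2 - p2).
move: (`|g1 _|) (`|g2 _|) (`|q1 - p1|) (`|q2 - p2|) hc hd n1 n2 => A1 A2 x y *.
nra.
Qed.

Lemma smooth2_lip g (K : R) : smooth2 g -> exists2 L : R, 0 <= L &
  forall p q, `|p.1| <= K -> `|p.2| <= K -> `|q.1| <= K -> `|q.2| <= K ->
    `|g q - g p| <= L * (`|q.1 - p.1| + `|q.2 - p.2|).
Proof.
move=> sg; have [_ dg] := sg [::].
apply: (@grad_lip g ('D_dir1 g) ('D_dir2 g) K).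
- by move=> p; have [d _] := dg p; exact: DeriveDef d erefl.
- by move=> p; have [_ d] := dg p; exact: DeriveDef d erefl.
- by have [] := sg [:: true].
- by have [] := sg [:: false].
Qed.

(** Existence of the partial derivatives alone would not suffice; their continuity makes G locally
Lipschitz. *)
Lemma grad_continuous G (g1 g2 : R * R -> R) :
  (forall p, is_derive p dir1 G (g1 p)) -> (forall p, is_derive p dir2 G (g2 p)) ->
  continuous g1 -> continuous g2 -> continuous G.
Proof.
move=> D1 D2 c1 c2 p; pose K := `|p.1| + `|p.2| + 1.
have [L L0 hL] := grad_lip K D1 D2 c1 c2.
apply/cvgrPdist_le => e e0.
pose d := Num.min 1 (e / (2 * L + 1)).
have L1 : 0 < 2 * L + 1 by rewrite ltr_wpDl// mulr_ge0.
have d0 : 0 < d by rewrite lt_min ltr01 divr_gt0.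
have : nbhs p (ball p d) by exact: nbhsx_ballx.
apply: filterS => q [] /=; rewrite -!ball_normE/= => b1 b2.
have n1 := normr_ge0 p.1; have n2 := normr_ge0 p.2.
have hd1 : d <= 1 by rewrite /d ge_min lexx.
have hde : d <= e / (2 * L + 1) by rewrite /d ge_min lexx orbT.
have qK1 : `|q.1| <= K.
  have := ler_normB p.1 (p.1 - q.1); rewrite opprB addrC subrK => h.
  by apply: le_trans h _; rewrite /K; move: (`|p.1 - q.1|) b1 => x b1; lra.
have qK2 : `|q.2| <= K.
  have := ler_normB p.2 (p.2 - q.2); rewrite opprB addrC subrK => h.
  by apply: le_trans h _; rewrite /K; move: (`|p.2 - q.2|) b2 => x b2; lra.
rewrite distrC; apply: le_trans (hL p q _ _ qK1 qK2) _; [rewrite /K; lra..|].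
rewrite distrC (distrC q.2).
rewrite ler_pdivlMr// in hde.
by move: (`|p.1 - q.1|) (`|p.2 - q.2|) b1 b2 => x y b1 b2; nra.
Qed.

(** The increment is written with the mean value theorem along two sides of a rectangle, and the
gradient is Lipschitz on the box. *)
Lemma potential_taylor G g1 g2 (K : R) :
  (forall p, is_derive p dir1 G (g1 p)) -> (forall p, is_derive p dir2 G (g2 p)) ->
  smooth2 g1 -> smooth2 g2 -> exists2 L : R, 0 <= L &
  forall p q, `|p.1| <= K -> `|p.2| <= K -> `|q.1| <= K -> `|q.2| <= K ->
    `|G q - G p - (g1 p * (q.1 - p.1) + g2 p * (q.2 - p.2))| <=
      L * ((q.1 - p.1) ^+ 2 + (q.2 - p.2) ^+ 2).
Proof.
move=> D1 D2 s1 s2; have [L1 L10 h1] := smooth2_lip K s1; have [L2 L20' h2] := smooth2_lip K s2.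
exists (2 * (L1 + L2)) => [|[p1 p2] [q1 q2] /= P1 P2 Q1 Q2]; first by rewrite mulr_ge0// addr_ge0.
have [c [cK cp E1]] := MVT_line P1 Q1 (fun x => is_derive_dir1 (D1 (x, q2))).
have [d [dK dp E2]] := MVT_line P2 Q2 (fun x => is_derive_dir2 (D2 (p1, x))).
have -> : G (q1, q2) - G (p1, p2) - (g1 (p1, p2) * (q1 - p1) + g2 (p1, p2) * (q2 - p2)) =
    (g1 (c, q2) - g1 (p1, p2)) * (q1 - p1) + (g2 (p1, d) - g2 (p1, p2)) * (q2 - p2).
  by rewrite !mulrBl -E1 -E2; ring.
apply: le_trans (ler_normD _ _) _; rewrite !normrM.
have hc := h1 (p1, p2) (c, q2) P1 P2 cK Q2; have hd := h2 (p1, p2) (p1, d) P1 P2 P1 dK.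
rewrite /= subrr normr0 add0r in hc hd.
rewrite -[(q1 - p1) ^+ 2]real_normK ?num_real// -[(q2 - p2) ^+ 2]real_normK ?num_real//.
have n1 := normr_ge0 (q1 - p1); have n2 := normr_ge0 (q2 - p2).
have hc' : L1 * (`|c - p1| + `|q2 - p2|) <= L1 * (`|q1 - p1| + `|q2 - p2|) by rewrite ler_wpM2l// lerD2r.
have hd' : L2 * `|d - p2| <= L2 * `|q2 - p2| by rewrite ler_wpM2l.
have {}hc := le_trans hc hc'; have {}hd := le_trans hd hd'.
clear E1 E2 hc' hd' cp dp.
move: (`|g1 _ - _|) (`|g2 _ - _|) (`|q1 - p1|) (`|q2 - p2|) hc hd n1 n2 => A1 A2 x y hc hd n1 n2.
have k1 : A1 * x <= L1 * (x + y) * x by rewrite ler_wpM2r.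
have k2 : A2 * y <= L2 * y * y by rewrite ler_wpM2r.
have k3 : (x + y) * x <= 2 * (x ^+ 2 + y ^+ 2) by have := sqr_ge0 (x - y); have := sqr_ge0 y; have := sqr_ge0 x; nra.
have k4 : L1 * ((x + y) * x) <= L1 * (2 * (x ^+ 2 + y ^+ 2)) by rewrite ler_wpM2l.
have k5 : L2 * (y * y) <= L2 * (2 * (x ^+ 2 + y ^+ 2)) by rewrite ler_wpM2l//; have := sqr_ge0 x; have := sqr_ge0 y; nra.
nra.
Qed.

End PlaneFunctions.

Section Superposition.
Context {R : realType}.
Local Notation mu := (@lebesgue_measure R).
Implicit Types (g G : R * R -> R) (u v f h : R -> R).

Lemma cvg_plane g (T : Type) (F : set_system T) (FF : Filter F) (f h : T -> R) (a b : R) :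
  continuous g -> f x @[x --> F] --> a -> h x @[x --> F] --> b -> g (f x, h x) @[x --> F] --> g (a, b).
Proof.
move=> cg fa hb; apply: (@continuous2_cvg _ _ _ _ _ _ _ _ (fun x y => g (x, y))) fa hb.
rewrite (_ : (fun z => _) = g); first exact: cg.
by apply/funext => -[].
Qed.

Lemma continuous_section g (c : R) : continuous g -> continuous (fun r : R => g (c, r)).
Proof. by move=> cg y; apply: cvg_plane => //; exact: cvg_cst. Qed.

(** If u is replaced by floor ((n + 1) u) / (n + 1), the composition is measurable on each of countably
many measurable pieces, because u is constant there; then n tends to infinity. *)
Lemma measurable_superposition g u v : continuous g -> measurable_fun setT u -> measurable_fun setT v ->
  measurable_fun setT (fun x => g (u x, v x)).
Proof.
move=> cg mu' mv.
pose a n x : R := (Num.floor (n.+1%:R * u x))%:~R / n.+1%:R.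
have ca x : a n x @[n --> \oo] --> u x.
  apply: (@null_cvg _ _ _ (fun n => n.+1%:R^-1)); last exact: cvg_harmonic.
  move=> n; have n0 : 0 < n.+1%:R :> R by rewrite ltr0n.
  rewrite /a; have := floor_itv (n.+1%:R * u x) => /andP[h1 h2].
  rewrite [_ / _ - _](_ : _ = ((Num.floor (n.+1%:R * u x))%:~R - n.+1%:R * u x) / n.+1%:R); last first.
    by field; exact: lt0r_neq0.
  rewrite normrM [X in _ * X]gtr0_norm ?invr_gt0// -[leRHS]mul1r ler_pM2r ?invr_gt0//.
  rewrite intrD1 in h2; rewrite ler_norml.
  by set y := n.+1%:R * u x in h1 h2 *; apply/andP; split; lra.
apply: (@measurable_fun_cvg _ _ _ _ (fun n x => g (a n x, v x))).
- move=> n _ B mB; rewrite setTI.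
  pose F (z : int) := ((fun x => n.+1%:R * u x) @^-1` `[z%:~R, (z + 1)%:~R[%classic) `&`
    ((fun x => g (z%:~R / n.+1%:R, v x)) @^-1` B).
  rewrite (_ : _ @^-1` B = \bigcup_z F z).
    apply: countable_bigcupT_measurable => // z; apply: measurableI.
      rewrite -[X in measurable X]setTI.
      have mn : measurable_fun setT (fun x => n.+1%:R * u x) by exact: measurable_funM.
      by apply: mn => //; exact: measurable_itv.
    rewrite -[X in measurable X]setTI.
    have mg : measurable_fun setT (fun x => g (z%:~R / n.+1%:R, v x)).
      apply: (@measurableT_comp _ _ _ _ _ _ (fun y => g (z%:~R / n.+1%:R, y))) => //.
      by apply: continuous_measurable_fun; exact: continuous_section.
    exact: mg.
  apply/seteqP; split=> x /=.
    move=> hx; exists (Num.floor (n.+1%:R * u x)) => //; split=> //=.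
    by rewrite in_itv/=; exact: floor_itv.
  move=> [z _ [/=]]; rewrite in_itv/= => hz.
  by rewrite /a (floor_def hz).
- by move=> x _; apply: cvg_plane => //; exact: cvg_cst.
Qed.

End Superposition.

(** * The nonlinearity along a solution *)

Section AlmostEverywhere.
Context {R : realType}.
Local Notation mu := (@lebesgue_measure R).
Implicit Types (f h : R -> R).

Lemma intg_le_ae f h : measurable_fun setT f -> {ae mu, forall x, `|f x| <= h x} ->
  intg h -> intg f.
Proof.
move=> mf fh Ih; have mh := intg_meas Ih.
pose k x := clamp `|h x| (f x).
have mn : measurable_fun setT (fun x => `|h x|) by exact: measurableT_comp.
have mk : measurable_fun setT k.
  by apply: measurable_maxr; [exact: measurableT_comp|exact: measurable_minr].
have Ik : intg k.
  apply: intg_le (intg_norm Ih) => // x; exact: clamp_bound.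
apply: intg_ae Ik => //; apply: aeS fh => x fx.
by apply: clamp_id; exact: le_trans fx (ler_norm _).
Qed.

Lemma Rint_le_ae f h : intg f -> intg h -> {ae mu, forall x, f x <= h x} ->
  \int[mu]_x f x <= \int[mu]_x h x.
Proof.
move=> If Ih fh; rewrite -subr_ge0 -(RintB Ih If).
have I := intgB Ih If.
rewrite (@eq_ae_Rint _ _ (fun x => `|h x - f x|)); first exact: Rint_ge0.
- exact: intg_meas.
- by apply: measurableT_comp => //; exact: intg_meas.
- by apply: aeS fh => x fx; rewrite ger0_norm// subr_ge0.
Qed.

Lemma l2_le_ae f h : measurable_fun setT f -> {ae mu, forall x, `|f x| <= `|h x|} ->
  l2 h -> l2 f.
Proof.
move=> mf fh [mh Ih]; split=> //; apply: intg_le_ae Ih; first exact: measurable_funX.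
apply: aeS fh => x fx; rewrite ger0_norm ?sqr_ge0//.
by rewrite -[f x ^+ 2]real_normK ?num_real// -[h x ^+ 2]real_normK ?num_real// ler_pXn2r ?nnegrE.
Qed.

(** The constant would have an integral at least that over every interval. *)
Lemma intg_cst0 (c : R) : intg (fun=> c) -> c = 0.
Proof.
move=> Ic; apply/eqP; rewrite -normr_eq0 eq_le normr_ge0 andbT leNgt; apply/negP => c0.
set T := \int[mu]_x `|c|.
have T0 : 0 <= T by exact: Rint_ge0.
pose n := (Num.truncn (T / `|c|)).+1.
have hn : T < n%:R * `|c| by rewrite -ltr_pdivrMr//; exact: truncnS_gt.
have Ib : intg (\1_(box n) : R -> R) by apply: intg_indic; [exact: measurable_box|exact: mu_box].
have n0 : (0 : R) < n%:R by rewrite ltr0n.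
have E : \int[mu]_x (\1_(box n) x : R) = n%:R + n%:R.
  rewrite /Rintegral integral_indic; [|by []|exact: measurable_box].
  have muE : mu (@box R n) = (n%:R + n%:R)%:E.
    by rewrite /box lebesgue_measure_itv/= lte_fin ifT ?EFinB ?opprK//; exact: gtrN.
  by rewrite setIT [X in fine X]muE.
have : `|c| * (n%:R + n%:R) <= T.
  rewrite -E -(RintZ _ Ib); apply: Rint_le; [exact: intgZ|exact: intg_norm|].
  by move=> x; rewrite -[leRHS]mulr1 ler_wpM2l.
by rewrite mulrDr (mulrC `|c|) => h; have p := mulr_gt0 n0 c0; clearbody n; lra.
Qed.

End AlmostEverywhere.

Section SolutionCurves.
Context {R : realType}.
Local Notation mu := (@lebesgue_measure R).
Local Notation H := (@dot_semi_inner R).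
Implicit Types (u v : R -> R -> R) (g G : R * R -> R).

(** What the nonlinear estimates use of an H^s-differentiable curve: differentiability in L^2, and
boundedness and continuity in the uniform norm. *)
Record good_curve u u' : Prop := GoodCurve {
  gc_l2 : forall t, 0 <= t -> l2 (u t) ;
  gc_l2' : forall t, 0 <= t -> l2 (u' t) ;
  gc_diff : forall t, 0 <= t -> cdiff dot (fun r => rfun (u r)) (rfun (u' t)) t ;
  gc_bnd : forall t, 0 <= t -> exists2 M : R, 0 <= M & {ae mu, forall x, `|u t x| <= M} ;
  gc_unif : forall t, 0 <= t -> forall e : R, 0 < e -> exists2 d : R, 0 < d &
    forall r : R, 0 <= r -> `|r - t| < d -> {ae mu, forall x, `|u r x - u t x| <= e} }.

Lemma good_curve_box u1 u1' u2 u2' t : good_curve u1 u1' -> good_curve u2 u2' -> 0 <= t ->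
  exists K d : R, [/\ 0 <= K, 0 < d & forall r : R, 0 <= r -> `|r - t| < d ->
    {ae mu, forall x, `|u1 r x| <= K /\ `|u2 r x| <= K}].
Proof.
move=> c1 c2 t0; have [M1 M10 b1] := gc_bnd c1 t0; have [M2 M20 b2] := gc_bnd c2 t0.
have [d1 d10 h1] := gc_unif c1 t0 ltr01; have [d2 d20 h2] := gc_unif c2 t0 ltr01.
exists (M1 + M2 + 1), (Num.min d1 d2); split; [by rewrite !addr_ge0|by rewrite lt_min d10|].
move=> r r0; rewrite lt_min => /andP[r1 r2].
have k (w w' : R -> R) (M : R) : {ae mu, forall x, `|w x| <= M} -> {ae mu, forall x, `|w' x - w x| <= 1} ->
    {ae mu, forall x, `|w' x| <= M + 1}.
  by apply: aeS2 => x a b; rewrite -(subrK (w x) (w' x)) addrC (le_trans (ler_normD _ _))// lerD.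
by apply: aeS2 (k _ _ _ b1 (h1 r r0 r1)) (k _ _ _ b2 (h2 r r0 r2)) => x a b; split; lra.
Qed.

(** As g is Lipschitz on the box and vanishes at the origin, |g (u, v)| <= L (|u| + |v|). *)
Lemma superposition_l2 g (K : R) (u v : R -> R) : smooth2 g -> g (0, 0) = 0 -> 0 <= K ->
  l2 u -> l2 v -> {ae mu, forall x, `|u x| <= K /\ `|v x| <= K} ->
  l2 (fun x => g (u x, v x)) /\ exists2 M : R, 0 <= M & {ae mu, forall x, `|g (u x, v x)| <= M}.
Proof.
move=> sg g0 K0 lu lv hK; have [L L0 hL] := smooth2_lip K sg.
have [cg _] := sg [::].
have hb : {ae mu, forall x, `|g (u x, v x)| <= L * (`|u x| + `|v x|)}.
  apply: aeS hK => x [h1 h2]; have := hL (0, 0) (u x, v x).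
  by rewrite /= !normr0 g0 !subr0; exact.
have mg : measurable_fun setT (fun x => g (u x, v x)).
  by apply: measurable_superposition => //; [case: lu|case: lv].
have ln (w : R -> R) : l2 w -> l2 (fun x => `|w x|).
  move=> lw; apply: (l2_le _ _ lw) => [|x]; last by rewrite normr_id.
  by apply: measurableT_comp => //; case: lw.
split.
  apply: l2_le_ae (l2Z L (l2D (ln _ lu) (ln _ lv))) => //.
  by apply: aeS hb => x hx; rewrite [leRHS]ger0_norm// mulr_ge0// addr_ge0.
exists (L * (K + K)) => [|]; first by rewrite mulr_ge0// addr_ge0.
by apply: aeS2 hK hb => x [h1 h2] h3; apply: le_trans h3 _; rewrite ler_wpM2l// lerD.
Qed.

Lemma dot_rfunB (f h : R -> R) :
  dot (rfun f - rfun h) (rfun f - rfun h) = nsq (fun x => f x - h x).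
Proof.
by rewrite -scaleN1r rfun_lin dot_rfun; apply: eq_Rintegral => x _; rewrite mulN1r.
Qed.

Lemma sqr_nm_rfunB (f h : R -> R) : l2 f -> l2 h ->
  nm dot (rfun f - rfun h) ^+ 2 = nsq (fun x => f x - h x).
Proof.
by move=> lf lh; rewrite (sqr_nm H) ?dot_rfunB//; apply: (carB H); exact: pl2_rfun.
Qed.

Lemma nsq_le_lin (f a b : R -> R) (L : R) : l2 f -> l2 a -> l2 b ->
  {ae mu, forall x, `|f x| <= L * (`|a x| + `|b x|)} ->
  nsq f <= 2 * L ^+ 2 * (nsq a + nsq b).
Proof.
move=> lf la lb hf; have I := intgD la.2 lb.2.
rewrite -(RintD la.2 lb.2) -(RintZ _ I); apply: Rint_le_ae; [exact: lf.2|exact: intgZ|].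
apply: aeS hf => x hx; rewrite -[f x ^+ 2]real_normK ?num_real//.
rewrite -[a x ^+ 2]real_normK ?num_real// -[b x ^+ 2]real_normK ?num_real//.
have h1 : `|f x| ^+ 2 <= (L * (`|a x| + `|b x|)) ^+ 2.
  by rewrite ler_pXn2r ?nnegrE//; exact: le_trans hx.
apply: le_trans h1 _; move: (`|a x|) (`|b x|) => p q.
rewrite -subr_ge0 (_ : _ - _ = L ^+ 2 * (p - q) ^+ 2); last by ring.
by rewrite mulr_ge0 ?sqr_ge0.
Qed.

Lemma superposition_ccont g u1 u1' u2 u2' t : smooth2 g -> g (0, 0) = 0 ->
  good_curve u1 u1' -> good_curve u2 u2' -> 0 <= t ->
  ccont dot (fun r => rfun (fun x => g (u1 r x, u2 r x))) t.
Proof.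
move=> sg g0 c1 c2 t0 e e0.
have [K [d [K0 d0 hK]]] := good_curve_box c1 c2 t0.
have [L L0 hL] := smooth2_lip K sg.
have L1 : 0 < 2 * L + 1 by rewrite ltr_wpDl// mulr_ge0.
have eta0 : 0 < e / (2 * L + 1) by rewrite divr_gt0.
have cc u u' : good_curve u u' -> ccont dot (fun r => rfun (u r)) t.
  move=> c; apply: (cdiff_cont H t0 _ _ (gc_diff c t0)).
  - by move=> r /(gc_l2 c)/pl2_rfun.
  - by apply: pl2_rfun; exact: gc_l2' c _ t0.
have [d1 d10 h1] := cc _ _ c1 _ eta0; have [d2 d20 h2] := cc _ _ c2 _ eta0.
exists (Num.min d (Num.min d1 d2)) => [|r r0]; first by rewrite !lt_min d0 d10.
rewrite !lt_min => /and3P[rd rd1 rd2].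
have {}h1 := h1 r r0 rd1; have {}h2 := h2 r r0 rd2.
have hr := hK r r0 rd.
have ht : {ae mu, forall x, `|u1 t x| <= K /\ `|u2 t x| <= K} by apply: hK; rewrite ?subrr ?normr0.
have lu1r := gc_l2 c1 r0; have lu2r := gc_l2 c2 r0.
have lu1t := gc_l2 c1 t0; have lu2t := gc_l2 c2 t0.
have [lr _] := superposition_l2 sg g0 K0 lu1r lu2r hr.
have [lt _] := superposition_l2 sg g0 K0 lu1t lu2t ht.
have hb : {ae mu, forall x, `|g (u1 r x, u2 r x) - g (u1 t x, u2 t x)| <=
    L * (`|u1 r x - u1 t x| + `|u2 r x - u2 t x|)}.
  by apply: aeS2 hr ht => x [a1 a2] [b1 b2]; exact: (hL (_, _) (_, _)).
have lB := l2B lr lt.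
have := nsq_le_lin lB (l2B lu1r lu1t) (l2B lu2r lu2t) hb.
rewrite -!sqr_nm_rfunB// => hle.
rewrite -(@ler_pXn2r _ 2)// ?nnegrE ?nm_ge0 ?(ltW e0)//.
apply: le_trans hle _.
have n1 := nm_ge0 dot (rfun (u1 r) - rfun (u1 t)); have n2 := nm_ge0 dot (rfun (u2 r) - rfun (u2 t)).
rewrite ler_pdivlMr// in h1; rewrite ler_pdivlMr// in h2.
move: (nm _ _) (nm _ _) n1 n2 h1 h2 => x y x0 y0 h1 h2.
have k (z : R) : 0 <= z -> z * (2 * L + 1) <= e -> (2 * L * z) ^+ 2 <= e ^+ 2.
  move=> z0 hz; rewrite ler_pXn2r ?nnegrE ?mulr_ge0 ?(ltW e0)//; apply: le_trans hz; nra.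
have := k _ x0 h1; have := k _ y0 h2; nra.
Qed.

(** As the gradient of G and G itself vanish at the origin, |G (u, v)| <= L (u^2 + v^2). *)
Lemma potential_intg G g1 g2 (K : R) (u v : R -> R) :
  (forall p, is_derive p dir1 G (g1 p)) -> (forall p, is_derive p dir2 G (g2 p)) ->
  smooth2 g1 -> smooth2 g2 -> g1 (0, 0) = 0 -> g2 (0, 0) = 0 -> G (0, 0) = 0 ->
  0 <= K -> l2 u -> l2 v -> {ae mu, forall x, `|u x| <= K /\ `|v x| <= K} ->
  intg (fun x => energy_density G (u x, v x)).
Proof.
move=> D1 D2 s1 s2 g10 g20 G0 K0 lu lv hK.
have [L L0 hL] := potential_taylor K D1 D2 s1 s2.
have [cg1 _] := s1 [::]; have [cg2 _] := s2 [::].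
have cG := grad_continuous D1 D2 cg1 cg2.
have [m1 _] := lu; have [m2 _] := lv.
apply: intg_le_ae (intgZ (2^-1 + L) (intgD lu.2 lv.2)) => //.
  apply: measurable_funD; last exact: measurable_superposition.
  by apply: measurable_funM => //; apply: measurable_funD; exact: measurable_funX.
apply: aeS hK => x [h1 h2]; have := hL (0, 0) (u x, v x).
rewrite /= !normr0 g10 g20 G0 !subr0 !mul0r addr0 subr0 => /(_ K0 K0 h1 h2) h.
rewrite /energy_density/= mulrDl; apply: le_trans (ler_normD _ _) _.
by apply: lerD h; rewrite ger0_norm// mulr_ge0// addr_ge0 ?sqr_ge0.
Qed.

(** Pointwise, the second order Taylor remainder of the density is bounded by the square of the
increments, whose integral is O(|r - t|^2). In the linear part, the increments are replaced by
(r - t) times the derivatives of the curves, at a cost o(|r - t|) in L^2. *)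
Lemma potential_rdiff G g1 g2 u1 u1' u2 u2' t :
  (forall p, is_derive p dir1 G (g1 p)) -> (forall p, is_derive p dir2 G (g2 p)) ->
  smooth2 g1 -> smooth2 g2 -> g1 (0, 0) = 0 -> g2 (0, 0) = 0 -> G (0, 0) = 0 ->
  good_curve u1 u1' -> good_curve u2 u2' -> 0 <= t ->
  rdiff (fun r => \int[mu]_x energy_density G (u1 r x, u2 r x))
    (\int[mu]_x ((u1 t x + g1 (u1 t x, u2 t x)) * u1' t x) +
     \int[mu]_x ((u2 t x + g2 (u1 t x, u2 t x)) * u2' t x)) t.
Proof.
move=> D1 D2 s1 s2 g10 g20 G0 c1 c2 t0.
have [K [d [K0 d0 hK]]] := good_curve_box c1 c2 t0.
have [L L0 hL] := potential_taylor K D1 D2 s1 s2.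
have [cg1 _] := s1 [::]; have [cg2 _] := s2 [::].
have cG := grad_continuous D1 D2 cg1 cg2.
pose P r x := energy_density G (u1 r x, u2 r x).
have IP r : 0 <= r -> `|r - t| < d -> intg (P r).
  by move=> r0 rd; apply: (potential_intg D1 D2 s1 s2 g10 g20 G0 K0 (gc_l2 c1 r0) (gc_l2 c2 r0)); exact: hK.
have ht : {ae mu, forall x, `|u1 t x| <= K /\ `|u2 t x| <= K} by apply: hK; rewrite ?subrr ?normr0.
have lu1t := gc_l2 c1 t0; have lu2t := gc_l2 c2 t0.
have lu1' := gc_l2' c1 t0; have lu2' := gc_l2' c2 t0.
have [lg1 _] := superposition_l2 s1 g10 K0 lu1t lu2t ht.
have [lg2 _] := superposition_l2 s2 g20 K0 lu1t lu2t ht.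
set f1 := fun x => u1 t x + g1 (u1 t x, u2 t x).
set f2 := fun x => u2 t x + g2 (u1 t x, u2 t x).
have lf1 : l2 f1 by exact: l2D.
have lf2 : l2 f2 by exact: l2D.
set F1 := nm dot (rfun f1); set F2 := nm dot (rfun f2).
set N1 := nm dot (rfun (u1' t)); set N2 := nm dot (rfun (u2' t)).
have F10 : 0 <= F1 by exact: nm_ge0.
have F20 : 0 <= F2 by exact: nm_ge0.
have N10 : 0 <= N1 by exact: nm_ge0.
have N20 : 0 <= N2 by exact: nm_ge0.
set C := 2^-1 + L; have C0 : 0 <= C by rewrite addr_ge0.
set D := C * ((1 + N1) ^+ 2 + (1 + N2) ^+ 2).
have DD0 : 0 <= D by rewrite mulr_ge0// addr_ge0 ?sqr_ge0.
move=> e e0.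
pose eta := Num.min 1 (e / (2 * (F1 + F2) + 1)).
have FF : 0 < 2 * (F1 + F2) + 1 by rewrite ltr_wpDl// mulr_ge0// addr_ge0.
have eta0 : 0 < eta by rewrite lt_min ltr01 divr_gt0.
have eta1 : eta <= 1 by rewrite /eta ge_min lexx.
have etae : eta * (2 * (F1 + F2) + 1) <= e by rewrite -ler_pdivlMr// /eta ge_min lexx orbT.
have [d1 d10 h1] := gc_diff c1 t0 eta0; have [d2 d20 h2] := gc_diff c2 t0 eta0.
have DDD : 0 < 2 * D + 1 by rewrite ltr_wpDl// mulr_ge0.
exists (Num.min (Num.min d (e / (2 * D + 1))) (Num.min d1 d2)) => [|r r0].
  by rewrite !lt_min d0 d10 d20 divr_gt0.
rewrite !lt_min => /andP[/andP[rd re] /andP[rd1 rd2]].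
have {}h1 := h1 r r0 rd1; have {}h2 := h2 r r0 rd2.
have hr := hK r r0 rd.
have lu1r := gc_l2 c1 r0; have lu2r := gc_l2 c2 r0.
have Ir := IP r r0 rd; have It : intg (P t) by apply: IP; rewrite ?subrr ?normr0.
pose w1 x := u1 r x - u1 t x - (r - t) * u1' t x.
pose w2 x := u2 r x - u2 t x - (r - t) * u2' t x.
have lw1 : l2 w1 by apply: l2B; [exact: l2B|exact: l2Z].
have lw2 : l2 w2 by apply: l2B; [exact: l2B|exact: l2Z].
have Ifu1 := l2M lf1 lu1'; have Ifu2 := l2M lf2 lu2'.
have Ifw1 := l2M lf1 lw1; have Ifw2 := l2M lf2 lw2.
pose T x := P r x - P t x - (f1 x * (u1 r x - u1 t x) + f2 x * (u2 r x - u2 t x)).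
have l1 := l2B lu1r lu1t; have l2' := l2B lu2r lu2t.
have IT : intg T by apply: intgB; [exact: intgB|apply: intgD; exact: l2M].
have E : \int[mu]_x P r x - \int[mu]_x P t x - (r - t) * (\int[mu]_x (f1 x * u1' t x) + \int[mu]_x (f2 x * u2' t x))
   = \int[mu]_x T x + (\int[mu]_x (f1 x * w1 x) + \int[mu]_x (f2 x * w2 x)).
  rewrite -(RintD Ifw1 Ifw2) -(RintD IT (intgD Ifw1 Ifw2)) -(RintD Ifu1 Ifu2).
  rewrite -(RintZ (r - t) (intgD Ifu1 Ifu2)) -(RintB Ir It) -(RintB (intgB Ir It) (intgZ _ (intgD Ifu1 Ifu2))).
  by apply: eq_Rintegral => x _; rewrite /T /w1 /w2; ring.
rewrite E.
have bT : `|\int[mu]_x T x| <= C * (nsq (fun x => u1 r x - u1 t x) + nsq (fun x => u2 r x - u2 t x)).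
  apply: le_trans (le_normr_Rintegral measurableT IT) _.
  rewrite -(RintD l1.2 l2'.2) -(RintZ C (intgD l1.2 l2'.2)).
  apply: Rint_le_ae; [exact: intg_norm|exact/intgZ/(intgD l1.2 l2'.2)|].
  apply: aeS2 hr ht => x [a1 a2] [b1 b2].
  have := hL (u1 t x, u2 t x) (u1 r x, u2 r x) b1 b2 a1 a2; rewrite /= => h.
  rewrite /T /P /energy_density/= /f1 /f2.
  rewrite (_ : _ - _ = 2^-1 * ((u1 r x - u1 t x) ^+ 2 + (u2 r x - u2 t x) ^+ 2) +
    (G (u1 r x, u2 r x) - G (u1 t x, u2 t x) - (g1 (u1 t x, u2 t x) * (u1 r x - u1 t x) +
       g2 (u1 t x, u2 t x) * (u2 r x - u2 t x)))); last by field.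
  rewrite /C mulrDl; apply: le_trans (ler_normD _ _) _; apply: lerD h.
  by rewrite ger0_norm// mulr_ge0// addr_ge0 ?sqr_ge0.
have bw f w : l2 f -> l2 w -> `|\int[mu]_x (f x * w x)| <= nm dot (rfun f) * nm dot (rfun w).
  by move=> lf lw; rewrite -dot_rfun; apply: (cauchy_schwarz H); exact: pl2_rfun.
have nw u u' : l2 (u r) -> l2 (u t) -> l2 (u' t) ->
   rfun (fun x => u r x - u t x - (r - t) * u' t x) = rfun (u r) - rfun (u t) - (r - t) *: rfun (u' t).
  move=> _ _ _; rewrite -[in RHS]scaleN1r rfun_lin -scaleNr rfun_lin; congr rfun.
  by apply/funext => x; rewrite mulN1r mulNr.
have B1 := bw _ _ lf1 lw1; have B2 := bw _ _ lf2 lw2.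
rewrite /w1 nw// in B1; rewrite /w2 nw// in B2.
have an u u' (N : R) : l2 (u r) -> l2 (u t) -> l2 (u' t) -> N = nm dot (rfun (u' t)) ->
    nm dot (rfun (u r) - rfun (u t) - (r - t) *: rfun (u' t)) <= eta * `|r - t| ->
    nsq (fun x => u r x - u t x) <= (1 + N) ^+ 2 * `|r - t| ^+ 2.
  move=> lr lt lt' NE hb; rewrite -sqr_nm_rfunB// -exprMn.
  have N0 : 0 <= N by rewrite NE nm_ge0.
  rewrite ler_pXn2r ?nnegrE ?nm_ge0 ?mulr_ge0 ?addr_ge0//.
  rewrite -[X in nm _ X](subrK ((r - t) *: rfun (u' t))).
  apply: le_trans (nmD H _ _) _.
  - apply: (carB H); last by apply: (carZ H); exact: pl2_rfun.
    by apply: (carB H); exact: pl2_rfun.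
  - by apply: (carZ H); exact: pl2_rfun.
  rewrite (nmZ H); last exact: pl2_rfun.
  rewrite -NE mulrDl mul1r; apply: lerD; last by rewrite mulrC.
  by apply: le_trans hb _; rewrite -[leRHS]mul1r ler_wpM2r.
have A1 := an _ _ N1 lu1r lu1t lu1' erefl h1; have A2 := an _ _ N2 lu2r lu2t lu2' erefl h2.
have bT' : `|\int[mu]_x T x| <= D * `|r - t| ^+ 2.
  apply: le_trans bT _; rewrite /D -mulrA ler_wpM2l// mulrDl; exact: lerD.
have B1' : `|\int[mu]_x (f1 x * w1 x)| <= F1 * (eta * `|r - t|).
  exact: le_trans B1 (ler_wpM2l F10 h1).
have B2' : `|\int[mu]_x (f2 x * w2 x)| <= F2 * (eta * `|r - t|).
  exact: le_trans B2 (ler_wpM2l F20 h2).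
apply: le_trans (ler_normD _ _) _.
apply: le_trans (lerD bT' (le_trans (ler_normD _ _) (lerD B1' B2'))) _.
rewrite ltr_pdivlMr// in re.
have q0 := normr_ge0 (r - t).
clear - DD0 e0 eta0 etae re q0 F10 F20.
rewrite (_ : _ + _ = (D * `|r - t| + (F1 + F2) * eta) * `|r - t|); last by ring.
rewrite ler_wpM2r//; move: (`|r - t|) re q0 => q re q0.
have : 2 * (D * q) <= e by nra.
have : 2 * ((F1 + F2) * eta) <= e by nra.
by move: (D * q) (_ * eta) => a b; lra.
Qed.

End SolutionCurves.

(** * Unbounded Fourier multipliers *)

Section IsolatedZeros.
Context {R : realType}.
Local Notation mu := (@lebesgue_measure R).

(** Each point of Z is the only one in some interval with rational endpoints, which makes Z
countable. *)
Lemma isolated_null (Z : R -> Prop) :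
  (forall x, Z x -> \forall y \near x^', ~ Z y) -> {ae mu, forall x, ~ Z x}.
Proof.
move=> hZ.
have sep x : Z x -> exists pq : rat * rat, [/\ ratr pq.1 < x, x < ratr pq.2 &
    forall y, ratr pq.1 < y -> y < ratr pq.2 -> Z y -> y = x].
  move=> /hZ; rewrite /dnbhs/= => /nbhs_ballP[e /= e0 he].
  have [p /= ] := @rat_in_itvoo R (x - e) x ltac:(by rewrite ltrBlDr ltrDl).
  rewrite in_itv/= => /andP[p1 p2].
  have [q /= ] := @rat_in_itvoo R x (x + e) ltac:(by rewrite ltrDl).
  rewrite in_itv/= => /andP[q1 q2].
  exists (p, q); split=> //= y y1 y2 Zy; apply/eqP/negPn/negP => yx.
  apply: (he y) => //=; rewrite -ball_normE/= ltr_norml; apply/andP; split; lra.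
pose f x : nat := pickle (xget (0, 0) [set pq : rat * rat | [/\ ratr pq.1 < x, x < ratr pq.2 &
    forall y, ratr pq.1 < y -> y < ratr pq.2 -> Z y -> y = x]]).
have cZ : countable [set x | Z x].
  apply/countable_injP; exists f => x y; rewrite !inE/= => Zx Zy.
  move=> /(pcan_inj pickleK) E.
  have [h1 h2 h3] := xgetPex (0, 0) (sep x Zx); have [k1 k2 k3] := xgetPex (0, 0) (sep y Zy).
  by rewrite -E in k1 k2 k3; rewrite (h3 y).
exists [set x | Z x]; split.
- exact: countable_measurable.
- exact: countable_lebesgue_measure0.
- by move=> x /= /contrapT.
Qed.

End IsolatedZeros.

Section Weights.
Context {R : realType}.
Local Notation mu := (@lebesgue_measure R).
Local Notation H := (@dot_semi_inner R).
Implicit Types (p q : @pfun R) (m : R -> R).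

Lemma mulp_lin m p q (a : R) : mulp m (p + a *: q) = mulp m p + a *: mulp m q.
Proof.
congr (_, _); apply/funext => x.
- by rewrite -[RHS]/(m x * p.1 x + a * (m x * q.1 x)) -[LHS]/(m x * (p.1 x + a * q.1 x)); ring.
- by rewrite -[RHS]/(m x * p.2 x + a * (m x * q.2 x)) -[LHS]/(m x * (p.2 x + a * q.2 x)); ring.
Qed.

Lemma mulpB m p q : mulp m (p - q) = mulp m p - mulp m q.
Proof. by rewrite -scaleN1r mulp_lin scaleN1r. Qed.

Lemma mulpZ m p (a : R) : mulp m (a *: p) = a *: mulp m p.
Proof.
congr (_, _); apply/funext => x.
- by rewrite -[LHS]/(m x * (a * p.1 x)) -[RHS]/(a * (m x * p.1 x)); ring.
- by rewrite -[LHS]/(m x * (a * p.2 x)) -[RHS]/(a * (m x * p.2 x)); ring.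
Qed.

Lemma mulp_comb m p q r (a : R) :
  mulp m (p - q - a *: r) = mulp m p - mulp m q - a *: mulp m r.
Proof. by rewrite mulpB mulpB mulpZ. Qed.

Lemma dot_mulp_le m m' p : pl2 (mulp m p) -> pl2 (mulp m' p) -> (forall x, `|m x| <= `|m' x|) ->
  dot (mulp m p) (mulp m p) <= dot (mulp m' p) (mulp m' p).
Proof.
move=> [l1 l2'] [k1 k2] mm; rewrite !dot_nsq.
have h (f : R -> R) x : (m x * f x) ^+ 2 <= (m' x * f x) ^+ 2.
  by rewrite !exprMn ler_wpM2r ?sqr_ge0// -real_normK ?num_real// -[leRHS]real_normK ?num_real//
    ler_pXn2r ?nnegrE.
apply: lerD; apply: Rint_le.
- exact: l1.2.
- exact: k1.2.
- exact: h.
- exact: l2'.2.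
- exact: k2.2.
- exact: h.
Qed.

Lemma nm_mulp_le m (M : R) p : measurable_fun setT m -> 0 <= M -> (forall x, `|m x| <= M) -> pl2 p ->
  nm dot (mulp m p) <= M * nm dot p.
Proof.
move=> mm M0 mM lp; have lmp := pl2_mulp mm mM lp.
have MM (x : R) : `|cst M x| <= M by rewrite ger0_norm.
have lMp := pl2_mulp (@measurable_cst _ _ _ _ setT M) MM lp.
have E : mulp (fun=> M) p = M *: p by congr (_, _); apply/funext.
have -> : M * nm dot p = nm dot (mulp (fun=> M) p) by rewrite E (nmZ H)// ger0_norm.
by apply/ler_wsqrtr/dot_mulp_le => // x; rewrite [leRHS]ger0_norm.
Qed.

Lemma pae_mulp m p q : pae p q -> pae (mulp m p) (mulp m q).
Proof. by move=> [a1 a2]; split; [apply: aeS a1|apply: aeS a2] => x /= ->. Qed.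

Definition wtrunc m (n : nat) (x : R) : R := if m x <= n%:R then m x else 0.

Section Weight.
Variable m : R -> R.
Hypotheses (mm : measurable_fun setT m) (m0 : forall x, 0 <= m x).

Let mt n : measurable_fun setT (wtrunc m n).
Proof.
apply: measurable_fun_ifT; [|exact: mm|exact: measurable_cst].
by apply: measurable_fun_ler => //; exact: measurable_cst.
Qed.

Let wt_bound n x : `|wtrunc m n x| <= n%:R.
Proof. by rewrite /wtrunc; case: ifP => [h|_]; rewrite ?normr0// ger0_norm. Qed.

Let wt_le n x : `|wtrunc m n x| <= `|m x|.
Proof. by rewrite /wtrunc; case: ifP => // _; rewrite normr0. Qed.

Let wt_cvg (f : R -> R) x : (wtrunc m n x * f x) ^+ 2 @[n --> \oo] --> (m x * f x) ^+ 2.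
Proof.
apply: cvg_near_cst; exists (Num.truncn (m x)).+1 => // n /= hn; rewrite /wtrunc ifT//.
by apply: ltW; apply: (lt_le_trans (truncnS_gt _)); rewrite ler_nat.
Qed.

Lemma pl2_wtrunc n p : pl2 p -> pl2 (mulp (wtrunc m n) p).
Proof. exact: pl2_mulp (mt n) (wt_bound n). Qed.

(** The squares of the truncated products converge pointwise. *)
Lemma weight_fatou p (B : R) : pl2 p ->
  (forall n, dot (mulp (wtrunc m n) p) (mulp (wtrunc m n) p) <= B) ->
  pl2 (mulp m p) /\ dot (mulp m p) (mulp m p) <= B.
Proof.
move=> lp hB.
have [m1 _] := lp.1; have [m2 _] := lp.2.
have h n : intg (fun x => (wtrunc m n x * p.1 x) ^+ 2 + (wtrunc m n x * p.2 x) ^+ 2).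
  by have [[_ i1] [_ i2]] := pl2_wtrunc n lp; exact: intgD.
have [I IB] : intg (fun x => (m x * p.1 x) ^+ 2 + (m x * p.2 x) ^+ 2) /\
    \int[mu]_x ((m x * p.1 x) ^+ 2 + (m x * p.2 x) ^+ 2) <= B.
apply: (@Rfatou _ (fun n x => (wtrunc m n x * p.1 x) ^+ 2 + (wtrunc m n x * p.2 x) ^+ 2)) => //.
- by move=> n x; rewrite addr_ge0 ?sqr_ge0.
- by apply: measurable_funD; apply: measurable_funX; exact: measurable_funM.
- by move=> x; rewrite addr_ge0 ?sqr_ge0.
- by apply: aeW => x; apply: cvgD; exact: wt_cvg.
- move=> n; have [[_ i1] [_ i2]] := pl2_wtrunc n lp.
  by have := hB n; rewrite dot_nsq -(RintD i1 i2).
have l : pl2 (mulp m p).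
  split; split; try exact: measurable_funM.
  - by apply: intg_le I => [|x]; [apply: measurable_funX; exact: measurable_funM|rewrite ger0_norm ?sqr_ge0// lerDl sqr_ge0].
  - by apply: intg_le I => [|x]; [apply: measurable_funX; exact: measurable_funM|rewrite ger0_norm ?sqr_ge0// lerDr sqr_ge0].
by split=> //; rewrite dot_nsq -(RintD l.1.2 l.2.2).
Qed.

(** A truncated weight acts as a bounded operator and hence preserves differentiability of curves,
so the mean value inequality applies; its bound does not depend on the truncation, which is
then removed by weight_fatou. *)
Let weight_mean (c c' : R -> @pfun R) (a b B : R) : 0 <= a -> 0 <= b -> 0 <= B ->
  (forall r, 0 <= r -> pl2 (c r)) -> (forall r, 0 <= r -> pl2 (c' r)) ->
  (forall t, 0 <= t -> cdiff dot c (c' t) t) ->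
  (forall t, 0 <= t -> pl2 (mulp m (c' t))) ->
  (forall t, Num.min a b <= t <= Num.max a b -> nm dot (mulp m (c' t) - mulp m (c' a)) <= B) ->
  pl2 (mulp m (c b - c a - (b - a) *: c' a)) /\
  nm dot (mulp m (c b - c a - (b - a) *: c' a)) <= B * `|b - a|.
Proof.
move=> a0 b0 B0 lc lc' dc lmc' hB.
have min0 : 0 <= Num.min a b by rewrite le_min a0.
have lz : pl2 (c b - c a - (b - a) *: c' a).
  by apply: (carB H); [apply: (carB H); exact: lc|apply: (carZ H); exact: lc'].
have hn n : dot (mulp (wtrunc m n) (c b - c a - (b - a) *: c' a))
    (mulp (wtrunc m n) (c b - c a - (b - a) *: c' a)) <= (B * `|b - a|) ^+ 2.
  have lw := pl2_wtrunc n lz.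
  rewrite -(sqr_nm H)// ler_pXn2r ?nnegrE ?nm_ge0 ?mulr_ge0// mulp_comb.
  apply: (@cdiff_mean_value _ _ _ _ H (fun r => mulp (wtrunc m n) (c r)) (fun r => mulp (wtrunc m n) (c' r))) => //.
  - by move=> r r0; apply: pl2_wtrunc; exact: lc.
  - by move=> r r0; apply: pl2_wtrunc; exact: lc'.
  - by apply: pl2_wtrunc; exact: lc'.
  - move=> t t0 e e0; have n1 : (0 : R) < n%:R + 1 by rewrite ltr_wpDl.
    have [d d0 hd] := dc t t0 _ (divr_gt0 e0 n1); exists d => // r r0 rd.
    rewrite -mulp_comb; have lr : pl2 (c r - c t - (r - t) *: c' t).
      by apply: (carB H); [apply: (carB H); exact: lc|apply: (carZ H); exact: lc'].
    apply: le_trans (nm_mulp_le (mt n) (ler0n _ n) (wt_bound n) lr) _.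
    have := hd r r0 rd; rewrite mulrAC ler_pdivlMr// => h.
    apply: le_trans h; rewrite mulrC ler_wpM2l ?nm_ge0// lerDl.
    exact: ler01.
  - move=> t tab; apply: le_trans (hB t tab); have t0 : 0 <= t by case/andP: tab => /(le_trans min0).
    have ld : pl2 (c' t - c' a) by apply: (carB H); exact: lc'.
    rewrite -!mulpB; apply/ler_wsqrtr/dot_mulp_le => //; first exact: pl2_wtrunc.
    by rewrite mulpB; apply: (carB H); exact: lmc'.
have [l1 l2'] := weight_fatou lz hn; split=> //.
have B1 : 0 <= B * `|b - a| by rewrite mulr_ge0.
by rewrite -(@ler_pXn2r _ 2)// ?nnegrE ?nm_ge0// (sqr_nm H).
Qed.

(** An unbounded weight may destroy differentiability. It does not if the derivative is a
continuous curve in the weighted space: then weight_mean puts the increments of c into the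
weighted space, and estimates their Taylor remainders in its norm. *)
Lemma weight_curve (c c' : R -> @pfun R) :
  (forall r, 0 <= r -> pl2 (c r)) -> (forall r, 0 <= r -> pl2 (c' r)) ->
  (forall t, 0 <= t -> cdiff dot c (c' t) t) ->
  (forall t, 0 <= t -> pl2 (mulp m (c' t))) ->
  (forall t, 0 <= t -> ccont dot (fun r => mulp m (c' r)) t) ->
  pl2 (mulp m (c 0)) ->
  forall t, 0 <= t -> pl2 (mulp m (c t)) /\ cdiff dot (fun r => mulp m (c r)) (mulp m (c' t)) t.
Proof.
move=> lc lc' dc lmc' cmc' l0.
have lm t : 0 <= t -> pl2 (mulp m (c t)).
  move=> t0; have lw0 := lmc' 0 (lexx 0).
  have cn r : 0 <= r -> rcont (fun r => nm dot (mulp m (c' r) - mulp m (c' 0))) r.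
    move=> r0 e e0; have [d d0 hd] := cmc' r r0 e e0; exists d => // r' r0' rd.
    apply: le_trans (nmB_le H _ _) _; [by apply: (carB H) => //; exact: lmc'..|].
    rewrite opprB addrA subrK; exact: hd.
  have [|B hB] := rcont_bounded (lexx 0) t0 (f := fun r => nm dot (mulp m (c' r) - mulp m (c' 0))).
    by move=> r /andP[r0 _]; exact: cn.
  have B0 : 0 <= B by apply: le_trans (nm_ge0 _ _) (hB 0 _); rewrite lexx.
  have [|h _] := weight_mean (lexx 0) t0 B0 lc lc' dc lmc'.
    by move=> r; rewrite min_l// max_r//; exact: hB.
  have -> : mulp m (c t) = mulp m (c t - c 0 - (t - 0) *: c' 0) + mulp m (c 0) + (t - 0) *: mulp m (c' 0).
    by rewrite mulp_comb addrAC !subrK.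
  by apply: (carD H); [exact: (carD H)|exact: (carZ H)].
move=> t t0; split; first exact: lm.
move=> e e0; have [d d0 hd] := cmc' t t0 e e0; exists d => // r r0 rd.
rewrite -mulp_comb; have [|_ ] := weight_mean t0 r0 (ltW e0) lc lc' dc lmc'; last by [].
move=> s /andP[s1 s2]; apply: hd.
  by apply: le_trans s1; rewrite le_min t0.
apply: le_lt_trans rd; rewrite ler_norml.
have [tr|rt] := leP t r.
- rewrite min_l// in s1; rewrite max_r// in s2; rewrite ger0_norm ?subr_ge0//.
  by apply/andP; split; lra.
- rewrite (min_r (ltW rt)) in s1; rewrite (max_l (ltW rt)) in s2; rewrite ltr0_norm ?subr_lt0//.
  by apply/andP; split; lra.
Qed.

End Weight.

End Weights.

(** * One component of a global solution *)

Section Kernel.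
Context {R : realType}.
Local Notation mu := (@lebesgue_measure R).
Implicit Types (beta w : R -> R).

Lemma Re_scale (a : R) (z : R[i]) : complex.Re (a%:C * z) = a * complex.Re z.
Proof. by case: z => x y /=; rewrite mul0r subr0. Qed.

Lemma Im_scale (a : R) (z : R[i]) : complex.Im (a%:C * z) = a * complex.Im z.
Proof. by case: z => x y /=; rewrite mul0r addr0. Qed.

Lemma Re_fourierL1 w xi : complex.Re (fourierL1 w xi) = Fc w xi.
Proof.
by rewrite /fourierL1/= /Fc; apply: eq_Rintegral => x _ /=; rewrite mulr0 subr0 cosN mulrC.
Qed.

Lemma Im_fourierL1 w xi : intg w -> complex.Im (fourierL1 w xi) = - Fs w xi.
Proof.
move=> Iw; rewrite /fourierL1/= /Fs -mulN1r -(RintZ _ (intg_sin xi Iw)).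
by apply: eq_Rintegral => x _ /=; rewrite mulr0 add0r sinN; ring.
Qed.

(** The decay of order r >= 2 absorbs the factor xi^2 of the second derivative, and the zeros of the
transform form a null set because they are isolated. *)
Lemma kernel_facts (r : R) beta : 2 <= r -> kernel_hyp r beta ->
  [/\ intg beta, forall xi, Fs beta xi = 0, forall xi, 0 <= Fc beta xi,
   exists2 C : R, 0 < C & forall xi, xi ^+ 2 * Fc beta xi <= C &
   {ae mu, forall xi, Fc beta xi != 0}].
Proof.
move=> r2 [Ib [C [C0 hC]] hz].
have S xi : Fs beta xi = 0.
  have /andP[+ _] := hC xi; rewrite lecE => /andP[/eqP h _].
  by move: h; rewrite Im_fourierL1// => /eqP; rewrite oppr_eq0 => /eqP.
have P xi : 0 <= Fc beta xi.
  by have /andP[+ _] := hC xi; rewrite lecE Re_fourierL1 => /andP[].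
have U xi : Fc beta xi <= C * (1 + xi ^+ 2) `^ (- (r / 2)).
  by have /andP[_ +] := hC xi; rewrite lecE Re_fourierL1 => /andP[].
split=> //.
- exists C => // xi; have x0 := sqr_ge0 xi.
  have h1 : (1 + xi ^+ 2) `^ (- (r / 2)) <= (1 + xi ^+ 2)^-1.
    rewrite -[leRHS]powR_inv1; last by rewrite addr_ge0.
    by rewrite ler_powR ?lerDl// lerNl opprK; lra.
  have h2 : xi ^+ 2 * (1 + xi ^+ 2)^-1 <= 1.
    by rewrite ler_pdivrMr ?ltr_pwDl// mul1r lerDr.
  apply: le_trans (ler_wpM2l x0 (U xi)) _; rewrite mulrCA -[leRHS]mulr1 ler_wpM2l ?(ltW C0)//.
  by apply: le_trans h2; rewrite ler_wpM2l.
- have E xi : (fourierL1 beta xi = 0) <-> (Fc beta xi = 0).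
    have := Re_fourierL1 beta xi; have := Im_fourierL1 xi Ib; rewrite S oppr0.
    case: (fourierL1 beta xi) => a c /= -> ->.
    by split=> [[]|->].
  have := @isolated_null R (fun xi => Fc beta xi = 0).
  move=> h; apply: aeS (h _) => [xi /eqP//|xi /E /hz].
  by apply: filterS => y /eqP yn /E.
Qed.

(** The symbol |xi|^-1 b^(xi)^(-1/2) of the operator P, where b^ is the transform of beta. *)
Definition psym beta (xi : R) : R := `|xi|^-1 * (Fc beta xi) `^ (- 2^-1).

Lemma psym_ge0 beta xi : 0 <= psym beta xi.
Proof. by rewrite mulr_ge0 ?powR_ge0. Qed.

Lemma measurable_psym beta : intg beta -> measurable_fun setT (psym beta).
Proof.
move=> Ib; apply: measurable_funM.
- rewrite (_ : (fun x => _) = (fun x => `|x| `^ (-1))); last first.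
    by apply/funext => x; rewrite powR_inv1.
  apply: (measurableT_comp (measurable_powR _)).
  by apply: continuous_measurable_fun; exact: norm_continuous.
- by apply: (measurableT_comp (measurable_powR _)); exact: measurable_Fc.
Qed.

(** Almost everywhere this is |xi| b^(xi)^(1/2), the inverse of the symbol of P. It is written
as the symbol of P times xi^2 b^, the form in which it arises from the equation. *)
Definition qsym beta (xi : R) : R := psym beta xi * (xi ^+ 2 * Fc beta xi).

Lemma psym_sqr beta xi : 0 < Fc beta xi -> xi != 0 -> psym beta xi ^+ 2 * (xi ^+ 2 * Fc beta xi) = 1.
Proof.
move=> b0 x0; rewrite /psym exprMn expr2 -[(_ `^ _) ^+ 2]powR_mulrn ?powR_ge0// -powRrM.
rewrite (_ : - 2^-1 * 2%:R = -1); last by field.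
rewrite powR_inv1 ?ltW//.
rewrite (_ : xi ^+ 2 = `|xi| ^+ 2); last by rewrite real_normK ?num_real.
by field; rewrite normr_eq0 x0 lt0r_neq0.
Qed.

(** The square of qsym is xi^2 b^ wherever this does not vanish, and q^2 <= C implies
q <= C + 1. *)
Lemma qsym_bound beta (C xi : R) : 0 < C -> 0 <= Fc beta xi -> xi ^+ 2 * Fc beta xi <= C ->
  `|qsym beta xi| <= C + 1.
Proof.
move=> C0 b0 bC; have w0 : 0 <= xi ^+ 2 * Fc beta xi by rewrite mulr_ge0 ?sqr_ge0.
rewrite /qsym ger0_norm; last by rewrite mulr_ge0 ?psym_ge0.
have [->|b1] := eqVneq (Fc beta xi) 0; first by rewrite !mulr0 addr_ge0// ltW.
have [->|x0] := eqVneq xi 0; first by rewrite expr0n/= mul0r mulr0 addr_ge0// ltW.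
have {}b0 : 0 < Fc beta xi by rewrite lt_neqAle eq_sym b1.
have := psym_sqr b0 x0; have p0 := psym_ge0 beta xi.
move: (psym _ _) (xi ^+ 2 * _) w0 bC p0 => p w w0 wC p0 e.
have : (p * w) ^+ 2 = w by rewrite exprMn [w ^+ 2]expr2 mulrA e mul1r.
move: (p * w) (mulr_ge0 p0 w0) => q q0 qw; nra.
Qed.

Lemma measurable_qsym beta : intg beta -> measurable_fun setT (qsym beta).
Proof.
move=> Ib; apply: measurable_funM; first exact: measurable_psym.
by apply: measurable_funM; [exact: measurable_funX|exact: measurable_Fc].
Qed.

Lemma psym_qsym beta : (forall xi, 0 <= Fc beta xi) -> {ae mu, forall xi, Fc beta xi != 0} ->
  {ae mu, forall xi, qsym beta xi * psym beta xi = 1}.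
Proof.
move=> b0 bn; have x0 : {ae mu, forall x : R, x <> 0}.
  apply: (@isolated_null R (fun x => x = 0)) => x ->.
  by apply: filterS (nbhs_dnbhs_neq 0) => y /eqP.
apply: aeS2 bn x0 => xi b1 /eqP x1.
have b2 : 0 < Fc beta xi by rewrite lt_neqAle eq_sym b1 b0.
by rewrite /qsym mulrAC -expr2 psym_sqr.
Qed.

Lemma c2p_P_transform beta w : c2p (P_transform beta w) = mulp (psym beta) (hat w).
Proof.
by congr (_, _); apply/funext => xi; rewrite /P_transform Re_fourierL1 ?Re_scale ?Im_scale.
Qed.

End Kernel.

Section Component.
Context {R : realType}.
Local Notation mu := (@lebesgue_measure R).
Local Notation H := (@dot_semi_inner R).
Local Notation I0 := (@time_interval R +oo%E).

Lemma nm_ae (p q : @pfun R) : pl2 p -> pl2 q -> pae p q -> nm dot p = nm dot q.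
Proof. by move=> lp lq pq; congr Num.sqrt; exact: dot_ae. Qed.

Lemma mulpN (m : R -> R) (p : @pfun R) : mulp m (- p) = - mulp m p.
Proof. by congr (_, _); apply/funext => x; exact: mulrN. Qed.

Lemma mulp_mulp (m w : R -> R) (p : @pfun R) : mulp m (mulp w p) = mulp (fun x => m x * w x) p.
Proof. by congr (_, _); apply/funext => x; exact: mulrA. Qed.

Lemma pi2V_ge0 : 0 <= (2 * pi : R)^-1.
Proof. by rewrite invr_ge0 ltW// pi2_gt0. Qed.

Lemma sqr_EFin_sqrt (a : R) : 0 <= a -> ((Num.sqrt a)%:E ^+ 2 = a%:E)%E.
Proof. by move=> a0; rewrite -EFin_expe sqr_sqrtr. Qed.

Lemma cdiff_ae (c : R -> @pfun R) (x y : @pfun R) t : 0 <= t -> (forall r, 0 <= r -> pl2 (c r)) ->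
  pl2 x -> pl2 y -> pae x y -> cdiff dot c x t -> cdiff dot c y t.
Proof.
move=> t0 lc lx ly xy hc e e0; have [d d0 hd] := hc e e0; exists d => // r r0 rd.
have L z : pl2 z -> pl2 (c r - c t - (r - t) *: z).
  by move=> lz; apply: (carB H); [apply: (carB H); exact: lc|exact: (carZ H)].
rewrite -(@nm_ae (c r - c t - (r - t) *: x)); [exact: hd|exact: L..|].
rewrite -!scaleNr; apply: pae_lin => //; exact: pae_refl.
Qed.

Lemma hat_ae (f g : R -> R) : l2 f -> l2 g -> ae_eq_fun f g -> pae (hat f) (hat g).
Proof.
rewrite /ae_eq_fun => lf lg fg; apply: subr_ae0; apply: dot_eq0_ae.
  by apply: (carB H); exact: pl2_hat.
rewrite pl2_hatB// (_ : nsq _ = 0) ?mulr0//.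
rewrite /nsq (@eq_ae_Rint _ _ (fun=> 0)) ?/Rintegral ?integral0//.
- by apply: measurable_funX; case: (l2B lf lg).
- by apply: aeS fg => x ->; rewrite subrr expr0n.
Qed.

Lemma ccont_mulp_hat (w : R -> R) (M : R) (f : R -> R -> R) t : 0 <= t -> measurable_fun setT w ->
  0 < M -> (forall x, `|w x| <= M) -> (forall r, 0 <= r -> l2 (f r)) ->
  ccont dot (fun r => rfun (f r)) t -> ccont dot (fun r => mulp w (hat (f r))) t.
Proof.
move=> t0 mw M0 wM lf hf e e0.
have s0 : 0 < Num.sqrt (2 * pi : R) by rewrite sqrtr_gt0; exact: pi2_gt0.
have [d d0 hd] := hf _ (divr_gt0 e0 (mulr_gt0 M0 s0)); exists d => // r r0 rd.
have lr := lf r r0; have lt := lf t t0.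
have lB : pl2 (hat (f r) - hat (f t)) by apply: (carB H); exact: pl2_hat.
rewrite -mulpB; apply: le_trans (nm_mulp_le mw (ltW M0) wM lB) _.
have E : nm dot (hat (f r) - hat (f t)) = Num.sqrt (2 * pi) * nm dot (rfun (f r) - rfun (f t)).
  by rewrite /nm pl2_hatB// dot_rfunB sqrtrM// ltW// pi2_gt0.
rewrite E mulrA; have := hd r r0 rd; rewrite ler_pdivlMr ?mulr_gt0// => h.
by apply: le_trans h; rewrite mulrC.
Qed.

Variables (s rr : R) (beta : R -> R).
Hypotheses (hs : 2^-1 < s) (hr : 2 <= rr) (hb : kernel_hyp rr beta).
Variables (u u1 u2 f : R -> R -> R) (phi psi : R -> R).
Hypothesis hC : C2_Hs s I0 u u1 u2.
Hypotheses (lf : forall t, 0 <= t -> l2 (f t))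
  (fb : forall t, 0 <= t -> exists2 M : R, 0 <= M & {ae mu, forall x, `|f t x| <= M})
  (fc : forall t, 0 <= t -> ccont dot (fun r => rfun (f r)) t)
  (heq : forall t, 0 < t -> weak_dxx (convolution beta (f t)) (u2 t))
  (hphi : inHs s phi) (hpsi : inHs s psi)
  (u0 : ae_eq_fun (u 0) phi) (u10 : ae_eq_fun (u1 0) psi)
  (Pphi : P_inL2 beta phi) (Ppsi : P_inL2 beta psi).

Let It t : 0 <= t -> I0 t. Proof. by move=> t0; split=> //; exact: ltry. Qed.

Let lu t : 0 <= t -> l2 (u t).
Proof. by move=> /It t0; case: hC => /(_ t t0)[/inHs_l2]. Qed.
Let lu1 t : 0 <= t -> l2 (u1 t).
Proof. by move=> /It t0; case: hC => /(_ t t0)[_ /inHs_l2]. Qed.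
Let lu2 t : 0 <= t -> l2 (u2 t).
Proof. by move=> /It t0; case: hC => /(_ t t0)[_ _ /inHs_l2]. Qed.

Local Notation m := (psym beta).
Local Notation k := (qsym beta).
Local Notation W := (fun xi : R => xi ^+ 2 * Fc beta xi).

Let kf := kernel_facts hr hb.
Let Ib : intg beta. Proof. by case: kf. Qed.
Let mW : measurable_fun setT W.
Proof. by apply: measurable_funM; [exact: measurable_funX|exact: measurable_Fc]. Qed.
Let WC : exists2 C : R, 0 < C & forall xi, `|W xi| <= C.
Proof.
have [_ _ b0 [C C0 hCC] _] := kf; exists C => // xi.
by rewrite ger0_norm// mulr_ge0 ?sqr_ge0.
Qed.
Let kC : exists2 C : R, 0 < C & forall xi, `|k xi| <= C.
Proof.
have [_ _ b0 [C C0 hCC] _] := kf; exists (C + 1) => [|xi]; first by rewrite addr_gt0.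
exact: qsym_bound.
Qed.

(** At positive times this is eq_fourier; at time 0, where the equation is not assumed, it follows by
continuity of both sides. *)
Let equation t : 0 <= t -> pae (hat (u2 t)) (- mulp W (hat (f t))).
Proof.
have [C C0 hCC] := WC; have [_ S _ _ _] := kf.
pose D r := hat (u2 r) + mulp W (hat (f r)).
have lD r : 0 <= r -> pl2 (D r).
  move=> r0; apply: (carD H); first exact/pl2_hat/lu2.
  by apply: pl2_mulp mW hCC _; exact/pl2_hat/lf.
have pos r : 0 < r -> pae (D r) 0.
  move=> r0; have [M M0 fM] := fb (ltW r0).
  have [_ _ ht] := heq r0.
  by apply: (@eq_fourier _ beta (f r) (u2 r) C M) => //; [exact/lf/ltW|exact/lu2/ltW].
suff DD : 0 <= t -> pae (D t) 0.
  by move=> /DD h; apply: subr_ae0; rewrite opprK.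
rewrite le_eqVlt => /orP[/eqP <-|/pos//].
apply: dot_eq0_ae; first exact: lD.
have c1 : ccont dot (fun r => hat (u2 r)) 0.
  by apply: (@hat_ccont _ s) => //; case: hC.
have c2 : ccont dot (fun r => mulp W (hat (f r))) 0.
  by apply: ccont_mulp_hat hCC _ _ => //; exact: fc.
rewrite -(sqr_nm H); last exact: lD.
suff -> : nm dot (D 0) = 0 by rewrite expr0n.
apply/eqP; rewrite eq_le nm_ge0 andbT; apply/ler_addgt0Pr => e e0; rewrite add0r.
have e2 : 0 < e / 2 by rewrite divr_gt0.
have [d1 d10 h1] := c1 _ e2; have [d2 d20 h2] := c2 _ e2.
pose r := Num.min d1 d2 / 2.
have m0 : 0 < Num.min d1 d2 by rewrite lt_min d10.
have r0 : 0 < r by rewrite divr_gt0.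
have rd : r < Num.min d1 d2 by rewrite /r ltr_pdivrMr// ltr_pMr// ltr1n.
have rn : `|r - 0| < Num.min d1 d2 by rewrite subr0 gtr0_norm.
move: rn; rewrite lt_min => /andP[rn1 rn2].
have {}h1 := h1 r (ltW r0) rn1; have {}h2 := h2 r (ltW r0) rn2.
have lr := lD r (ltW r0); have l0 := lD 0 (lexx 0).
have Dr0 : nm dot (D r) = 0.
  have lz : pl2 (0 : @pfun R) := pl2_rfun (@l2_0 R).
  rewrite (nm_ae lr lz (pos r r0)) -(scale0r (0 : @pfun R)) (nmZ H)// normr0 mul0r//.
have -> : D 0 = D r - (D r - D 0) by rewrite subKr.
apply: le_trans (nmD H lr _) _; first by apply: (carN H); exact: (carB H).
rewrite Dr0 add0r (nmN H); last exact: (carB H).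
rewrite /D opprD addrACA; apply: le_trans (nmD H _ _) _.
- by apply: (carB H); [exact/pl2_hat/lu2/ltW|exact/pl2_hat/lu2].
- by apply: (carB H); apply: pl2_mulp mW hCC _; [exact/pl2_hat/lf/ltW|exact/pl2_hat/lf].
- by have := lerD h1 h2; rewrite -splitr.
Qed.

(** The curves of P u, P u_t and P u_tt in Fourier variables; the equation is used to write the
last one with the bounded weight qsym. *)
Definition Uc t := mulp m (hat (u t)).
Definition Vc t := mulp m (hat (u1 t)).
Definition Ac t := - mulp k (hat (f t)).

Lemma pl2_init (v w : R -> R) : l2 v -> l2 w -> ae_eq_fun v w -> P_inL2 beta w ->
  pl2 (mulp m (hat v)) /\ dot (mulp m (hat v)) (mulp m (hat v)) = dot (mulp m (hat w)) (mulp m (hat w)).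
Proof.
move=> lv lw vw /inL2P; rewrite c2p_P_transform => lp.
have lhv := pl2_hat lv; have mm := measurable_psym Ib.
have vw' := pae_mulp m (hat_ae lv lw vw).
have wv' := pae_sym vw'.
have l : pl2 (mulp m (hat v)).
  split; [apply: l2_ae wv'.1 lp.1|apply: l2_ae wv'.2 lp.2]; apply: measurable_funM => //.
  - by case: lhv => -[].
  - by case: lhv => _ [].
split; [exact: l|exact: (dot_ae l l lp lp vw' vw')].
Qed.

(** The curve Ac is continuous because its weight qsym is bounded. So weight_curve
applies first to u_t, whose weighted derivative is Ac, and then to u, whose weighted derivative is
Vc; the hypotheses on the initial values start both. *)
Lemma component_curves t : 0 <= t ->
  [/\ pl2 (Uc t), pl2 (Vc t), pl2 (Ac t), cdiff dot Uc (Vc t) t & cdiff dot Vc (Ac t) t].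
Proof.
move=> t0; have [C C0 hCC] := WC; have [K K0 hK] := kC.
have mm := measurable_psym Ib; have mk := measurable_qsym Ib.
have lA r : 0 <= r -> pl2 (Ac r).
  by move=> r0; apply: (carN H); apply: pl2_mulp mk hK _; exact/pl2_hat/lf.
have cA r : 0 <= r -> ccont dot Ac r.
  move=> r0 e e0; have [d d0 hd] := ccont_mulp_hat r0 mk K0 hK lf (fc r0) e0.
  exists d => // r' r0' rd; rewrite /Ac -opprD (nmN H); first exact: hd.
  by apply: (carB H); apply: pl2_mulp mk hK _; exact/pl2_hat/lf.
pose c' r := - mulp W (hat (f r)).
have lc' r : 0 <= r -> pl2 (c' r).
  by move=> r0; apply: (carN H); apply: pl2_mulp mW hCC _; exact/pl2_hat/lf.
have mc' r : mulp m (c' r) = Ac r.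
  by rewrite /c' mulpN mulp_mulp.
have hd1 : Hs_derivative s I0 u u1 by case: hC.
have hd2 : Hs_derivative s I0 u1 u2 by case: hC.
have V r : 0 <= r -> pl2 (Vc r) /\ cdiff dot Vc (Ac r) r.
  move=> r0; rewrite -mc'; apply: (weight_curve mm (psym_ge0 beta) _ lc') => //.
  - by move=> r' r0'; exact/pl2_hat/lu1.
  - move=> r' r0'; apply: cdiff_ae (equation r0') (hat_cdiff hs r0' lu1 (lu2 r0') hd2) => //.
    + by move=> ? ?; exact/pl2_hat/lu1.
    + exact/pl2_hat/lu2.
    + exact: lc'.
  - by move=> r' r0'; rewrite mc'; exact: lA.
  - move=> r' r0' e e0; have [d d0 hd] := cA r' r0' e e0; exists d => // r'' r0'' rd.
    have key p q : p = Ac r'' -> q = Ac r' -> nm dot (p - q) <= e by move=> -> ->; exact: hd.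
    exact: (key _ _ (mc' r'') (mc' r')).
  - by have [] := pl2_init (lu1 (lexx 0)) (inHs_l2 hpsi) u10 Ppsi.
have U : pl2 (Uc t) /\ cdiff dot Uc (Vc t) t.
  apply: (@weight_curve _ m mm (psym_ge0 beta) (fun r => hat (u r)) (fun r => hat (u1 r))) => //.
  - by move=> r r0; exact/pl2_hat/lu.
  - by move=> r r0; exact/pl2_hat/lu1.
  - by move=> r r0; apply: (hat_cdiff hs r0 lu (lu1 r0) hd1).
  - by move=> r r0; case: (V r r0).
  - move=> r r0; have [lV dV] := V r r0.
    by apply: (cdiff_cont H r0 _ (lA r r0) dV) => r' /V[].
  - by have [] := pl2_init (lu (lexx 0)) (inHs_l2 hphi) u0 Pphi.
by have [] := V t t0; case: U; split=> //; exact: lA.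
Qed.

(** The weights psym and qsym are inverse to each other almost everywhere and cancel in the product;
Parseval's identity does the rest. *)
Let dot_A t (v : R -> R) : 0 <= t -> l2 v -> pl2 (mulp m (hat v)) ->
  dot (mulp m (hat v)) (Ac t) = - (2 * pi * \int[mu]_x (v x * f t x)).
Proof.
move=> t0 lv lmv; have [K K0 hK] := kC; have mk := measurable_qsym Ib.
have lft := lf t0; have lk : pl2 (mulp k (hat (f t))) by apply: pl2_mulp mk hK _; exact: pl2_hat.
rewrite /Ac -scaleN1r (dotZr H)// mulN1r; congr (- _).
rewrite -dot_mulp -hat_parseval//.
have [_ _ b0 _ bn] := kf; have e := psym_qsym b0 bn.
apply: dot_ae; [exact: pl2_mulp mk hK _|exact: pl2_hat..| |exact: pae_refl].
by split; apply: aeS e => xi e; rewrite /= mulrA e mul1r.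
Qed.

Lemma dot_V_A t : 0 <= t -> dot (Vc t) (Ac t) = - (2 * pi * \int[mu]_x (u1 t x * f t x)).
Proof.
by move=> t0; have [_ lV _ _ _] := component_curves t0; apply: dot_A => //; exact: lu1.
Qed.

Lemma dot_U_A t : 0 <= t -> dot (Uc t) (Ac t) = - (2 * pi * \int[mu]_x (u t x * f t x)).
Proof.
by move=> t0; have [lU _ _ _ _] := component_curves t0; apply: dot_A => //; exact: lu.
Qed.

Lemma initial_norm : (L2norm (P_op beta psi) ^+ 2 = ((2 * pi)^-1 * dot (Vc 0) (Vc 0))%:E)%E.
Proof.
have [lV E] := pl2_init (lu1 (lexx 0)) (inHs_l2 hpsi) u10 Ppsi.
have /inL2P/ifourierL2_norm := Ppsi; rewrite c2p_P_transform => h.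
have E2 : L2norm (P_op beta psi) = (Num.sqrt ((2 * pi)^-1 * dot (Vc 0) (Vc 0)))%:E.
  have E' : dot (Vc 0) (Vc 0) = dot (mulp m (hat psi)) (mulp m (hat psi)) := E.
  by rewrite E'.
have V0 : 0 <= dot (Vc 0) (Vc 0) := dot_ge0 H lV.
have X0 : 0 <= (2 * pi)^-1 * dot (Vc 0) (Vc 0) := mulr_ge0 pi2V_ge0 V0.
exact: etrans (congr1 (fun x => x ^+ 2)%E E2) (sqr_EFin_sqrt X0).
Qed.

End Component.

(** * Concavity and blow-up *)

Section Concavity.
Context {R : realType}.

(** In the application P is the squared norm of the solution in the norm of the operators P_i, N that of
its time derivative, C their inner product, Phi the potential energy and N + 2 Phi the conserved
energy, with value - b < 0. For K t = P t + b (t + t0)^2 the Cauchy-Schwarz inequality and the bound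
on S give K K'' >= (1 + nu) K'^2. Hence K / K' has derivative at most - nu, and it cannot
stay positive for all times. *)
Lemma levine (P C N S Phi : R -> R) (nu : R) : 0 < nu ->
  (forall t, 0 <= t -> 0 <= P t) -> (forall t, 0 <= t -> 0 <= N t) ->
  (forall t, 0 <= t -> C t ^+ 2 <= P t * N t) ->
  (forall t, 0 <= t -> rdiff P (2 * C t) t) ->
  (forall t, 0 <= t -> rdiff C (N t - S t) t) ->
  (forall t, 0 <= t -> rdiff (fun r => N r + 2 * Phi r) 0 t) ->
  (forall t, 0 <= t -> S t <= 2 * (1 + 2 * nu) * Phi t) ->
  N 0 + 2 * Phi 0 < 0 -> False.
Proof.
move=> nu0 P0 N0 CPN dP dC dE SPhi E0.
pose b := - (N 0 + 2 * Phi 0); have b0 : 0 < b by rewrite oppr_gt0.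
have Econst t : 0 <= t -> N t + 2 * Phi t = - b.
  rewrite le_eqVlt => /orP[/eqP <-|t0]; first by rewrite opprK.
  have [c _ /eqP] := @rdiff_MVT R (fun r => N r + 2 * Phi r) (fun=> 0) 0 t (lexx 0) t0
    (fun s h => dE s (proj1 (andP h))).
  by rewrite mul0r subr_eq0 /b opprK => /eqP.
(* Large enough for K1 0 = 2 C 0 + 2 b t0 > 0. *)
pose t0 := `|C 0| / b + 1.
have t00 : 0 < t0 by rewrite ltr_wpDl// divr_ge0// ltW.
pose K t := P t + b * (t + t0) ^+ 2.
pose K1 t := 2 * C t + 2 * b * (t + t0).
pose K2 t := 2 * (N t - S t) + 2 * b.
have K0 t : 0 <= t -> 0 < K t.
  by move=> h; rewrite /K ltr_wpDl ?P0// mulr_gt0// exprn_gt0// ltr_wpDl.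
have dK t : 0 <= t -> rdiff K (K1 t) t.
  by move=> h; exact: rdiffD (dP t h) (rdiff_quad b t0 t).
have dK1 t : 0 <= t -> rdiff K1 (K2 t) t.
  by move=> h; exact: rdiffD (rdiffZ 2 (dC t h)) (rdiff_lin (2 * b) t0 t).
have K2ge t : 0 <= t -> 4 * (1 + nu) * (N t + b) <= K2 t.
  move=> h; have e := Econst t h; have s := SPhi t h; rewrite /K2.
  have e' : Phi t = - (N t + b) / 2 by lra.
  by rewrite e' in s; move: (N t) (S t) s => n q s; nra.
have K2pos t : 0 <= t -> 0 < K2 t.
  move=> h; apply: lt_le_trans (K2ge t h); apply: mulr_gt0; first by rewrite mulr_gt0// addr_gt0.
  by rewrite ltr_wpDl// N0.
have K1pos t : 0 <= t -> 0 < K1 t.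
  have K10 : 0 < K1 0.
    rewrite /K1 add0r /t0 mulrDr mulr1.
    have -> : 2 * b * (`|C 0| / b) = 2 * `|C 0| by rewrite mulrCA -mulrA mulfV ?mulr1 1?mulrC// lt0r_neq0.
    have := ler_norm (- C 0); rewrite normrN => h; lra.
  rewrite le_eqVlt => /orP[/eqP <-//|tp].
  have [c /andP[c0 _] e] := rdiff_MVT (lexx 0) tp (fun s h => dK1 s (proj1 (andP h))).
  rewrite subr0 in e; have := mulr_gt0 (K2pos c (ltW c0)) tp; rewrite -e; lra.
(* Cauchy-Schwarz for (P, C, N), augmented by the nonnegative form (b w^2, b w, b) with w = t + t0. *)
have KK t : 0 <= t -> (1 + nu) * K1 t ^+ 2 <= K t * K2 t.
  move=> h; have n0 := N0 t h; have p0 := P0 t h; have cs := CPN t h.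
  have tt : 0 < t + t0 by rewrite ltr_wpDl.
  apply: le_trans (ler_wpM2l (ltW (K0 t h)) (K2ge t h)).
  rewrite /K1 /K; move: (t + t0) tt (P t) (N t) (C t) n0 p0 cs => w w0 p n c n0 p0 cs.
  have k1 : 2 * c * w <= p + w ^+ 2 * n.
    have q0 : 0 <= p + w ^+ 2 * n by rewrite addr_ge0// mulr_ge0// sqr_ge0.
    apply: le_trans (ler_norm _) _; rewrite -(@ler_pXn2r _ 2)// ?nnegrE//.
    rewrite real_normK ?num_real//.
    have -> : (2 * c * w) ^+ 2 = 4 * w ^+ 2 * c ^+ 2 by ring.
    have : 4 * w ^+ 2 * c ^+ 2 <= 4 * w ^+ 2 * (p * n) by rewrite ler_wpM2l// mulr_ge0// sqr_ge0.
    move=> /le_trans; apply; rewrite -subr_ge0 (_ : _ - _ = (p - w ^+ 2 * n) ^+ 2) ?sqr_ge0//; ring.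
  have k2 : (c + b * w) ^+ 2 <= (p + b * w ^+ 2) * (n + b).
    have : b * (2 * c * w) <= b * (p + w ^+ 2 * n) by rewrite ler_wpM2l// ltW.
    rewrite sqrrD; nra.
  have -> : (1 + nu) * (2 * c + 2 * b * w) ^+ 2 = (4 * (1 + nu)) * (c + b * w) ^+ 2 by ring.
  have -> : (p + b * w ^+ 2) * (4 * (1 + nu) * (n + b)) = (4 * (1 + nu)) * ((p + b * w ^+ 2) * (n + b)) by ring.
  by rewrite ler_wpM2l// mulr_ge0// addr_ge0// ltW.
pose z t := K t * (K1 t)^-1.
have dz (t : R) : 0 < t -> is_derive t 1 z (1 - K t * K2 t / K1 t ^+ 2).
  move=> tp; have h := ltW tp; have k1 := K1pos t h.
  have d1 := rdiff_is_derive tp (dK t h); have d2 := rdiff_is_derive tp (dK1 t h).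
  have d3 := @is_deriveV R K1 t (K2 t) 1 (lt0r_neq0 k1) d2.
  apply: is_derive_eq (is_deriveMf d1 d3) _; rewrite /GRing.scale/=; field; exact: lt0r_neq0.
have z0 t : 0 <= t -> 0 < z t by move=> h; rewrite mulr_gt0 ?K0// invr_gt0 K1pos.
(* At rate - nu, z would have reached 0 at time T. The start is at 1 because derivatives
   are two-sided only at positive times. *)
pose T := 1 + z 1 / nu.
have T1 : 1 < T by rewrite ltrDl divr_gt0// z0.
have [||c cT e] := @MVT_segment R z (fun t => 1 - K t * K2 t / K1 t ^+ 2) 1 T (ltW T1).
- by move=> x; rewrite in_itv/= => /andP[x1 _]; apply: dz; exact: lt_trans x1.
- apply/subspace_continuousP => x /=; rewrite in_itv/= => /andP[x1 _].
  by apply: cvg_within_filter; apply: is_derive_cont (dz x _); exact: lt_le_trans x1.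
have cp : 0 < c by move: cT; rewrite in_itv/= => /andP[c1 _]; exact: lt_le_trans c1.
have k1 := K1pos c (ltW cp).
have hc : 1 - K c * K2 c / K1 c ^+ 2 <= - nu.
  have := KK c (ltW cp); rewrite -ler_pdivlMr ?exprn_gt0//; lra.
have zT := z0 T (ltW (lt_trans ltr01 T1)).
have Tn : nu * (T - 1) = z 1 by rewrite /T [1 + _]addrC addrK mulrC divfK// lt0r_neq0.
have : z T - z 1 <= - nu * (T - 1) by rewrite e ler_wpM2r// subr_ge0 ltW.
rewrite mulNr Tn; lra.
Qed.

End Concavity.

Section GlobalSolutions.
Context {R : realType}.
Local Notation mu := (@lebesgue_measure R).
Local Notation H := (@dot_semi_inner R).
Local Notation I0 := (@time_interval R +oo%E).

Lemma good_curve_C2 (s : R) (u u1 u2 : R -> R -> R) : 2^-1 < s -> C2_Hs s I0 u u1 u2 ->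
  good_curve u u1.
Proof.
move=> hs [hin d1 _ _].
have It t : 0 <= t -> I0 t by move=> t0; split=> //; exact: ltry.
have Hu t : 0 <= t -> inHs s (u t) by move=> /It /hin[].
have Hu1 t : 0 <= t -> inHs s (u1 t) by move=> /It /hin[].
have lu t : 0 <= t -> l2 (u t) by move=> /Hu/inHs_l2.
have lu1 t : 0 <= t -> l2 (u1 t) by move=> /Hu1/inHs_l2.
split=> //.
- by move=> t t0; exact: (rfun_cdiff hs t0 lu (lu1 t t0) d1).
- by move=> t t0; exact: Hs_bounded hs (Hu t t0).
- by move=> t t0; exact: (Hs_unif_cont hs t0 Hu (Hu1 t t0) d1).
Qed.

(** The difference G(phi) - G(0, 0) is integrable by the Taylor bound at the origin. So the constant
G(0, 0) is integrable on the whole line, and must vanish. *)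
Lemma potential_at0 (s : R) (G g1 g2 : R * R -> R) (phi1 phi2 : R -> R) : 2^-1 < s ->
  (forall p, is_derive p dir1 G (g1 p)) -> (forall p, is_derive p dir2 G (g2 p)) ->
  smooth2 g1 -> smooth2 g2 -> g1 (0, 0) = 0 -> g2 (0, 0) = 0 ->
  inHs s phi1 -> inHs s phi2 -> intg (fun x => G (phi1 x, phi2 x)) -> G (0, 0) = 0.
Proof.
move=> hs D1 D2 s1 s2 g10 g20 h1 h2 IG.
have [M1 M10 b1] := Hs_bounded hs h1; have [M2 M20 b2] := Hs_bounded hs h2.
have l1 := inHs_l2 h1; have l2' := inHs_l2 h2.
have K0 : 0 <= M1 + M2 by rewrite addr_ge0.
have [L L0 hL] := potential_taylor (M1 + M2) D1 D2 s1 s2.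
have J : intg (fun x => G (phi1 x, phi2 x) - G (0, 0)).
  apply: intg_le_ae (intgZ L (intgD l1.2 l2'.2)).
    by apply: measurable_funB; [exact: intg_meas|exact: measurable_cst].
  apply: aeS2 b1 b2 => x a1 a2; have := hL (0, 0) (phi1 x, phi2 x).
  rewrite /= !normr0 g10 g20 !subr0 !mul0r addr0 subr0; apply=> //; lra.
apply: intg_cst0; have := intgB IG J; congr intg.
by apply/funext => x; rewrite subKr.
Qed.

(** From here on, a component enters only through its three weighted curves and their products,
which hides the kernel and the Fourier side. *)
Lemma component_summary (s rr : R) (beta : R -> R) (u u1 u2 f : R -> R -> R) (phi psi : R -> R) :
  2^-1 < s -> 2 <= rr -> kernel_hyp rr beta -> C2_Hs s I0 u u1 u2 ->
  (forall t, 0 <= t -> l2 (f t)) ->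
  (forall t, 0 <= t -> exists2 M : R, 0 <= M & {ae mu, forall x, `|f t x| <= M}) ->
  (forall t, 0 <= t -> ccont dot (fun r => rfun (f r)) t) ->
  (forall t, 0 < t -> weak_dxx (convolution beta (f t)) (u2 t)) ->
  inHs s phi -> inHs s psi -> ae_eq_fun (u 0) phi -> ae_eq_fun (u1 0) psi ->
  P_inL2 beta phi -> P_inL2 beta psi ->
  exists U V A : R -> @pfun R, [/\
    forall t, 0 <= t -> [/\ pl2 (U t), pl2 (V t), pl2 (A t), cdiff dot U (V t) t & cdiff dot V (A t) t],
    forall t, 0 <= t -> dot (V t) (A t) = - (2 * pi * \int[mu]_x (u1 t x * f t x)),
    forall t, 0 <= t -> dot (U t) (A t) = - (2 * pi * \int[mu]_x (u t x * f t x)) &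
    (L2norm (P_op beta psi) ^+ 2 = ((2 * pi)^-1 * dot (V 0) (V 0))%:E)%E].
Proof.
move=> hs hr hb hC lf fb fc heq hphi hpsi u0 u10 Pphi Ppsi.
exists (Uc beta u), (Vc beta u1), (Ac beta f); split.
- by move=> t t0; exact: (component_curves hs hr hb hC lf fb fc heq hphi hpsi u0 u10 Pphi Ppsi t0).
- by move=> t t0; exact: (dot_V_A hs hr hb hC lf fb fc heq hphi hpsi u0 u10 Pphi Ppsi t0).
- by move=> t t0; exact: (dot_U_A hs hr hb hC lf fb fc heq hphi hpsi u0 u10 Pphi Ppsi t0).
- exact: (initial_norm hr hb hC hpsi u10 Ppsi).
Qed.

Lemma cauchy_schwarz2 (x1 y1 x2 y2 : @pfun R) : pl2 x1 -> pl2 y1 -> pl2 x2 -> pl2 y2 ->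
  (dot x1 y1 + dot x2 y2) ^+ 2 <= (dot x1 x1 + dot x2 x2) * (dot y1 y1 + dot y2 y2).
Proof.
move=> lx1 ly1 lx2 ly2.
have c1 := cauchy_schwarz H lx1 ly1; have c2 := cauchy_schwarz H lx2 ly2.
rewrite -!(sqr_nm H)//.
have a1 := nm_ge0 dot x1; have a2 := nm_ge0 dot x2; have b1 := nm_ge0 dot y1; have b2 := nm_ge0 dot y2.
move: (nm dot x1) (nm dot x2) (nm dot y1) (nm dot y2) (dot x1 y1) (dot x2 y2) a1 a2 b1 b2 c1 c2.
move=> p1 p2 q1 q2 d1 d2 a1 a2 b1 b2 c1 c2.
have h : `|d1 + d2| <= p1 * q1 + p2 * q2 by apply: le_trans (ler_normD _ _) (lerD c1 c2).
have h2 : (d1 + d2) ^+ 2 <= (p1 * q1 + p2 * q2) ^+ 2.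
  by rewrite -[leLHS]real_normK ?num_real// ler_pXn2r ?nnegrE// addr_ge0// mulr_ge0.
apply: le_trans h2 _; rewrite -subr_ge0 (_ : _ - _ = (p1 * q2 - p2 * q1) ^+ 2) ?sqr_ge0//; ring.
Qed.

Lemma good_curve_ccont (u u' : R -> R -> R) t : good_curve u u' -> 0 <= t ->
  ccont dot (fun r => rfun (u r)) t.
Proof.
move=> c t0; apply: (cdiff_cont H t0 _ _ (gc_diff c t0)).
- by move=> r /(gc_l2 c)/pl2_rfun.
- by apply: pl2_rfun; exact: gc_l2' c _ t0.
Qed.

Lemma ccont_rfunD (f g : R -> R -> R) t : (forall r, 0 <= r -> l2 (f r)) ->
  (forall r, 0 <= r -> l2 (g r)) -> 0 <= t ->
  ccont dot (fun r => rfun (f r)) t -> ccont dot (fun r => rfun (g r)) t ->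
  ccont dot (fun r => rfun (fun x => f r x + g r x)) t.
Proof.
move=> lf lg t0 cf cg e e0; have e2 : 0 < e / 2 by rewrite divr_gt0.
have [d1 d10 h1] := cf _ e2; have [d2 d20 h2] := cg _ e2.
exists (Num.min d1 d2) => [|r r0]; first by rewrite lt_min d10.
rewrite lt_min => /andP[rd1 rd2].
have E (a b : R -> R) : rfun (fun x => a x + b x) = rfun a + rfun b.
  rewrite -[rfun b]scale1r rfun_lin; congr rfun.
  by apply/funext => x; rewrite mul1r.
rewrite !E opprD addrACA; apply: le_trans (nmD H _ _) _.
- by apply: (carB H); apply: pl2_rfun; exact: lf.
- by apply: (carB H); apply: pl2_rfun; exact: lg.
- by rewrite [leRHS]splitr; apply: lerD; [exact: h1|exact: h2].
Qed.

(** The derivatives of the norms follow from the product rule. The derivative 2 K <V, A> = - 2 Q of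
the kinetic term cancels that of 2 Phi: this is conservation of energy. The factor K
turns products on the Fourier side into products of functions. *)
Lemma energy_blowup (U1 V1 A1 U2 V2 A2 : R -> @pfun R) (S Q Phi : R -> R) (K nu : R) :
  0 < K -> 0 < nu ->
  (forall t, 0 <= t -> [/\ pl2 (U1 t), pl2 (V1 t), pl2 (A1 t), cdiff dot U1 (V1 t) t & cdiff dot V1 (A1 t) t]) ->
  (forall t, 0 <= t -> [/\ pl2 (U2 t), pl2 (V2 t), pl2 (A2 t), cdiff dot U2 (V2 t) t & cdiff dot V2 (A2 t) t]) ->
  (forall t, 0 <= t -> K * (dot (U1 t) (A1 t) + dot (U2 t) (A2 t)) = - S t) ->
  (forall t, 0 <= t -> K * (dot (V1 t) (A1 t) + dot (V2 t) (A2 t)) = - Q t) ->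
  (forall t, 0 <= t -> rdiff Phi (Q t) t) ->
  (forall t, 0 <= t -> S t <= 2 * (1 + 2 * nu) * Phi t) ->
  K * (dot (V1 0) (V1 0) + dot (V2 0) (V2 0)) + 2 * Phi 0 < 0 -> False.
Proof.
move=> K0 nu0 c1 c2 US VQ dPhi SPhi E0.
have K1 := ltW K0.
pose P t := K * (dot (U1 t) (U1 t) + dot (U2 t) (U2 t)).
pose C t := K * (dot (U1 t) (V1 t) + dot (U2 t) (V2 t)).
pose N t := K * (dot (V1 t) (V1 t) + dot (V2 t) (V2 t)).
have eqd (f : R -> R) l l' t : l = l' -> rdiff f l t -> rdiff f l' t by move=> ->.
have lU1 t : 0 <= t -> pl2 (U1 t) by move=> /c1[].
have lU2 t : 0 <= t -> pl2 (U2 t) by move=> /c2[].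
have lV1 t : 0 <= t -> pl2 (V1 t) by move=> /c1[].
have lV2 t : 0 <= t -> pl2 (V2 t) by move=> /c2[].
apply: (@levine R P C N S Phi nu) => //.
- move=> t t0; apply: mulr_ge0 => //; apply: addr_ge0; apply: (dot_ge0 H); [exact: lU1|exact: lU2].
- move=> t t0; apply: mulr_ge0 => //; apply: addr_ge0; apply: (dot_ge0 H); [exact: lV1|exact: lV2].
- move=> t t0; have := cauchy_schwarz2 (lU1 t t0) (lV1 t t0) (lU2 t t0) (lV2 t t0).
  rewrite /C /P /N exprMn; move: (_ + _) (dot (U1 t) _ + _) (_ + dot _ _) => x y z h.
  rewrite (_ : K * y * (K * x) = K ^+ 2 * (y * x)); last by ring.
  by rewrite ler_wpM2l// sqr_ge0.
- move=> t t0; have [u1 v1 a1 du1 dv1] := c1 t t0; have [u2 v2 a2 du2 dv2] := c2 t t0.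
  have d1 := dot_rdiff H t0 lU1 lU1 v1 v1 du1 du1; have d2 := dot_rdiff H t0 lU2 lU2 v2 v2 du2 du2.
  apply: eqd (rdiffZ K (rdiffD d1 d2)).
  by rewrite (dotC H (V1 t)) (dotC H (V2 t)) /C; ring.
- move=> t t0; have [u1 v1 a1 du1 dv1] := c1 t t0; have [u2 v2 a2 du2 dv2] := c2 t t0.
  have d1 := dot_rdiff H t0 lU1 lV1 v1 a1 du1 dv1; have d2 := dot_rdiff H t0 lU2 lV2 v2 a2 du2 dv2.
  apply: eqd (rdiffZ K (rdiffD d1 d2)).
  by rewrite -US// /N; ring.
- move=> t t0; have [u1 v1 a1 du1 dv1] := c1 t t0; have [u2 v2 a2 du2 dv2] := c2 t t0.
  have d1 := dot_rdiff H t0 lV1 lV1 a1 a1 dv1 dv1; have d2 := dot_rdiff H t0 lV2 lV2 a2 a2 dv2 dv2.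
  apply: eqd (rdiffD (rdiffZ K (rdiffD d1 d2)) (rdiffZ 2 (dPhi t t0))).
  have -> : Q t = - (K * (dot (V1 t) (A1 t) + dot (V2 t) (A2 t))) by rewrite VQ// opprK.
  by rewrite (dotC H (A1 t)) (dotC H (A2 t)); ring.
Qed.

Lemma initial_energy_lt0 (beta1 beta2 : R -> R) (G : R * R -> R) (phi1 phi2 psi1 psi2 : R -> R)
    (x y : R) :
  (L2norm (P_op beta1 psi1) ^+ 2 = x%:E)%E -> (L2norm (P_op beta2 psi2) ^+ 2 = y%:E)%E ->
  intg (fun x => energy_density G (phi1 x, phi2 x)) ->
  (initial_energy beta1 beta2 G phi1 phi2 psi1 psi2 < 0)%E ->
  x + y + 2 * \int[mu]_x energy_density G (phi1 x, phi2 x) < 0.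
Proof.
move=> ex ey IG.
have -> : initial_energy beta1 beta2 G phi1 phi2 psi1 psi2 =
    (x%:E + y%:E + 2%:E * (\int[mu]_x energy_density G (phi1 x, phi2 x))%:E)%E.
  exact: (congr2 +%E (congr2 +%E ex ey) (congr1 ( *%E 2%:E) (intg_fin IG))).
by rewrite -EFinM -!EFinD lte_fin.
Qed.

End GlobalSolutions.

Theorem theorem4p2 (R : realType) (s r1 r2 : R)
    (hs : 2^-1 < s) (hr1 : 2 <= r1) (hr2 : 2 <= r2)
    (beta1 beta2 : R -> R)
    (hbeta1 : kernel_hyp r1 beta1) (hbeta2 : kernel_hyp r2 beta2)
    (g1 g2 G : R * R -> R)
    (hg1 : smooth2 g1) (hg2 : smooth2 g2)
    (hg10 : g1 (0, 0) = 0) (hg20 : g2 (0, 0) = 0)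
    (hG1 : forall p, is_derive p dir1 G (g1 p))
    (hG2 : forall p, is_derive p dir2 G (g2 p))
    (phi1 phi2 psi1 psi2 : R -> R)
    (hphi1 : inHs s phi1) (hphi2 : inHs s phi2)
    (hpsi1 : inHs s psi1) (hpsi2 : inHs s psi2)
    (hPphi1 : P_inL2 beta1 phi1) (hPphi2 : P_inL2 beta2 phi2)
    (hPpsi1 : P_inL2 beta1 psi1) (hPpsi2 : P_inL2 beta2 psi2)
    (hGL1 : (@lebesgue_measure R).-integrable setT
              (fun x => (G (phi1 x, phi2 x))%:E))
    (nu : R) (hnu : 0 < nu)
    (hF : forall a b : R,
       a * (a + g1 (a, b)) + b * (b + g2 (a, b))
         <= 2 * (1 + 2 * nu) * energy_density G (a, b))
    (hE : (initial_energy beta1 beta2 G phi1 phi2 psi1 psi2 < 0)%E)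
    (Tmax : \bar R) (u1 u2 : R -> R -> R)
    (hu : maximal_solution s beta1 beta2 g1 g2 phi1 phi2 psi1 psi2 Tmax u1 u2) :
  (Tmax < +oo)%E.
Proof.
rewrite ltey; apply/negP => /eqP Too; move: hu; rewrite {}Too.
move=> [[_ [v1 [w1 [v2 [w2 [C1 C2 weq [u10 u20] [v10 v20]]]]]]] _].
have gc1 := good_curve_C2 hs C1; have gc2 := good_curve_C2 hs C2.
have lu1 := gc_l2 gc1; have lu2 := gc_l2 gc2.
have G0 := potential_at0 hs hG1 hG2 hg1 hg2 hg10 hg20 hphi1 hphi2 hGL1.
pose n1 t x := g1 (u1 t x, u2 t x); pose n2 t x := g2 (u1 t x, u2 t x).
pose f1 t x := u1 t x + n1 t x; pose f2 t x := u2 t x + n2 t x.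
have box0 t : 0 <= t -> exists2 K : R, 0 <= K &
    {ae @lebesgue_measure R, forall x, `|u1 t x| <= K /\ `|u2 t x| <= K}.
  move=> t0; have [K [d [K0 d0 hK]]] := good_curve_box gc1 gc2 t0.
  by exists K => //; apply: hK => //; rewrite subrr normr0.
have ln1 t : 0 <= t -> l2 (n1 t).
  by move=> t0; have [K K0 hK] := box0 t t0; have [] := superposition_l2 hg1 hg10 K0 (lu1 t t0) (lu2 t t0) hK.
have ln2 t : 0 <= t -> l2 (n2 t).
  by move=> t0; have [K K0 hK] := box0 t t0; have [] := superposition_l2 hg2 hg20 K0 (lu1 t t0) (lu2 t t0) hK.
have lf1 t : 0 <= t -> l2 (f1 t) by move=> t0; exact: l2D (lu1 t t0) (ln1 t t0).
have lf2 t : 0 <= t -> l2 (f2 t) by move=> t0; exact: l2D (lu2 t t0) (ln2 t t0).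
have fb1 t : 0 <= t -> exists2 M : R, 0 <= M & {ae @lebesgue_measure R, forall x, `|f1 t x| <= M}.
  move=> t0; have [K K0 hK] := box0 t t0.
  have [_ [M M0 hM]] := superposition_l2 hg1 hg10 K0 (lu1 t t0) (lu2 t t0) hK.
  exists (K + M); first by rewrite addr_ge0.
  by apply: aeS2 hK hM => x [a _] b; apply: le_trans (ler_normD _ _) _; exact: lerD.
have fb2 t : 0 <= t -> exists2 M : R, 0 <= M & {ae @lebesgue_measure R, forall x, `|f2 t x| <= M}.
  move=> t0; have [K K0 hK] := box0 t t0.
  have [_ [M M0 hM]] := superposition_l2 hg2 hg20 K0 (lu1 t t0) (lu2 t t0) hK.
  exists (K + M); first by rewrite addr_ge0.
  by apply: aeS2 hK hM => x [_ a] b; apply: le_trans (ler_normD _ _) _; exact: lerD.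
have fc1 t : 0 <= t -> ccont dot (fun r => rfun (f1 r)) t.
  move=> t0; apply: ccont_rfunD; [exact: lu1|exact: ln1|exact: t0|exact: good_curve_ccont gc1 t0|].
  exact: (superposition_ccont hg1 hg10 gc1 gc2 t0).
have fc2 t : 0 <= t -> ccont dot (fun r => rfun (f2 r)) t.
  move=> t0; apply: ccont_rfunD; [exact: lu2|exact: ln2|exact: t0|exact: good_curve_ccont gc2 t0|].
  exact: (superposition_ccont hg2 hg20 gc1 gc2 t0).
have weq1 t : 0 < t -> weak_dxx (convolution beta1 (f1 t)) (w1 t).
  by move=> t0; case: (weq t t0 (ltry t)).
have weq2 t : 0 < t -> weak_dxx (convolution beta2 (f2 t)) (w2 t).
  by move=> t0; case: (weq t t0 (ltry t)).
have [U1 [V1 [A1 [c1 va1 ua1 i1]]]] := component_summary hs hr1 hbeta1 C1 lf1 fb1 fc1 weq1 hphi1 hpsi1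
  u10 v10 hPphi1 hPpsi1.
have [U2 [V2 [A2 [c2 va2 ua2 i2]]]] := component_summary hs hr2 hbeta2 C2 lf2 fb2 fc2 weq2 hphi2 hpsi2
  u20 v20 hPphi2 hPpsi2.
(* S and Q pair the forces f_i with the solution and with its time derivative. *)
pose Phi t := \int[@lebesgue_measure R]_x energy_density G (u1 t x, u2 t x).
pose S t := \int[@lebesgue_measure R]_x (u1 t x * f1 t x) + \int[@lebesgue_measure R]_x (u2 t x * f2 t x).
pose Q t := \int[@lebesgue_measure R]_x (v1 t x * f1 t x) + \int[@lebesgue_measure R]_x (v2 t x * f2 t x).
have K0 : 0 < (2 * pi : R)^-1 by rewrite invr_gt0; exact: pi2_gt0.
have Kpi (a b : R) : (2 * pi)^-1 * (- (2 * pi * a) + - (2 * pi * b)) = - (a + b).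
  by rewrite -opprD -mulrDr mulrN mulKf// lt0r_neq0//; exact: pi2_gt0.
(* (2 pi)^-1 is the constant of Parseval's identity: with it, squared norms of the weighted curves
   are those of P_i u_i and of its time derivative. *)
apply: (@energy_blowup R U1 V1 A1 U2 V2 A2 S Q Phi (2 * pi)^-1 nu) => //.
- by move=> t t0; rewrite ua1// ua2// Kpi.
- by move=> t t0; rewrite va1// va2// Kpi.
- move=> t t0; have := potential_rdiff hG1 hG2 hg1 hg2 hg10 hg20 G0 gc1 gc2 t0.
  congr rdiff; congr (_ + _); apply: eq_Rintegral => x _; exact: mulrC.
- move=> t t0; have [K K0' hK] := box0 t t0.
  have IP := potential_intg hG1 hG2 hg1 hg2 hg10 hg20 G0 K0' (lu1 t t0) (lu2 t t0) hK.
  have I1 := l2M (lu1 t t0) (lf1 t t0); have I2 := l2M (lu2 t t0) (lf2 t t0).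
  rewrite /S /Phi -(RintD I1 I2) -(RintZ _ IP).
  apply: Rint_le; [exact: intgD|exact: intgZ|].
  by move=> x; exact: hF.
- have IPhi : intg (fun x => energy_density G (phi1 x, phi2 x)).
    have l1 := inHs_l2 hphi1; have l2' := inHs_l2 hphi2.
    exact: intgD (intgZ _ (intgD l1.2 l2'.2)) hGL1.
  have [K K0' hK] := box0 0 (lexx 0).
  have IP := potential_intg hG1 hG2 hg1 hg2 hg10 hg20 G0 K0' (lu1 0 (lexx 0)) (lu2 0 (lexx 0)) hK.
  have E : Phi 0 = \int[@lebesgue_measure R]_x energy_density G (phi1 x, phi2 x).
    apply: eq_ae_Rint; [exact: intg_meas|exact: intg_meas|].
    by apply: aeS2 u10 u20 => x -> ->.
  by have h := initial_energy_lt0 i1 i2 IPhi hE; rewrite mulrDr E.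
Qed.
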